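(* Let $R$ be a commutative ring with identity, let $n$ be a nonnegative integer, and let $(A,B)$ be a hypergroup over $\mathbb Z$ such that $R\otimes_{\mathbb Z}A$ is cellular over $R$ with respect to (the $R$-linear extension of) an anti-automorphism $\psi$ of the based ring $(A,B)$, with cell datum $(\Lambda_0,M_0,C_0,\psi)$. Equip $A$ with the trace map $\delta\cdot t$, where $\delta=v+v^{-1}$ and $t(a)$ is the coefficient of $1\in B$ in $a$. Then $R\otimes_{\mathbb Z}P_n^A$ is cellular over $R\otimes_{\mathbb Z}\mathcal A$, where $\mathcal A=\mathbb Z[v,v^{-1}]$. Explicitly, let $g$ be the automorphism of the based ring $(A,B)$ with $\psi=\bar{\ }\circ g$, and let $\alpha$ be the linear map of $P_n^A$ obtained by applying $g$ to the label of every edge of each canonical basis diagram. Let $(\Lambda,\Gamma,\mathbf B,M,C,* )$ be the table datum of $P_n^A$ described in the context, and let $\sigma_r$ be the permutation of $M(r)$ obtained by applying $g$ to all labels. For $r\in\Lambda$ let $(\Lambda_r,M_r,C_r,\psi^{\otimes r})$ be the $r$-fold tensor power cell datum of $R\otimes_{\mathbb Z}A^{\otimes r}$. Then a cell datum $(\Lambda',M',C',*')$ for $R\otimes_{\mathbb Z}P_n^A$ is given by: $\Lambda'=\{(r,\lambda'):r\in\Lambda,\lambda'\in\Lambda_r\}$ ordered lexicographically; $M'((r,\lambda'))=M(r)\times M_r(\lambda')$; $C'((S,s),(T,t))=C_{S,\sigma_r(T)}^{C_r(s,t)}$; and $*'=*\circ\alpha=\alpha\circ *$.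
   Context: **Hypergroup.** A hypergroup over $\mathbb Z$ is a pair $(A,B)$ with $A$ an associative unital $\mathbb Z$-algebra and $B$ a distinguished $\mathbb Z$-basis with $1\in B$ such that: (H1) structure constants with respect to $B$ are nonnegative integers; (H2) there is an algebra anti-automorphism $\bar{\ }$ of $A$ with square the identity and $\overline B=B$; (H3) if $\kappa(b,a)$ is the coefficient of $b\in B$ in $a\in A$, then $\kappa(b_m,b_ib_j)=\kappa(b_i,b_m\overline{b_j})$ for all $b_i,b_j,b_m\in B$. An automorphism (anti-automorphism) of the based ring $(A,B)$ is a ring automorphism (anti-automorphism) of $A$ permuting $B$. Every anti-automorphism of $(A,B)$ is uniquely of the form $\bar{\ }\circ g$ with $g$ an automorphism of $(A,B)$. The tensor power $A^{\otimes r}$ is a hypergroup with basis $B^{\otimes r}$ and anti-automorphism $\bar{\ }^{\otimes r}$; for $r=0$ it is $(\mathbb Z,\{1\})$. **Cellular algebra.** A cellular algebra over a commutative ring $R$ with $1$ is an associative unital $R$-algebra $A$ with a cell datum $(\Lambda,M,C,* )$ where: (C1) $\Lambda$ is a finite poset, $M(\lambda)$ is a finite set for each $\lambda$, and $C:\coprod_{\lambda}(M(\lambda)\times M(\lambda))\to A$ is injective with image an $R$-basis; (C2) writing $C(S,T)=C_{S,T}^\lambda$, $*$ is an $R$-linear involutory anti-automorphism with $(C_{S,T}^\lambda)^*=C_{T,S}^\lambda$; (C3) for all $a\in A$, $a\,C_{S,T}^\lambda\equiv\sum_{S'}r_a(S',S)C_{S',T}^\lambda\bmod A(<\lambda)$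 with $r_a(S',S)\in R$ independent of $T$, where $A(<\lambda)$ is the $R$-span of all $C_{S'',T''}^\mu$ with $\mu<\lambda$. ''Cellular with respect to $\psi$'' means there is a cell datum with $*=\psi$. The tensor product of cellular algebras with data $(\Lambda_1,M_1,C_1,*_1)$, $(\Lambda_2,M_2,C_2,*_2)$ has the cell datum with poset $\Lambda_1\times\Lambda_2$ (product order), $M(\lambda_1,\lambda_2)=M_1(\lambda_1)\times M_2(\lambda_2)$, $C((S_1,S_2),(T_1,T_2))=C_1(S_1,T_1)\otimes C_2(S_2,T_2)$ and $*=*_1\otimes *_2$; the $r$-fold tensor power datum is obtained by iterating this (for $r=0$: the trivial datum of $R$). **The algebra $P_n^A$.** The standard $n$-box is $[0,n+1]\times[0,1]$ with marked points $i=(i,1)$ and $2n+1-i=(i,0)$ for $1\le i\le n$. A Temperley–Lieb diagram is (the isotopy class of) a family of disjoint smooth curves (''edges'') in the box joining the $2n$ marked points in pairs, possibly with closed loops; edges carry the unique orientation such that edges exit the box at odd-numbered marked points and the orientation of each edge agrees with that induced as boundary of orientable complementary regions. An edge joining $y=0$ to $y=1$ is propagating; other non-closed edges are non-propagating. The canonical basis $\mathbf B_n^A$ of $P_n^A$ consists of all Temperley–Lieb diagrams with no closed loops in which each edge carries exactly one label from $B$. $P_n^A$ is the free $\mathcal A$-module on this basis; to multiply $X$ by $Y$, place $X$ on top of $Y$, rescale to a standard box, and reduce using: labels are multilinear; an unlabelled edge is the same as one labelled $1$; two labels on the same edge, where following the orientation one meets first $b$ and then $a$, are replaced by the single label $ab$;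 a closed loop labelled $a$ is removed and replaced by the scalar $\delta\, t(a)$. **Table datum of $P_n^A$.** $\Lambda=\{r:0\le r\le n,\ n-r\text{ even}\}$ with the natural order; $(\Gamma(r),\mathbf B(r))=(A^{\otimes r},B^{\otimes r})$; $M(r)$ is the set of configurations of $(n-r)/2$ labelled non-propagating edges with endpoints on $y=1$ arising from elements of $\mathbf B_n^A$. For $S,T\in M(r)$ and $b=b_{1}\otimes\cdots\otimes b_{r}\in B^{\otimes r}$, $C_{S,T}^b$ is the basis diagram whose top non-propagating edges are $S$, whose bottom non-propagating edges are $T$ turned upside down with arrows reversed and each label $c$ replaced by $\bar c$, and whose $k$-th propagating edge from the left is labelled $b_k$ if $k$ is odd and $\overline{b_k}$ if $k$ is even; $C_{S,T}^g$ is extended linearly in $g$. The map $*$ is the linear anti-automorphism reflecting a basis diagram in $y=1/2$, reversing all arrows, and replacing each label $b$ by $\bar b$. *)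

(* Defs.v *)
From HB Require Import structures.
From mathcomp Require Import all_boot all_order all_algebra finmap zify.
From mathcomp.multinomials Require Import monalg.

Set Implicit Arguments.
Unset Strict Implicit.
Unset Printing Implicit Defensive.

Import Order.TTheory GRing.Theory Num.Theory.
Local Open Scope ring_scope.

(* {malg K[X]} is used throughout as the free K-module on X: [g@_x] is the
   coefficient of the basis element << x >> in g.                           *)

Section FreeModule.
Variables (K : comNzRingType) (X : choiceType).

Definition lincomb (V : lmodType K) (e : X -> V) (f : {malg K[X]}) : V :=
  \sum_(x <- msupp f) f@_x *: e x.

Definition bilin (V : lmodType K) (mu : X -> X -> V)
    (x y : {malg K[X]}) : V :=
  lincomb (fun i => lincomb (mu i) y) x.

Definition is_basis (V : lmodType K) (e : X -> V) : Prop :=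
  forall v, exists! f : {malg K[X]}, lincomb e f = v.

(* The element a_0 (x) ... (x) a_{r-1} of the r-th tensor power of the free
   module on X, which is the free module on X^r.                            *)
Definition tensor (r : nat) (a : 'I_r -> {malg K[X]}) : {malg K[r.-tuple X]} :=
  let S := (\bigcup_(i <- enum 'I_r) msupp (a i))%fset in
  \sum_(f : {ffun 'I_r -> S})
     << \prod_(i < r) (a i)@_(val (f i)) *g [tuple val (f i) | i < r] >>.

Lemma lincombEw (V : lmodType K) (e : X -> V) (f : {malg K[X]}) (d : {fset X}) :
  (msupp f `<=` d)%fset -> lincomb e f = \sum_(x <- d) f@_x *: e x.
Proof.
move=> sfd; rewrite /lincomb; apply: big_fset_incl => // x _ /mcoeff_outdom ->.
by rewrite scale0r.
Qed.

Fact lincomb_is_linear (V : lmodType K) (e : X -> V) : linear (lincomb e).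
Proof.
move=> c f g; pose d := (msupp (c *: f + g) `|` (msupp f `|` msupp g))%fset.
have sd h : (msupp h `<=` (msupp f `|` msupp g) -> msupp h `<=` d)%fset.
  by move=> le; rewrite (fsubset_trans le) // fsubsetUr.
rewrite (@lincombEw _ _ _ d) ?fsubsetUl //.
rewrite (@lincombEw _ _ f d) ?sd ?fsubsetUl //.
rewrite (@lincombEw _ _ g d) ?sd ?fsubsetUr //.
rewrite scaler_sumr -big_split; apply: eq_bigr => x _ /=.
by rewrite mcoeffD mcoeffZ scalerDl scalerA.
Qed.

HB.instance Definition _ (V : lmodType K) (e : X -> V) :=
  GRing.isLinear.Build K {malg K[X]} V *:%R (lincomb e) (lincomb_is_linear e).

Lemma lincombU (V : lmodType K) (e : X -> V) c x :
  lincomb e << c *g x >> = c *: e x.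
Proof. by rewrite (lincombEw _ msuppU_le) big_seq_fset1 mcoeffUU. Qed.

End FreeModule.

(* Extension of scalars along f : K -> K' of an element of a free module.   *)
Definition base_change (K K' : nzRingType) (f : K -> K') (X : choiceType)
    (c : {malg K[X]}) : {malg K'[X]} :=
  \sum_(x <- msupp c) << f c@_x *g x >>.

Section Laurent.
Variable R : comNzRingType.

(* R[v, v^-1]; << c *g i >> is c * v ^ i.                                   *)
Definition laurent : Type := {malg R[int]}.
HB.instance Definition _ := GRing.Lmodule.on laurent.

Definition laurent_mul (p q : laurent) : laurent :=
  bilin (fun i j : int => << i + j >> : {malg R[int]}) p q.
Definition laurent_one : laurent := << 0%Z >>.

Fact laurent_mulDl : left_distributive laurent_mul +%R.
Proof. by move=> p q s; rewrite /laurent_mul /bilin linearD. Qed.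

Fact laurent_mulUU (c d : R) (i j : int) :
  laurent_mul << c *g i >> << d *g j >> = << c * d *g i + j >>.
Proof.
rewrite /laurent_mul /bilin !lincombU scalerA.
by apply/malgP=> k; rewrite mcoeffZ !mcoeffU mulrnAr mulr1.
Qed.

Fact laurent_mulC : commutative laurent_mul.
Proof.
move=> p q; rewrite /laurent_mul /bilin /lincomb.
under eq_bigr do rewrite scaler_sumr.
under [RHS]eq_bigr do rewrite scaler_sumr.
rewrite exchange_big; apply: eq_bigr => i _; apply: eq_bigr => j _.
by rewrite !scalerA mulrC addrC.
Qed.

Fact laurent_mulDr : right_distributive laurent_mul +%R.
Proof. by move=> p q s; rewrite ![laurent_mul p _]laurent_mulC laurent_mulDl. Qed.

Fact laurent_ind (P : laurent -> Prop) :
  P 0 -> (forall p q, P p -> P q -> P (p + q)) ->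
  (forall c i, P << c *g i >>) -> forall p, P p.
Proof.
by move=> P0 PD PU p; rewrite [p]monalgE; elim/big_ind: _ => // i _; apply: PU.
Qed.

Fact laurent_mul0 p : laurent_mul 0 p = 0.
Proof. by rewrite /laurent_mul /bilin linear0. Qed.

Fact laurent_mulA : associative laurent_mul.
Proof.
move=> p q s; elim/laurent_ind: p => [|p p' IHp IHp'|c i].
- by rewrite !laurent_mul0.
- by rewrite !laurent_mulDl IHp IHp'.
elim/laurent_ind: q => [|q q' IHq IHq'|d j].
- by rewrite [laurent_mul _ 0]laurent_mulC !laurent_mul0 laurent_mulC laurent_mul0.
- by rewrite !(laurent_mulDl, laurent_mulDr) IHq IHq'.
elim/laurent_ind: s => [|s s' IHs IHs'|e k].
- by rewrite ![laurent_mul _ 0]laurent_mulC !laurent_mul0 laurent_mulC laurent_mul0.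
- by rewrite !laurent_mulDr IHs IHs'.
by rewrite !laurent_mulUU mulrA addrA.
Qed.

Fact laurent_mul1 : left_id laurent_one laurent_mul.
Proof.
move=> p; elim/laurent_ind: p => [|p q IHp IHq|c i].
- by rewrite laurent_mulC laurent_mul0.
- by rewrite laurent_mulDr IHp IHq.
by rewrite laurent_mulUU mul1r add0r.
Qed.

Fact laurent_one_neq0 : laurent_one != 0.
Proof. by rewrite monalgU_eq0 oner_eq0. Qed.

HB.instance Definition _ := GRing.Zmodule_isComNzRing.Build laurent
  laurent_mulA laurent_mulC laurent_mul1 laurent_mulDl laurent_one_neq0.

Definition laurentC (c : R) : laurent := << c *g 0%Z >>.

End Laurent.

Definition laurent_map (R R' : comNzRingType) (f : R -> R') :
  laurent R -> laurent R' := @base_change R R' f int.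

(* delta = v + v^-1 in Z[v, v^-1].                                          *)
Definition delta : laurent int := << 1%Z >> + << (- 1)%Z >>.

Record assoc_unital_algebra (K : comNzRingType) (V : lmodType K)
    (mul : V -> V -> V) (one : V) : Prop := AssocUnitalAlgebra {
  aua_linearl : forall y, linear (fun x => mul x y);
  aua_linearr : forall x, linear (mul x);
  aua_mulA : associative mul;
  aua_mul1l : left_id one mul;
  aua_mul1r : right_id one mul
}.

(* The raw data (Lambda, M, C, star); the finiteness of the index sets M(lambda)
   is part of [is_cell_datum].                                              *)
Record cell_datum (V : Type) := CellDatum {
  cd_disp : Order.disp_t;
  cd_poset :> finPOrderType cd_disp;
  cd_M : cd_poset -> choiceType;
  cd_C : forall l : cd_poset, cd_M l -> cd_M l -> V;
  cd_star : V -> V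
}.

Section Cellular.
Variables (K : comNzRingType) (V : lmodType K).
Variables (mul : V -> V -> V) (one : V) (D : cell_datum V).

Definition cell_index := {l : D & (cd_M l * cd_M l)%type}.

Definition cell_elt (x : cell_index) : V :=
  cd_C (tagged x).1 (tagged x).2.

Definition lower_cells (l : D) (v : V) : Prop :=
  exists2 f : {malg K[cell_index]},
    (forall x, x \in msupp f -> (tag x < l)%O) & v = lincomb cell_elt f.

(* In the last field, [ra S] is the function S' |-> r_a(S', S).              *)
Record is_cell_datum : Prop := IsCellDatum {
  cd_algebra : assoc_unital_algebra mul one;
  cd_finM : forall l : D, exists s : seq (cd_M l), forall S, S \in s;
  cd_C_inj : injective cell_elt;
  cd_C_basis : is_basis cell_elt;
  cd_star_linear : linear (cd_star D);
  cd_star_invol : involutive (cd_star D);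
  cd_star_antimul : forall a b, cd_star D (mul a b) = mul (cd_star D b) (cd_star D a);
  cd_star_C : forall (l : D) (S T : cd_M l), cd_star D (cd_C S T) = cd_C T S;
  cd_C3 : forall (a : V) (l : D), exists ra : cd_M l -> {malg K[cd_M l]},
    forall S T : cd_M l,
      lower_cells l (mul a (cd_C S T) - lincomb (fun S' => cd_C S' T) (ra S))
}.

End Cellular.

Definition cellular (K : comNzRingType) (V : lmodType K) (mul : V -> V -> V)
  (one : V) : Prop := exists D : cell_datum V, is_cell_datum mul one D.

(* Automorphisms and anti-automorphisms f of a ring A that permute the
   distinguished family e : B -> A; fB is the permutation induced on B.     *)
Record is_based_aut (A : pzRingType) (B : choiceType) (e : B -> A)
    (f : A -> A) (fB : B -> B) : Prop := IsBasedAut {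
  ba_add : {morph f : x y / x + y};
  ba_mul : {morph f : x y / x * y};
  ba_one : f 1 = 1;
  ba_bij : bijective f;
  ba_bijB : bijective fB;
  ba_basis : forall b, f (e b) = e (fB b)
}.

Record is_based_antiaut (A : pzRingType) (B : choiceType) (e : B -> A)
    (f : A -> A) (fB : B -> B) : Prop := IsBasedAntiaut {
  bna_add : {morph f : x y / x + y};
  bna_mul : forall x y, f (x * y) = f y * f x;
  bna_one : f 1 = 1;
  bna_bij : bijective f;
  bna_bijB : bijective fB;
  bna_basis : forall b, f (e b) = e (fB b)
}.

(* The distinguished basis B of A is the family [hg_emb]; [hg_coord a] is the
   coordinate vector of a, so that kappa(b, a) = (hg_coord a)@_b. The fields
   [hg_coordK] and [hg_embK] say that [hg_emb] is a Z-basis of A.           *)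
Record hypergroup := Hypergroup {
  hg_alg :> pzRingType;
  hg_bas : choiceType;
  hg_emb : hg_bas -> hg_alg;
  hg_coord : hg_alg -> {malg int[hg_bas]};
  hg_coordK : forall a, \sum_(b <- msupp (hg_coord a)) hg_emb b *~ (hg_coord a)@_b = a;
  hg_embK : forall f : {malg int[hg_bas]},
    hg_coord (\sum_(b <- msupp f) hg_emb b *~ f@_b) = f;
  hg_one : hg_bas;
  hg_emb1 : hg_emb hg_one = 1;
  hg_ge0 : forall b1 b2 b, 0 <= (hg_coord (hg_emb b1 * hg_emb b2))@_b;
  hg_bar : hg_alg -> hg_alg;
  hg_barB : hg_bas -> hg_bas;
  hg_bar_antiaut : is_based_antiaut hg_emb hg_bar hg_barB;
  hg_bar_invol : involutive hg_bar;
  hg_frob : forall bi bj bm,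
    (hg_coord (hg_emb bi * hg_emb bj))@_bm
      = (hg_coord (hg_emb bm * hg_bar (hg_emb bj)))@_bi
}.

Section Hypergroup.
Variable H : hypergroup.
Local Notation B := (hg_bas H).
Local Notation emb := (@hg_emb H).

Definition hg_trace (a : H) : int := (hg_coord a)@_(hg_one H).

Section BaseChange.
Variable R : comNzRingType.

(* R (x)_Z A is the free R-module on B, with the structure constants of A.  *)
Definition hgR : lmodType R := {malg R[B]}.
Definition hgR_mul : hgR -> hgR -> hgR :=
  bilin (fun b c => base_change (fun z : int => z%:~R : R) (hg_coord (emb b * emb c))
                    : {malg R[B]}).
Definition hgR_one : hgR := << hg_one H >>.
(* R-linear extension of an additive map of A that sends b to fB b.         *)
Definition hgR_map (fB : B -> B) : hgR -> hgR :=
  lincomb (fun b => << fB b >> : {malg R[B]}).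

End BaseChange.
End Hypergroup.

(* Marked points are numbered clockwise; the point numbered j + 1 is
   j : 'I_(n + n). Thus the top points are the j < n (left to right), the bottom
   point below the top point j is [rev_ord j], and edges exit at the even j.
   An isotopy class of loop-free diagrams is a non-crossing perfect matching. *)
Section Diagrams.
Variable n : nat.
Local Notation pt := 'I_(n + n).

Definition enters (j : pt) : bool := odd j.

Definition planar_matching (m : {ffun pt -> pt}) : bool :=
  [&& [forall j : pt, m (m j) == j], [forall j : pt, m j != j]
    & [forall i : pt, forall j : pt, ~~ [&& (i < j)%N, (j < m i)%N & (m i < m j)%N]]].

Section Labelled.
Variable B : choiceType.

(* The label of an edge is recorded at both of its endpoints.               *)
Definition is_diagram (x : {ffun pt -> pt} * {ffun pt -> B}) : bool :=
  planar_matching x.1 && [forall j : pt, x.2 (x.1 j) == x.2 j].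

Definition diagram := {x : {ffun pt -> pt} * {ffun pt -> B} | is_diagram x}.

Definition dmatch (X : diagram) : {ffun pt -> pt} := (val X).1.
Definition dlabel (X : diagram) : {ffun pt -> B} := (val X).2.

(* The canonical basis element with the given matching and labels; all uses
   below are for arguments satisfying [is_diagram], 0 is a dummy value.     *)
Definition diagram_elt (K : comNzRingType) (m : {ffun pt -> pt})
    (l : {ffun pt -> B}) : {malg K[diagram]} :=
  if insub (m, l) is Some X then << X >> else 0.

Fact id_is_diagram (b : B) : is_diagram ([ffun j => rev_ord j], [ffun=> b]).
Proof.
apply/andP; split; last by apply/forallP=> j; rewrite !ffunE.
apply/and3P; split.
- by apply/forallP=> j; rewrite !ffunE rev_ordK.
- by apply/forallP=> j; rewrite ffunE -val_eqE /=; have := ltn_ord j; lia.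
by apply/forallP=> i; apply/forallP=> j; rewrite !ffunE /=; have := ltn_ord j; lia.
Qed.

Definition id_diagram (b : B) : diagram := Sub _ (id_is_diagram b).

Fact map_is_diagram (g : B -> B) (X : diagram) :
  is_diagram (dmatch X, [ffun j => g (dlabel X j)]).
Proof.
case/andP: (valP X) => pX /forallP lX; apply/andP; split=> //.
by apply/forallP=> j; rewrite !ffunE /= (eqP (lX j)).
Qed.

Definition map_diagram (g : B -> B) (X : diagram) : diagram :=
  Sub _ (map_is_diagram g X).

Fact reflect_is_diagram (g : B -> B) (X : diagram) :
  is_diagram ([ffun j => rev_ord (dmatch X (rev_ord j))],
              [ffun j => g (dlabel X (rev_ord j))]).
Proof.
case/andP: (valP X) => /and3P[/forallP mK /forallP mn /forallP mc] /forallP lX.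
apply/andP; split; last by apply/forallP=> j; rewrite !ffunE rev_ordK (eqP (lX _)).
apply/and3P; split.
- by apply/forallP=> j; rewrite !ffunE rev_ordK (eqP (mK _)) rev_ordK.
- apply/forallP=> j; rewrite ffunE; apply/eqP=> E.
  by have := mn (rev_ord j); rewrite -{2}E rev_ordK eqxx.
apply/forallP=> i; apply/forallP=> j; rewrite !ffunE.
have /forallP/(_ (dmatch X (rev_ord i))) := mc (dmatch X (rev_ord j)).
rewrite !(eqP (mK _)) /=.
have := (ltn_ord (dmatch X (rev_ord i)), ltn_ord (dmatch X (rev_ord j))).
by case; have := (ltn_ord i, ltn_ord j); case; lia.
Qed.

(* Reflection in y = 1/2, with g applied to the labels.                     *)
Definition reflect_diagram (g : B -> B) (X : diagram) : diagram :=
  Sub _ (reflect_is_diagram g X).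

End Labelled.
End Diagrams.

(* The product of X and Y is traced in the box of X (tag [true]) stacked on top
   of the box of Y (tag [false]). A point at the bottom of X and the point of Y
   that it meets are (true, j) and (false, rev_ord j).                      *)
Section Stacking.
Variables (n : nat) (B : choiceType) (X Y : diagram n B).
Local Notation pt := 'I_(n + n).

Definition stack_pt := (bool * pt)%type.

Definition stack_end (w : stack_pt) : stack_pt :=
  (w.1, (if w.1 then dmatch X else dmatch Y) w.2).

Definition stack_label (w : stack_pt) : B :=
  (if w.1 then dlabel X else dlabel Y) w.2.

(* w lies on the top of X or on the bottom of Y.                            *)
Definition stack_outer (w : stack_pt) : bool := w.1 == (w.2 < n)%N.

(* Follow the edge starting at w, then cross over to the other box. When the
   edge ends at an outer point, this instead crosses from the top of X to the
   bottom of Y or back, which makes [stack_next] a permutation.             *)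
Definition stack_next (w : stack_pt) : stack_pt :=
  let w' := stack_end w in (~~ w'.1, rev_ord w'.2).

Definition stack_in (j : pt) : stack_pt := ((j < n)%N, j).

(* Starting points of the successive edges traversed from the outer point j to
   the first outer point reached.                                           *)
Definition stack_path (j : pt) : seq stack_pt :=
  let o := orbit stack_next (stack_in j) in
  take (find (fun w => stack_outer (stack_end w)) o).+1 o.

Definition comp_match : {ffun pt -> pt} :=
  [ffun j => (stack_end (last (stack_in j) (stack_path j))).2].

(* One starting point, traversed along the orientation, for each closed loop.
   As t(ab) = t(ba), the choice made by [froot] is immaterial.              *)
Definition is_loop_base (w : stack_pt) : bool :=
  [&& enters w.2, froot stack_next w == w
    & ~~ has (fun w' => stack_outer (stack_end w')) (orbit stack_next w)].

End Stacking.

Section TLAlgebra.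
Variables (n : nat) (H : hypergroup).
Local Notation pt := 'I_(n + n).
Local Notation B := (hg_bas H).
Local Notation D := (diagram n B).

(* Meeting first b and then a along an edge produces the label ab.          *)
Definition path_label (X Y : D) (p : seq (stack_pt n)) : H :=
  \prod_(w <- rev p) hg_emb (stack_label X Y w).

(* Meaningful when j is an entering point, so that the path is oriented.    *)
Definition comp_label (X Y : D) (j : pt) : H :=
  path_label X Y (stack_path X Y j).

Definition loop_scalar (X Y : D) : laurent int :=
  \prod_(w | is_loop_base X Y w)
    (delta * laurentC (hg_trace (path_label X Y (orbit (stack_next X Y) w)))).

(* Expansion of the labels of the edges of the product over B: the sum is over
   the families of one label (in a sufficiently large finite part S of B) for
   each edge; each edge has exactly one entering endpoint.                  *)
Definition diagram_mul (X Y : D) : {malg (laurent int)[D]} :=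
  let m := comp_match X Y in
  let S := (\bigcup_(j <- enum pt | enters j)
              msupp (hg_coord (comp_label X Y j)))%fset in
  loop_scalar X Y *:
  \sum_(l : {ffun pt -> S} | [forall j : pt, l (m j) == l j])
     laurentC (\prod_(j : pt | enters j) (hg_coord (comp_label X Y j))@_(val (l j)))
       *: diagram_elt (laurent int) m [ffun j => val (l j)].

Section BaseChangeTL.
Variable R : comNzRingType.

(* R (x)_Z P_n^A over R (x)_Z Z[v, v^-1] = R[v, v^-1].                      *)
Definition tlR : lmodType (laurent R) := {malg (laurent R)[D]}.

Definition tlR_mul : tlR -> tlR -> tlR :=
  bilin (fun X Y => base_change (laurent_map (fun z : int => z%:~R : R))
                                (diagram_mul X Y) : {malg (laurent R)[D]}).
Definition tlR_one : tlR := << id_diagram n (hg_one H) >>.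

(* Linear extensions of reflection with bar on the labels, and of g acting on
   the labels.                                                              *)
Definition tlR_star : tlR -> tlR :=
  lincomb (fun X => << reflect_diagram (@hg_barB H) X >> : {malg (laurent R)[D]}).
Definition tlR_alpha (gB : B -> B) : tlR -> tlR :=
  lincomb (fun X => << map_diagram gB X >> : {malg (laurent R)[D]}).

End BaseChangeTL.
End TLAlgebra.

Section Table.
Variable n : nat.
Local Notation pt := 'I_(n + n).

Definition table_index := {r : 'I_n.+1 | ~~ odd (n - r)}.
HB.instance Definition _ := SubFinite.on table_index.
HB.instance Definition _ :=
  [SubChoice_isSubOrder of table_index by <: with Order.OrdinalOrder.ord_display].

(* The non-propagating edges at the top of a diagram with matching m.       *)
Definition top_arc (m : {ffun pt -> pt}) (j : 'I_n) : option 'I_n :=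
  if split (m (lshift n j)) is inl k then Some k else None.

Section HalfDiagrams.
Variable B : choiceType.

(* c j = Some (k, b) when j is joined to k by an edge labelled b, and
   c j = None when no edge of the configuration ends at j.                  *)
Definition config := {ffun 'I_n -> option ('I_n * B)}.

Definition is_half (r : nat) (c : config) : bool :=
  [&& [forall j, if c j is Some (k, b) then c k == Some (j, b) else true],
      #|[pred j | c j == None]| == r
    & [exists m : {ffun pt -> pt}, planar_matching m &&
         [forall j, omap fst (c j) == top_arc m j]]].

Definition half (r : nat) := {c : config | is_half r c}.

Fact map_is_half (g : B -> B) (r : nat) (S : half r) :
  is_half r [ffun j => omap (fun kb => (kb.1, g kb.2)) (val S j)].
Proof.
case: S => c /= /and3P[/forallP c_sym /eqP c_r /existsP[m /andP[m_pl /forallP m_c]]].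
apply/and3P; split.
- apply/forallP=> j; rewrite ffunE; have := c_sym j.
  by case: (c j) => [[k b]|] //= /eqP ck; rewrite ffunE ck.
- rewrite -c_r; apply/eqP; apply: eq_card => j.
  by rewrite !inE ffunE; case: (c j).
apply/existsP; exists m; rewrite m_pl; apply/forallP=> j.
by rewrite ffunE -(eqP (m_c j)); case: (c j) => [[]|].
Qed.

Definition map_half (g : B -> B) (r : nat) (S : half r) : half r :=
  Sub _ (map_is_half g S).

(* The points of S that carry a propagating edge, from left to right.       *)
Definition free_points (r : nat) (S : half r) : seq 'I_n :=
  [seq i <- enum 'I_n | val S i == None].

Definition bottom_point (i : 'I_n) : pt := rev_ord (lshift n i).

(* The i-th point at the bottom, for j = inr i, lies below the top point
   [rev_ord i].                                                             *)
Definition table_match (r : nat) (S T : half r) : {ffun pt -> pt} :=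
  [ffun j => match split j with
   | inl i =>
     if val S i is Some (k, _) then lshift n k
     else bottom_point (nth i (free_points T) (index i (free_points S)))
   | inr i => let p := rev_ord i in
     if val T p is Some (k, _) then bottom_point k
     else lshift n (nth p (free_points S) (index p (free_points T)))
   end].

End HalfDiagrams.

Variable H : hypergroup.
Local Notation B := (hg_bas H).

(* The propagating edge of index k is the (k + 1)-st from the left, whence the
   label b_{k+1} for k even. The default value of [nth] is not used.        *)
Definition prop_label (r : nat) (b : r.-tuple B) (k : nat) : B :=
  let bk := nth (hg_one H) b k in if odd k then hg_barB bk else bk.

Definition table_label (r : nat) (S T : half B r) (b : r.-tuple B) : {ffun pt -> B} :=
  [ffun j => match split j with
   | inl i => if val S i is Some (_, c) then c
              else prop_label b (index i (free_points S))
   | inr i => let p := rev_ord i in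
              if val T p is Some (_, c) then hg_barB c
              else prop_label b (index p (free_points T))
   end].

Section CellDatum.
Variable R : comNzRingType.

(* C_{S,T}^b, and its linear extension C_{S,T}^a to a in R (x)_Z A^{(x) r}.  *)
Definition table_C (r : nat) (S T : half B r) (b : r.-tuple B) : tlR n H R :=
  diagram_elt (laurent R) (table_match S T) (table_label S T b).

Definition table_Clin (r : nat) (S T : half B r) (a : {malg R[r.-tuple B]}) :
    tlR n H R :=
  lincomb (table_C S T) (base_change (@laurentC R) a).

Variables (D0 : cell_datum (hgR H R)) (gB : B -> B).

(* The r-fold tensor power of D0 is indexed by r.-tuples in the poset of D0 with
   the product order. The poset below has the lexicographic order of sigma types. *)
Definition tl_poset := {r : table_index & (val r).-tupleprod D0}.

Definition tl_M (x : tl_poset) : choiceType :=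
  (half B (val (tag x)) *
   {dffun forall i : 'I_(val (tag x)), cd_M (tnth (tagged x) i)})%type.

Definition power_C (x : tl_poset)
    (s t : {dffun forall i : 'I_(val (tag x)), cd_M (tnth (tagged x) i)}) :
    {malg R[(val (tag x)).-tuple B]} :=
  tensor (fun i => cd_C (s i) (t i)).

Definition tl_C (x : tl_poset) (Ss Tt : tl_M x) : tlR n H R :=
  table_Clin Ss.1 (map_half gB Tt.1) (power_C Ss.2 Tt.2).

Definition tl_cell_datum : cell_datum (tlR n H R) :=
  CellDatum tl_C (@tlR_star n H R \o @tlR_alpha n H R gB).

End CellDatum.
End Table.

(* Main.v *)
From HB Require Import structures.
From mathcomp Require Import all_boot all_order all_algebra finmap zify.
From mathcomp.multinomials Require Import monalg.
Require Import Defs.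

(** Why the theorem holds.

    The argument is that of Graham and Lehrer for the Temperley-Lieb algebra, with
    the tensor powers of the cell datum of the label algebra inserted on the
    propagating edges. What makes it long is that the algebra axioms of the diagram
    algebra are part of the claim.

    Associativity, antimultiplicativity of the reflections and the unit laws are
    reduced to closed diagrams on an annulus. A ring of boxes has a value: the
    product, over the cycles of the permutation that follows the edges from box to
    box, of delta times the trace of the label of the cycle ([ring_value]).
    Replacing a product X * Y in the ring by its two factors replaces a permutation
    by another one of which it is the first-return map, and the value does not
    change ([zeta_first_return], [ring_value_split], [ring_valueD_split]): the loops
    that get lost are those that the product turns into scalars. Thus X * Y is
    characterised by its pairings with all diagrams W, that is, by the rings of X, Y
    and W, as soon as the pairing is nondegenerate. It is, by a degree argument: the
    closure of X on W has at most n loops, and exactly n only if W is the mirror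
    image of X ([tpairD_lead], [tpair_nondeg]). Both bracketings of a triple product
    pair with W to the ring of four boxes ([prodD_assoc]), and reading a ring
    backwards shows that reflections reverse products ([prodD_refl]). That stacking
    preserves planarity is proved by counting modulo 2 the edges of one path that
    separate the points of another from the left end ([comp_planar]).

    A diagram is the same thing as its two halves with the labels of its propagating
    edges ([tdiag_ix_surj], [tdiag_ix_inj]). The arcs at the bottom of Y stay at the
    bottom of X * Y. Hence, modulo diagrams with fewer propagating edges,
    X * C_{S,S}^1 is a combination of elements C_{S',S}^a. Multiply it by C_{S,T}^b:
    as C_{S',S}^a * C_{S,T}^b is delta^k C_{S',T}^{ab}, where k is the number of arcs
    of S ([prodD_tableE]), and as powers of delta can be cancelled ([deltaR_lead]),
    the product X * C_{S,T}^b is, modulo fewer propagating edges, a combination of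
    elements C_{S',T}^{ab} with coefficients that depend neither on T nor on b
    ([mul_straighten]). It remains to straighten the products ab in the tensor power
    of the label algebra, one tensor factor at a time ([act_cell_pow]). The errors of
    the two kinds lower the first, resp. the second component of the lexicographic
    order.

    For the involution, write psi as the conjugation composed with g. Reflecting
    C_{S,T}^b conjugates the labels of the half diagrams, which the definition of
    C_{S,T}^b did already for T; with psi in place of the conjugation g is left over,
    and the twist of T by g in the cells absorbs it ([reflect_tdiag]). *)


Set Implicit Arguments.
Unset Strict Implicit.
Unset Printing Implicit Defensive.

Import Order.TTheory GRing.Theory Num.Theory.
Local Open Scope ring_scope.
(** * Multi-additive maps and free modules *)

Section MultiAdditive.
Variables (F : finType) (A V : zmodType).

Fact upd_key : unit. Proof. exact: tt. Qed.
Definition upd : {ffun F -> A} -> F -> A -> {ffun F -> A} :=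
  locked_with upd_key (fun l j a => [ffun i => if i == j then a else l i]).

Lemma updE l j a i : upd l j a i = if i == j then a else l i.
Proof. by rewrite /upd unlock ffunE. Qed.

Definition multiadditive (Phi : {ffun F -> A} -> V) :=
  forall j l a b, Phi (upd l j (a - b)) = Phi (upd l j a) - Phi (upd l j b).

(** Generation as an additive group, in the form of an induction principle. *)
Definition additive_gen (G : A -> Prop) :=
  forall Q : A -> Prop, Q 0 -> (forall x y, Q x -> Q y -> Q (x - y)) ->
  (forall x, G x -> Q x) -> forall x, Q x.

Lemma upd_id l j : upd l j (l j) = l.
Proof. by apply/ffunP=> i; rewrite updE; case: eqP => [->|]. Qed.

(** The arguments are moved from the generators to arbitrary values one at a
    time. This is how identities known for diagrams with labels in the basis of
    the hypergroup are extended to labels in the algebra. *)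
Lemma multiadd_ext (G : A -> Prop) (Phi Psi : {ffun F -> A} -> V) :
  additive_gen G -> multiadditive Phi -> multiadditive Psi ->
  (forall l : {ffun F -> A}, (forall j, G (l j)) -> Phi l = Psi l) -> Phi =1 Psi.
Proof.
move=> gen aPhi aPsi eqG l.
have{eqG} eqs : forall (s : seq F) (l : {ffun F -> A}), (forall j, j \notin s -> G (l j)) -> Phi l = Psi l.
  elim=> [|j s IHs] {}l Gl; first by apply: eqG => j; apply: Gl.
  rewrite -(upd_id l j).
  apply: (gen (fun a => Phi (upd l j a) = Psi (upd l j a))).
  - by rewrite -(subrr (0 : A)) aPhi aPsi !subrr.
  - by move=> x y Ex Ey; rewrite aPhi aPsi Ex Ey.
  move=> x Gx; apply: IHs => i is_; rewrite updE; case: eqP => // /eqP ij.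
  by apply: Gl; rewrite inE (negPf ij).
by apply: (eqs (enum F)) => j; rewrite mem_enum.
Qed.

End MultiAdditive.

Lemma finite_choice (T : eqType) (U : Type) (u0 : U) (P : T -> U -> Prop) (s : seq T) :
  (forall x, x \in s) -> (forall x, exists y, P x y) -> exists f, forall x, P x (f x).
Proof.
move=> sT exP.
suff: forall s : seq T, exists f, forall x, x \in s -> P x (f x).
  by case/(_ s) => f fP; exists f => x; apply: fP.
elim=> [|x t [f fP]]; first by exists (fun=> u0).
have [y Py] := exP x; exists (fun z => if z == x then y else f z) => z.
by rewrite inE; case: eqP => [->|_ /fP].
Qed.

Lemma seq_max (s : seq int) : s != [::] ->
  exists2 m, m \in s & forall k, k \in s -> k <= m.
Proof.
elim: s => // x s IHs _; have [->|/IHs[m ms mP]] := eqVneq s [::].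
  by exists x; rewrite ?inE // => k; rewrite inE => /eqP->.
have [le|/ltW le] := lerP m x.
  exists x; first by rewrite inE eqxx.
  by move=> k; rewrite inE => /predU1P[->//|/mP km]; apply: le_trans km le.
exists m; first by rewrite inE ms orbT.
by move=> k; rewrite inE => /predU1P[->//|/mP].
Qed.

Section FreeModules.
Variables (K : comNzRingType).

Lemma malg_ind (X : choiceType) (P : {malg K[X]} -> Prop) :
  P 0 -> (forall f g, P f -> P g -> P (f + g)) ->
  (forall c x, P << c *g x >>) -> forall f, P f.
Proof. by move=> P0 PD PU f; rewrite [f]monalgE; elim/big_ind: _. Qed.

Lemma malg_gen (X : choiceType) :
  additive_gen (fun f : {malg K[X]} => exists c x, f = << c *g x >>).
Proof.
move=> Q Q0 QB QU; apply: malg_ind => // [f g Qf Qg|c x]; last by apply: QU; exists c, x.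
by rewrite -[g]opprK; apply: (QB f) => //; rewrite -sub0r; apply: QB.
Qed.

Lemma malgUZ (X : choiceType) c (x : X) : << c *g x >> = c *: << x >> :> {malg K[X]}.
Proof. by apply/malgP=> k; rewrite mcoeffZ !mcoeffU mulrnAr mulr1. Qed.

Lemma lincombU1 (X : choiceType) (V : lmodType K) (e : X -> V) x : lincomb e << x >> = e x.
Proof. by rewrite lincombU scale1r. Qed.

Lemma lincomb0 (X : choiceType) (V : lmodType K) (e : X -> V) : lincomb e 0 = 0.
Proof. exact: linear0. Qed.
Lemma lincombD (X : choiceType) (V : lmodType K) (e : X -> V) f g :
  lincomb e (f + g) = lincomb e f + lincomb e g.
Proof. exact: linearD. Qed.
Lemma lincombB (X : choiceType) (V : lmodType K) (e : X -> V) f g :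
  lincomb e (f - g) = lincomb e f - lincomb e g.
Proof. exact: linearB. Qed.
Lemma lincombZ (X : choiceType) (V : lmodType K) (e : X -> V) c f :
  lincomb e (c *: f) = c *: lincomb e f.
Proof. exact: linearZ. Qed.

Lemma linear_fun0 (U V : lmodType K) (phi : U -> V) : linear phi -> phi 0 = 0.
Proof. by move=> lphi; have := lphi (-1) 0 0; rewrite !scaleN1r !addNr. Qed.
Lemma linear_funD (U V : lmodType K) (phi : U -> V) : linear phi -> {morph phi : x y / x + y}.
Proof. by move=> lphi x y; rewrite -[x]scale1r lphi !scale1r. Qed.
Lemma linear_funZ (U V : lmodType K) (phi : U -> V) c x : linear phi -> phi (c *: x) = c *: phi x.
Proof. by move=> lphi; rewrite -[c *: x]addr0 lphi linear_fun0 // addr0. Qed.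

Lemma linear_fun_comp (U V W : lmodType K) (f : V -> W) (g : U -> V) :
  linear f -> linear g -> linear (fun x => f (g x)).
Proof. by move=> lf lg c a b; rewrite lg lf. Qed.

Lemma linear_lincomb (X : choiceType) (U V : lmodType K) (phi : U -> V) (e : X -> U) f :
  linear phi -> phi (lincomb e f) = lincomb (phi \o e) f.
Proof.
move=> lphi; elim/malg_ind: f => [|f g IHf IHg|c x].
- by rewrite !lincomb0 linear_fun0.
- by rewrite !lincombD linear_funD // IHf IHg.
by rewrite !lincombU linear_funZ.
Qed.

Lemma lincomb_id (X : choiceType) (f : {malg K[X]}) : lincomb (fun x => << x >>) f = f.
Proof.
elim/malg_ind: f => [|f g IHf IHg|c x]; rewrite ?lincomb0 ?lincombD ?IHf ?IHg //.
by rewrite lincombU -malgUZ.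
Qed.

Lemma linear_malgE (X : choiceType) (V : lmodType K) (phi : {malg K[X]} -> V) :
  linear phi -> phi =1 lincomb (fun x => phi << x >>).
Proof. by move=> lphi f; rewrite -{1}[f]lincomb_id linear_lincomb. Qed.

Lemma lincomb_linear (X : choiceType) (V : lmodType K) (e : X -> V) : linear (lincomb e).
Proof. exact: linearP. Qed.

Lemma lincomb_lincomb (X Y : choiceType) (V : lmodType K) (e : X -> V)
    (h : Y -> {malg K[X]}) f :
  lincomb e (lincomb h f) = lincomb (fun y => lincomb e (h y)) f.
Proof. by rewrite linear_lincomb //; apply: lincomb_linear. Qed.

Lemma eq_lincomb (X : choiceType) (V : lmodType K) (e e' : X -> V) :
  e =1 e' -> lincomb e =1 lincomb e'.
Proof. by move=> ee f; apply: eq_bigr => x _; rewrite ee. Qed.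

Lemma lincomb_sum (X : choiceType) (V : lmodType K) (e : X -> V) f :
  lincomb e f = \sum_(x <- msupp f) f@_x *: e x.
Proof. by []. Qed.

Lemma lincombE (X Y : choiceType) (e : X -> {malg K[Y]}) f k :
  (lincomb e f)@_k = \sum_(x <- msupp f) f@_x * (e x)@_k.
Proof. by rewrite /lincomb raddf_sum; apply: eq_bigr => x _ /=; rewrite mcoeffZ. Qed.

Lemma lincomb_inj_coef (X Y : choiceType) (h : X -> Y) (f : {malg K[X]}) x : injective h ->
  (lincomb (fun x => << h x >> : {malg K[Y]}) f)@_(h x) = f@_x.
Proof.
move=> hI; elim/malg_ind: f => [|f g IHf IHg|c y]; first by rewrite lincomb0 !mcoeff0.
  by rewrite lincombD !mcoeffD IHf IHg.
by rewrite lincombU mcoeffZ !mcoeffU (inj_eq hI); case: eqP => _; rewrite ?mulr1 ?mulr0.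
Qed.

Lemma lincombDl (X : choiceType) (V : lmodType K) (e e' : X -> V) f :
  lincomb (fun x => e x + e' x) f = lincomb e f + lincomb e' f.
Proof. by rewrite -big_split; apply: eq_bigr => x _; rewrite scalerDr. Qed.

Lemma lincombZl (X : choiceType) (V : lmodType K) c (e : X -> V) f :
  lincomb (fun x => c *: e x) f = c *: lincomb e f.
Proof.
by rewrite scaler_sumr; apply: eq_bigr => x _; rewrite !scalerA mulrC.
Qed.

Lemma lincomb0l (X : choiceType) (V : lmodType K) f : lincomb (fun _ : X => 0 : V) f = 0.
Proof. by rewrite /lincomb big1 // => x _; rewrite scaler0. Qed.

Lemma lincombNl (X : choiceType) (V : lmodType K) (e : X -> V) f :
  lincomb (fun x => - e x) f = - lincomb e f.
Proof.
by rewrite -scaleN1r -lincombZl; apply: eq_lincomb => x; rewrite scaleN1r.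
Qed.

Section Bases.
Variables (V : lmodType K).

(** A linear left inverse of [lincomb e] on the family gives the uniqueness of the
    coordinates without any argument on supports. *)
Lemma is_basisP (X : choiceType) (e : X -> V) (phi : V -> {malg K[X]}) :
  linear phi -> (forall x, phi (e x) = << x >>) ->
  (forall v, lincomb e (phi v) = v) -> is_basis e.
Proof.
move=> lphi phie ephi v; exists (phi v); split=> // f <-.
rewrite linear_lincomb // -[RHS](lincomb_id f); exact: eq_lincomb.
Qed.

Lemma basis_inj (X : choiceType) (e : X -> V) : is_basis e -> injective e.
Proof.
move=> be x y exy; have [f [_ fU]] := be (e x).
have /malgP/(_ x) : << x >> = << y >> :> {malg K[X]}.
  by rewrite -(fU << x >>) ?lincombU1 // -(fU << y >>) ?lincombU1.
by rewrite !mcoeffU eqxx; case: eqP => // _ /eqP; rewrite oner_eq0.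
Qed.

Lemma basis_bij (X Y : choiceType) (e : X -> V) (h : Y -> X) :
  is_basis e -> injective h -> (forall x, exists y, h y = x) -> is_basis (e \o h).
Proof.
move=> be hI hS.
have exh x : exists y, h y == x by have [y <-] := hS x; exists y.
pose k x := xchoose (exh x).
have hk x : h (k x) = x by apply/eqP; apply: (xchooseP (exh x)).
have kh y : k (h y) = y by apply: hI; rewrite hk.
have hP (f : {malg K[Y]}) : lincomb e (lincomb (fun y => << h y >>) f) = lincomb (e \o h) f.
  by rewrite lincomb_lincomb; apply: eq_lincomb => y; rewrite lincombU1.
have kP (f : {malg K[X]}) : lincomb (e \o h) (lincomb (fun x => << k x >>) f) = lincomb e f.
  by rewrite lincomb_lincomb; apply: eq_lincomb => x; rewrite lincombU1 /= hk.
move=> v; have [f [fP fU]] := be v.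
exists (lincomb (fun x => << k x >>) f); split=> [|g gP]; first by rewrite kP.
rewrite (fU (lincomb (fun y => << h y >>) g)) ?hP // lincomb_lincomb.
by rewrite -[RHS]lincomb_id; apply: eq_lincomb => y; rewrite lincombU1 kh.
Qed.

End Bases.

Lemma bilinUU (X : choiceType) (V : lmodType K) (mu : X -> X -> V) x y :
  bilin mu << x >> << y >> = mu x y.
Proof. by rewrite /bilin !lincombU1. Qed.

Lemma bilin_linearl (X : choiceType) (V : lmodType K) (mu : X -> X -> V) y :
  linear (fun x => bilin mu x y).
Proof. exact: lincomb_linear. Qed.

Lemma bilin_linearr (X : choiceType) (V : lmodType K) (mu : X -> X -> V) x :
  linear (bilin mu x).
Proof.
move=> c f g; rewrite /bilin -lincombZl -lincombDl; apply: eq_lincomb => i.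
exact: lincomb_linear.
Qed.

End FreeModules.

Lemma base_changeE (K K' : nzRingType) (f : {additive K -> K'}) (X : choiceType)
    (c : {malg K[X]}) k : (base_change f c)@_k = f c@_k.
Proof.
rewrite /base_change raddf_sum /=; under eq_bigr do rewrite mcoeffU.
case: (msuppP c k) => [ks|ks]; last first.
  rewrite raddf0 big1_seq // => x /andP[_ xs]; case: eqP => // xk.
  by rewrite xk in xs; rewrite xs in ks.
rewrite (big_fsetD1 k) //= eqxx big1_seq ?addr0 // => x /andP[_].
by rewrite !inE => /andP[/negPf->].
Qed.

Lemma base_changeU (K K' : nzRingType) (f : {additive K -> K'}) (X : choiceType)
    c (x : X) : base_change f << c *g x >> = << f c *g x >>.
Proof. by apply/malgP=> k; rewrite base_changeE !mcoeffU raddfMn. Qed.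

Lemma base_change_is_additive (K K' : nzRingType) (f : {additive K -> K'})
  (X : choiceType) : additive (@base_change K K' f X).
Proof. by move=> a b; apply/malgP=> k; rewrite !(base_changeE, mcoeffB) raddfB. Qed.

Lemma base_change0 (K K' : nzRingType) (f : {additive K -> K'}) (X : choiceType) :
  base_change f (0 : {malg K[X]}) = 0.
Proof. by apply/malgP=> k; rewrite base_changeE !mcoeff0 raddf0. Qed.
Lemma base_changeB (K K' : nzRingType) (f : {additive K -> K'}) (X : choiceType)
    (x y : {malg K[X]}) : base_change f (x - y) = base_change f x - base_change f y.
Proof. exact: base_change_is_additive. Qed.
Lemma base_changeD (K K' : nzRingType) (f : {additive K -> K'}) (X : choiceType)
    (x y : {malg K[X]}) : base_change f (x + y) = base_change f x + base_change f y.
Proof. by apply/malgP=> k; rewrite base_changeE !mcoeffD raddfD !base_changeE. Qed.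

Lemma base_changeZ (K K' : nzRingType) (f : {rmorphism K -> K'}) (X : choiceType)
    c (x : {malg K[X]}) : base_change f (c *: x) = f c *: base_change f x.
Proof. by apply/malgP=> k; rewrite mcoeffZ !base_changeE mcoeffZ; exact: rmorphM. Qed.

Lemma base_change_lincomb (K K' : comNzRingType) (f : {rmorphism K -> K'}) (X Y : choiceType)
    (e : X -> {malg K[Y]}) (c : {malg K[X]}) :
  base_change f (lincomb e c) = lincomb (fun x => base_change f (e x)) (base_change f c).
Proof.
elim/malg_ind: c => [|a b IHa IHb|c x]; first by rewrite !lincomb0 !base_change0 lincomb0.
  by rewrite lincombD !base_changeD IHa IHb lincombD.
by rewrite base_changeU !lincombU base_changeZ.
Qed.

(** * Laurent polynomials *)

Section LaurentFacts.
Variable R : comNzRingType.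
Implicit Types p q : laurent R.

Lemma laurentMUU (c d : R) (i j : int) :
  (<< c *g i >> : laurent R) * (<< d *g j >> : laurent R) = << c * d *g i + j >>.
Proof. exact: laurent_mulUU. Qed.

Lemma laurentC_is_additive : additive (@laurentC R).
Proof. by move=> a b; rewrite /laurentC monalgUB. Qed.
HB.instance Definition _ :=
  GRing.isAdditive.Build R (laurent R) (@laurentC R) laurentC_is_additive.
Lemma laurentC_is_multiplicative : multiplicative (@laurentC R).
Proof. by split=> // a b; rewrite /laurentC laurentMUU addr0. Qed.
HB.instance Definition _ :=
  GRing.isMultiplicative.Build R (laurent R) (@laurentC R) laurentC_is_multiplicative.

Lemma laurentC_coef c p k : (laurentC c * p)@_k = c * p@_k.
Proof.
elim/laurent_ind: p => [|p q IHp IHq|d i]; first by rewrite mulr0 mcoeff0 mulr0.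
  by rewrite mulrDr !mcoeffD mulrDr IHp IHq.
by rewrite laurentMUU add0r !mcoeffU mulrnAr.
Qed.

Definition deltaR : laurent R := << 1%Z >> + << (- 1)%Z >>.

Lemma deltaR_coef p k : (deltaR * p)@_k = p@_(k - 1) + p@_(k + 1).
Proof.
elim/laurent_ind: p => [|p q IHp IHq|d i]; first by rewrite mulr0 !mcoeff0 addr0.
  by rewrite mulrDr !mcoeffD IHp IHq addrACA.
rewrite mulrDl mcoeffD !laurentMUU !mul1r !mcoeffU.
by congr (_ *+ _ + _ *+ _); congr (nat_of_bool _); lia.
Qed.

(** Multiplication by a power of delta shifts the leading coefficient without
    changing it; this is what makes delta cancellable over any base ring. *)
Lemma deltaR_lead c p m : (forall k, m < k -> p@_k = 0) ->
  (deltaR ^+ c * p)@_(m + c%:Z) = p@_m /\ forall k, m + c%:Z < k -> (deltaR ^+ c * p)@_k = 0.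
Proof.
move=> pm; elim: c => [|c [IHm IHk]].
  by rewrite mul1r addr0.
rewrite exprS -mulrA !deltaR_coef; split=> [|k km].
  by rewrite -[RHS]IHm [X in _ + X]IHk ?addr0; [congr (_@_ _); lia|lia].
by rewrite deltaR_coef !IHk ?addr0 //; lia.
Qed.

End LaurentFacts.

Section LaurentMap.
Variables (R R' : comNzRingType) (f : {rmorphism R -> R'}).

Lemma laurent_map_is_additive : additive (laurent_map f).
Proof. exact: base_change_is_additive. Qed.
HB.instance Definition _ :=
  GRing.isAdditive.Build (laurent R) (laurent R') (laurent_map f) laurent_map_is_additive.

Lemma laurent_mapU c i : laurent_map f << c *g i >> = << f c *g i >>.
Proof. exact: base_changeU. Qed.

Lemma laurent_map_is_multiplicative : multiplicative (laurent_map f).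
Proof.
split=> [p q|]; last by rewrite [LHS]laurent_mapU rmorph1.
elim/laurent_ind: p => [|p p' IHp IHp'|c i]; first by rewrite mul0r !raddf0 mul0r.
  by rewrite mulrDl !raddfD /= IHp IHp' mulrDl.
elim/laurent_ind: q => [|q q' IHq IHq'|d j]; first by rewrite mulr0 !raddf0 mulr0.
  by rewrite mulrDr !raddfD /= IHq IHq' mulrDr.
by rewrite laurentMUU !laurent_mapU laurentMUU rmorphM.
Qed.
HB.instance Definition _ :=
  GRing.isMultiplicative.Build (laurent R) (laurent R') (laurent_map f)
    laurent_map_is_multiplicative.

End LaurentMap.

Lemma laurent_map_delta (R : comNzRingType) :
  laurent_map (fun z : int => z%:~R : R) delta = deltaR R.
Proof. by rewrite raddfD /= !laurent_mapU. Qed.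

Lemma laurent_mapC (R : comNzRingType) z :
  laurent_map (fun z : int => z%:~R : R) (laurentC z) = laurentC z%:~R.
Proof. exact: laurent_mapU. Qed.

#[global] Opaque lincomb mkmalgU.

(** * Products over the cycles of a permutation *)

Section CycleProducts.
Variables (A : pzRingType) (K : comNzRingType) (tau : {additive A -> K}).
Hypothesis tauC : forall a b, tau (a * b) = tau (b * a).

(** The label of a path: what is met later is multiplied on the left. *)
Definition path_prod (T : Type) (lab : T -> A) (p : seq T) : A := \prod_(x <- rev p) lab x.

Lemma path_prod_nil (T : Type) (lab : T -> A) : path_prod lab [::] = 1.
Proof. by rewrite /path_prod big_nil. Qed.

Lemma path_prod_cat (T : Type) (lab : T -> A) p q : path_prod lab (p ++ q) = path_prod lab q * path_prod lab p.
Proof. by rewrite /path_prod rev_cat big_cat. Qed.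

Lemma path_prod1 (T : Type) (lab : T -> A) x : path_prod lab [:: x] = lab x.
Proof. by rewrite /path_prod big_seq1. Qed.

Lemma path_prod_cons (T : Type) (lab : T -> A) x p : path_prod lab (x :: p) = path_prod lab p * lab x.
Proof. by rewrite -cat1s path_prod_cat path_prod1. Qed.

Lemma eq_plab (T : eqType) (lab lab' : T -> A) p :
  {in p, lab =1 lab'} -> path_prod lab p = path_prod lab' p.
Proof. by move=> ll; apply: eq_big_seq => x; rewrite mem_rev => /ll. Qed.

Lemma path_prod_map (T T' : Type) (h : T' -> T) (lab : T -> A) p :
  path_prod lab (map h p) = path_prod (lab \o h) p.
Proof. by rewrite /path_prod -map_rev big_map. Qed.

Lemma path_prod_flatten (T T' : Type) (lab : T -> A) (seg : T' -> seq T) p :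
  path_prod lab (flatten [seq seg y | y <- p]) = path_prod (fun y => path_prod lab (seg y)) p.
Proof.
elim: p => [|y p IHp]; first by rewrite /path_prod !big_nil.
by rewrite /= path_prod_cat path_prod_cons IHp.
Qed.

Lemma tau_rot (T : Type) (lab : T -> A) k p : tau (path_prod lab (rot k p)) = tau (path_prod lab p).
Proof. by rewrite /rot path_prod_cat tauC -path_prod_cat cat_take_drop. Qed.

(** As tau is symmetric, this does not depend on the point w of the cycle. *)
Definition cycle_value (T : finType) (f : T -> T) (lab : T -> A) (w : T) : K :=
  tau (path_prod lab (orbit f w)).

Fact zeta_key : unit. Proof. exact: tt. Qed.
(** The product over the cycles that lie in P. Below, f follows the edges of a
    closed diagram, P selects the points at which an edge is entered along its
    orientation, and tau is delta times the trace, so that this is the value of the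
    closed diagram. *)
Definition zeta : forall T : finType, (T -> T) -> (T -> A) -> pred T -> K :=
  locked_with zeta_key (fun T f lab P => \prod_(w | P w && (froot f w == w)) cycle_value f lab w).

Lemma zetaE (T : finType) (f : T -> T) (lab : T -> A) (P : pred T) :
  zeta f lab P = \prod_(w | P w && (froot f w == w)) cycle_value f lab w.
Proof. by rewrite /zeta unlock. Qed.

Section Zeta.
Variables (T : finType) (f : T -> T).
Hypothesis fI : injective f.

Lemma cycle_value_cycle lab p x : fcycle f p -> uniq p -> x \in p -> cycle_value f lab x = tau (path_prod lab p).
Proof. by move=> fp up xp; have [i E] := orbit_rot_cycle fp up xp; rewrite /cycle_value E tau_rot. Qed.

Lemma cycle_value_connect lab x y : fconnect f x y -> cycle_value f lab x = cycle_value f lab y.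
Proof.
rewrite fconnect_orbit => xy.
by rewrite (@cycle_value_cycle lab (orbit f x) y) ?cycle_orbit ?orbit_uniq.
Qed.

(** A function on cycles can be multiplied over any choice of one point in each
    cycle. *)
Lemma prod_transversal (F : T -> K) (P R : pred T) :
  (forall x y, fconnect f x y -> F x = F y) ->
  (forall x y, fconnect f x y -> P x -> P y) ->
  (forall x, R x -> P x) ->
  (forall x, P x -> exists2 y, R y & fconnect f x y) ->
  (forall x y, R x -> R y -> fconnect f x y -> x = y) ->
  \prod_(w | R w) F w = \prod_(w | P w && (froot f w == w)) F w.
Proof.
move=> FC PC RP exR RU; have symf := fconnect_sym fI.
pose h w := odflt w [pick y | R y && fconnect f w y].
rewrite [RHS](reindex_onto (froot f) h); last first.
  move=> w /andP[Pw /eqP rw]; rewrite /h; case: pickP => [y /andP[_ wy]|no].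
    by rewrite /= -[RHS]rw; apply/eqP; rewrite eq_sym (root_connect symf).
  by have [y Ry wy] := exR _ Pw; move: (no y); rewrite Ry wy.
apply: eq_big => [w|w _]; last by apply: FC; apply: connect_root.
rewrite (root_root symf) eqxx andbT.
have wr : fconnect f w (froot f w) by apply: connect_root.
apply/idP/andP=> [Rw|[Prw /eqP hw]].
  split; first exact: PC wr (RP _ Rw).
  rewrite /h; case: pickP => [y /andP[Ry wy]|no] /=.
    by apply/eqP; apply: RU => //; rewrite symf (connect_trans wr).
  by move: (no w); rewrite Rw symf wr.
move: hw; rewrite /h; case: pickP => [y /andP[Ry _] /= <- //|no].
by have [y Ry wy] := exR _ Prw; move: (no y); rewrite Ry wy.
Qed.

Lemma zeta_transversal lab (P R : pred T) :
  (forall x y, fconnect f x y -> P x -> P y) ->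
  (forall x, R x -> P x) ->
  (forall x, P x -> exists2 y, R y & fconnect f x y) ->
  (forall x y, R x -> R y -> fconnect f x y -> x = y) ->
  \prod_(w | R w) cycle_value f lab w = zeta f lab P.
Proof. by move=> *; rewrite zetaE; apply: prod_transversal => // x y /cycle_value_connect. Qed.

Lemma closed_connect (P : pred T) : (forall x, P x -> P (f x)) ->
  forall x y, fconnect f x y -> P x -> P y.
Proof.
move=> Pf x y /iter_findex <- Px; elim: (findex _ _ _) => //= k; exact: Pf.
Qed.

(** A multiplicative quantity over cycles is affine in the label of one point,
    because a cycle meets that point at most once. *)
Lemma zeta_additive lab1 lab2 lab3 (P : pred T) x0 :
  (forall x, P x -> P (f x)) -> P x0 -> lab3 x0 = lab1 x0 - lab2 x0 ->
  (forall x, x != x0 -> lab1 x = lab3 x) -> (forall x, x != x0 -> lab2 x = lab3 x) ->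
  zeta f lab3 P = zeta f lab1 P - zeta f lab2 P.
Proof.
move=> Pf Px0 E0 E1 E2; have symf := fconnect_sym fI.
have xr : fconnect f x0 (froot f x0) by apply: connect_root.
have Pr : P (froot f x0) && (froot f (froot f x0) == froot f x0).
  by rewrite (root_root symf) eqxx (closed_connect Pf xr).
rewrite !zetaE !(bigD1 (froot f x0) Pr) /=.
have Eo lab : (forall x, x != x0 -> lab x = lab3 x) ->
    \prod_(w | P w && (froot f w == w) && (w != froot f x0)) cycle_value f lab w
    = \prod_(w | P w && (froot f w == w) && (w != froot f x0)) cycle_value f lab3 w.
  move=> El; apply: eq_bigr => w /andP[/andP[_ /eqP rw] wr].
  congr (tau _); apply: eq_plab => x; rewrite -fconnect_orbit => wx; apply: El.
  apply: contra_neq wr => xx; rewrite -rw -xx; apply/eqP.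
  by rewrite (root_connect symf).
rewrite (Eo _ E1) (Eo _ E2) -mulrBl; congr (_ * _); rewrite /cycle_value -[RHS]raddfB; congr (tau _).
have x0r : x0 \in orbit f (froot f x0) by rewrite -fconnect_orbit symf.
have := orbit_uniq f (froot f x0).
case/splitPr: x0r => p1 p2; rewrite cat_uniq /= => /and3P[_ /norP[x1 _] /andP[x2 _]].
have E (lab : T -> A) : (forall x, x != x0 -> lab x = lab3 x) ->
    path_prod lab (p1 ++ x0 :: p2) = path_prod lab3 p2 * lab x0 * path_prod lab3 p1.
  move=> El; rewrite path_prod_cat path_prod_cons.
  by congr (_ * _ * _); apply: eq_plab => x xp; apply: El;
    [apply: contraNneq x2 => <-|apply: contraNneq x1 => <-].
by rewrite (E lab1) // (E lab2) // (E lab3) // E0 mulrBr mulrBl.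
Qed.

End Zeta.

Section FirstReturn.
Variables (T T' : finType) (f : T -> T) (f' : T' -> T').
Variables (lab : T -> A) (lab' : T' -> A) (iota : T' -> T) (seg : T' -> seq T) (P : pred T).
Hypotheses (fI : injective f) (f'I : injective f') (iotaI : injective iota).
Hypothesis Pf : forall x, P x -> P (f x).
Hypothesis seg_traject : forall x, seg x = traject f (iota x) (size (seg x)).
Hypothesis seg_gt0 : forall x, (0 < size (seg x))%N.
Hypothesis seg_next : forall x, f (last (iota x) (seg x)) = iota (f' x).
Hypothesis seg_first : forall x y, y \in behead (seg x) -> y \notin codom iota.
Hypothesis lab'E : forall x, P (iota x) -> lab' x = path_prod lab (seg x).

Let meets w := has (mem (codom iota)) (orbit f w).

Lemma seg_cons x : seg x = iota x :: behead (seg x).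
Proof. by rewrite seg_traject; case: (size (seg x)) (seg_gt0 x). Qed.

Lemma seg_iter x : iter (size (seg x)) f (iota x) = iota (f' x).
Proof.
rewrite -seg_next [in RHS]seg_traject; case: (size (seg x)) (seg_gt0 x) => // k _.
by rewrite trajectS /= last_traject.
Qed.

Lemma filter_seg x : filter (mem (codom iota)) (seg x) = [:: iota x].
Proof.
rewrite seg_cons /= codom_f; congr (_ :: _).
rewrite -(filter_pred0 (behead (seg x))); apply: eq_in_filter => y /seg_first /=.
exact: negPf.
Qed.

Lemma flatten_seg x p : fpath f' x p ->
  let L := flatten [seq seg y | y <- x :: p] in
  L = traject f (iota x) (size L) /\ iter (size L) f (iota x) = iota (f' (last x p)).
Proof.
elim: p x => [|y p IHp] x /=.
  by move=> _; rewrite cats0 -seg_traject seg_iter.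
case/andP=> /eqP <- /IHp[/= EL El]; rewrite size_cat trajectD -seg_traject seg_iter -EL.
by split=> //; rewrite addnC iterD seg_iter El.
Qed.

(** The concatenation of the segments along the orbit of x for f' is a trajectory
    of f from iota x back to iota x, and it meets iota x only once. *)
Lemma orbit_seg x : orbit f (iota x) = flatten [seq seg y | y <- orbit f' x].
Proof.
have := fpath_traject f' x (order f' x).-1.
have := last_traject f' x (order f' x).-1.
have Eo : orbit f' x = x :: traject f' (f' x) (order f' x).-1.
  by rewrite /orbit -(prednK (order_gt0 f' x)).
rewrite Eo.
move: (traject _ _ _) Eo => p Eo lastp /flatten_seg.
set L := flatten _ => -[EL Eit].
have{}Eit : iter (size L) f (iota x) = iota x.
  by rewrite Eit lastp -iterS prednK ?order_gt0 // iter_order.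
have L_gt0 : (0 < size L)%N by rewrite /L /= size_cat addn_gt0 seg_gt0.
have countL : count_mem (iota x) L = 1%N.
  have -> : count_mem (iota x) L = count_mem (iota x) (filter (mem (codom iota)) L).
    rewrite count_filter; apply: eq_count => y /=.
    by case: eqP => // ->; rewrite codom_f.
  have -> : filter (mem (codom iota)) L = map iota (orbit f' x).
    rewrite Eo /L; elim: (x :: p) => //= y s IHs.
    by rewrite filter_cat filter_seg /= IHs.
  by rewrite count_uniq_mem ?(map_inj_uniq iotaI) ?orbit_uniq ?(mem_map iotaI) ?in_orbit.
rewrite [LHS]/orbit EL; congr traject.
case: (ltngtP (order f (iota x)) (size L)) => // [lt|gt].
  have E2 : L = take (order f (iota x)) L ++ drop (order f (iota x)) L by rewrite cat_take_drop.
  move: countL; rewrite E2 count_cat.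
  have o0 := order_gt0 f (iota x).
  have c1 : (0 < count_mem (iota x) (take (order f (iota x)) L))%N.
    rewrite -has_count has_pred1 EL take_traject ?(ltnW lt) //.
    by rewrite -(prednK o0) /= inE eqxx.
  have c2 : (0 < count_mem (iota x) (drop (order f (iota x)) L))%N.
    rewrite -has_count has_pred1 (drop_nth (iota x)) // inE EL nth_traject //.
    by rewrite iter_order ?eqxx.
  by lia.
have := iter_findex (fconnect_iter f (size L) (iota x)).
by have := findex_iter gt; rewrite Eit findex0 => E; rewrite -E in L_gt0.
Qed.

Lemma fconnect_seg x y : fconnect f (iota x) (iota y) = fconnect f' x y.
Proof.
rewrite !fconnect_orbit orbit_seg; apply/idP/idP=> [|yx].
  case/flatten_mapP=> z zx; rewrite seg_cons inE => /orP[/eqP/iotaI-> //|/seg_first].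
  by rewrite codom_f.
by apply/flatten_mapP; exists y => //; rewrite seg_cons mem_head.
Qed.

Lemma cycle_value_seg x : P (iota x) -> cycle_value f lab (iota x) = cycle_value f' lab' x.
Proof.
move=> Px; rewrite /cycle_value orbit_seg path_prod_flatten; congr (tau _); apply: eq_plab => y yx.
rewrite lab'E //; apply: (closed_connect Pf) Px.
by rewrite fconnect_seg fconnect_orbit.
Qed.

(** Replacing a permutation by its first-return map on a subset, and each label
    by the product of the labels met on the way, only loses the cycles that
    avoid the subset. *)
Lemma zeta_first_return :
  zeta f lab P = zeta f' lab' (P \o iota)
                 * \prod_(w | P w && ~~ meets w && (froot f w == w)) cycle_value f lab w.
Proof.
have symf := fconnect_sym fI; have symf' := fconnect_sym f'I.
have PC := closed_connect Pf.
have meetsC x y : fconnect f x y -> meets x -> meets y.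
  move=> xy /hasP[z]; rewrite -fconnect_orbit => xz zi; apply/hasP; exists z => //.
  by rewrite -fconnect_orbit (connect_trans _ xz) // symf.
rewrite !zetaE (bigID meets) /=; congr (_ * _); last by apply: eq_bigl => w; rewrite andbAC.
rewrite (eq_bigl (fun w => (P w && meets w) && (froot f w == w))); last by move=> w; rewrite andbAC.
rewrite -(zetaE f lab (fun w => P w && meets w)).
rewrite -(@zeta_transversal _ f fI lab (fun w => P w && meets w)
  (mem (iota @: [set x | P (iota x) && (froot f' x == x)]))).
- rewrite big_imset => [|x y _ _ /iotaI//].
  by apply: eq_big => x; rewrite inE // => /andP[Px _]; rewrite cycle_value_seg.
- by move=> x y xy /andP[Px mx]; rewrite (PC _ _ xy) ?(meetsC _ _ xy).
- move=> w /imsetP[x]; rewrite inE => /andP[Px _] ->; rewrite Px /=.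
  by apply/hasP; exists (iota x); rewrite ?in_orbit //= codom_f.
- move=> w /andP[Pw /hasP[z]]; rewrite -fconnect_orbit => wz /= /codomP[x Ez].
  exists (iota (froot f' x)).
    apply/imsetP; exists (froot f' x) => //; rewrite inE (root_root symf') eqxx andbT.
    apply: (PC w) => //; apply: connect_trans wz _.
    by rewrite Ez fconnect_seg connect_root.
  by apply: connect_trans wz _; rewrite Ez fconnect_seg connect_root.
move=> w1 w2 /imsetP[x1]; rewrite inE => /andP[_ /eqP r1] -> /imsetP[x2].
rewrite inE => /andP[_ /eqP r2] ->; rewrite fconnect_seg => x12.
by congr iota; rewrite -r1 -r2; apply/eqP; rewrite (root_connect symf').
Qed.

End FirstReturn.

(** Conjugate permutations: each segment of the first return is one point. *)
Lemma zeta_bij (T T' : finType) (f : T -> T) (f' : T' -> T') (lab : T -> A)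
    (lab' : T' -> A) (h : T' -> T) (P : pred T) (P' : pred T') :
  injective f -> injective f' -> injective h -> (forall y, exists x, y = h x) ->
  (forall x, P x -> P (f x)) -> (forall x, f (h x) = h (f' x)) ->
  (forall x, P' x = P (h x)) -> (forall x, P' x -> lab' x = lab (h x)) ->
  zeta f lab P = zeta f' lab' P'.
Proof.
move=> fI f'I hI hS Pf hf PE labE.
rewrite (zeta_first_return (f' := f') (lab' := lab') (iota := h) (seg := fun x => [:: h x])) //.
  rewrite big1 ?mulr1; first by rewrite !zetaE; apply: eq_bigl => x; rewrite PE.
  move=> w /andP[/andP[_ /hasPn/(_ w (in_orbit _ _))]].
  by have [x ->] := hS w; rewrite /= codom_f.
by move=> x; rewrite -PE => /labE->; rewrite path_prod1.
Qed.

(** The cycles of the inverse are the same cycles read backwards, and psi reverses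
    the products of labels. *)
Lemma zeta_inv (T : finType) (f g : T -> T) (lab lab' : T -> A) (P : pred T) (psi : A -> A) :
  injective f -> cancel f g -> cancel g f -> (forall x, P x -> P (f x)) ->
  psi 1 = 1 -> (forall a b, psi (a * b) = psi b * psi a) -> (forall a, tau (psi a) = tau a) ->
  (forall x, P x -> lab' x = psi (lab (g x))) ->
  zeta g lab' P = zeta f lab P.
Proof.
move=> fI fK gK Pf psi1 psiM psit labE; have gI := can_inj gK.
have symf := fconnect_sym fI; have symg := fconnect_sym gI.
have PC := closed_connect Pf.
have fg x : fconnect f x (g x) by rewrite symf -{2}[x]gK fconnect1.
have gf x y : fconnect g x y = fconnect f x y.
  apply/idP/idP=> /iter_findex <-; elim: (findex _ _ _) => //= k IHk.
    exact: connect_trans IHk (fg _).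
  by apply: connect_trans IHk _; rewrite symg -{2}[iter _ _ _]fK fconnect1.
have psi_plab p : psi (path_prod (lab \o g) p) = \prod_(x <- p) psi (lab (g x)).
  by elim: p => [|x p IHp]; rewrite ?path_prod_nil ?big_nil // path_prod_cons psiM IHp big_cons.
have cE w : P w -> cycle_value g lab' w = cycle_value f lab w.
  move=> Pw; rewrite (@cycle_value_cycle _ g lab' (rev (orbit f w))).
  - rewrite (@eq_plab _ _ (psi \o (lab \o g))) => [|x]; last first.
      by rewrite mem_rev -fconnect_orbit => /PC/(_ Pw)/labE.
    rewrite /path_prod revK -psi_plab psit -path_prod_map (cycle_value_connect fI lab (fg w)).
    rewrite -(@cycle_value_cycle _ f lab _ (g w)) ?(map_inj_uniq gI) ?orbit_uniq //.
      rewrite cycle_map; apply: sub_cycle (cycle_orbit fI w) => x y /eqP <- /=.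
      by rewrite fK gK.
    by rewrite map_f ?in_orbit.
  - rewrite rev_cycle; apply: sub_cycle (cycle_orbit fI w) => x y /eqP <- /=.
    by rewrite fK.
  - by rewrite rev_uniq orbit_uniq.
  by rewrite mem_rev in_orbit.
rewrite [LHS]zetaE (eq_bigr (fun w => cycle_value f lab w)) => [|w /andP[/cE//]].
have PCg x y : fconnect g x y -> P x -> P y by rewrite gf; apply: PC.
rewrite (@zeta_transversal _ f fI lab P (fun w => P w && (froot g w == w))) //.
- by move=> x /andP[].
- move=> x Px; exists (froot g x); last by rewrite -gf connect_root.
  by rewrite (root_root symg) eqxx andbT (PCg x) ?connect_root.
move=> x y /andP[_ /eqP rx] /andP[_ /eqP ry]; rewrite -gf => xy.
by rewrite -rx -ry; apply/eqP; rewrite (root_connect symg).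
Qed.

End CycleProducts.

(** * Stacking two planar diagrams *)

Lemma card_between N a b : (b <= N)%N -> #|[set k : 'I_N | (a < k < b)%N]| = (b - a.+1)%N.
Proof.
move=> bN; rewrite -sum1dep_card -(big_mkord (fun k => (a < k < b)%N) (fun=> 1%N)).
rewrite sum1_count /index_iota subn0.
have [ba|ab] := leqP b a.+1.
  rewrite (eq_count (a2 := pred0)) ?count_pred0; first by apply/esym/eqP.
  by move=> k /=; apply/negbTE; lia.
have -> : N = (a.+1 + (b - a.+1) + (N - b))%N by lia.
rewrite !iotaD !count_cat !add0n addnC.
rewrite (eq_in_count (a2 := pred0)) ?count_pred0; last first.
  by move=> k; rewrite mem_iota => ? /=; apply/negbTE; lia.
rewrite (eq_in_count (a2 := pred0) (s := iota 0 _)) ?count_pred0; last first.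
  by move=> k; rewrite mem_iota => ? /=; apply/negbTE; lia.
rewrite (eq_in_count (a2 := predT)) ?count_predT ?size_iota; first by lia.
by move=> k; rewrite mem_iota => ? /=; lia.
Qed.

Lemma even_card_involution N (A : {set 'I_N}) (m : 'I_N -> 'I_N) :
  (forall j, j \in A -> m j \in A) -> {in A, involutive m} -> {in A, forall j, m j != j} ->
  ~~ odd #|A|.
Proof.
move=> mA mK mn; pose B := [set j in A | (j < m j)%N].
have -> : A = B :|: m @: B.
  apply/setP=> j; rewrite !inE; apply/idP/orP=> [jA|[/andP[]//|]].
    have := mn j jA; rewrite -val_eqE neq_ltn => /orP[lt|gt]; [right|left].
      apply/imsetP; exists (m j); last by rewrite mK.
      by rewrite inE mA // mK.
    by rewrite jA gt.
  by case/imsetP=> k; rewrite inE => /andP[kA _] ->; apply: mA.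
rewrite cardsU disjoint_setI0 ?cards0 ?subn0; last first.
  rewrite -setI_eq0; apply/eqP/setP=> j; rewrite !inE; apply/negbTE/negP.
  case/andP=> /andP[jA jm] /imsetP[k]; rewrite inE => /andP[kA km] jk.
  by move: jm; rewrite jk mK // => ?; lia.
rewrite card_in_imset ?addnn ?odd_double // => i j.
by rewrite !inE => /andP[/mK iK _] /andP[/mK jK _] E; rewrite -iK E.
Qed.

Section Planar.
Variables (n : nat) (m : {ffun 'I_(n + n) -> 'I_(n + n)}).
Hypothesis mP : planar_matching m.

Lemma matchK : involutive m.
Proof. by case/and3P: mP => /forallP mK _ _ j; apply/eqP. Qed.
Lemma match_neq j : m j != j.
Proof. by case/and3P: mP => _ /forallP. Qed.
Lemma match_inj : injective m.
Proof. exact: can_inj matchK. Qed.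
Lemma match_nocross (i j : 'I_(n + n)) : ~~ [&& (i < j)%N, (j < m i)%N & (m i < m j)%N].
Proof. by case/and3P: mP => _ _ /forallP/(_ i)/forallP. Qed.

(** The points under an arc are matched among themselves, hence they are even in
    number. *)
Lemma match_parity j : odd (m j) = ~~ odd j.
Proof.
have lt_parity (i : 'I_(n + n)) : (i < m i)%N -> odd (m i) = ~~ odd i.
  move=> lt; have := @even_card_involution _ [set k : 'I_(n + n) | (i < k < m i)%N] m.
  rewrite card_between 1?ltnW ?ltn_ord // => H.
  suff: ~~ odd (m i - i.+1) by lia.
  apply: H => [k|k _|k _]; rewrite ?matchK ?match_neq // !inE => /andP[ik ki].
  have : (m k != i) by apply: contraTneq ki => <-; rewrite matchK ltnn.
  have : (m k != m i) by rewrite (inj_eq match_inj); apply: contraTneq ik => ->; rewrite ltnn.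
  rewrite -!val_eqE /= => n1 n2.
  by have := match_nocross i k; have := match_nocross (m k) i; rewrite matchK; lia.
have := match_neq j; rewrite -val_eqE neq_ltn => /orP[lt|/lt_parity//].
by have := lt_parity (m j); rewrite matchK => /(_ lt) ->; rewrite negbK.
Qed.

(** Planarity as a congruence modulo 2, in which form it can be summed along a
    path. *)
Lemma match_separate (a c : 'I_(n + n)) : c != a -> c != m a ->
  (a < c)%N (+) (m a < c)%N = (a < m c)%N (+) (m a < m c)%N.
Proof.
have E x y : (x == y) = (nat_of_ord x == nat_of_ord y) by rewrite -val_eqE.
move=> ca cb; have cb' : m c != a by apply: contra_neq cb => <-; rewrite matchK.
have ca' : m c != m a by rewrite (inj_eq match_inj).
rewrite !E in ca cb ca' cb'.
have := match_nocross a c; have := match_nocross c a.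
have := match_nocross (m a) c; have := match_nocross (m c) a.
have := match_nocross a (m c); have := match_nocross c (m a).
have := match_nocross (m a) (m c); have := match_nocross (m c) (m a).
rewrite !matchK; move: ca cb ca' cb'.
move: (nat_of_ord (m a)) (nat_of_ord (m c)) (nat_of_ord a) (nat_of_ord c) => b d {}a {}c.
by case: (ltngtP a c); case: (ltngtP b c); case: (ltngtP a d); case: (ltngtP b d) => //; lia.
Qed.

End Planar.

Lemma odd_rev_ord n (j : 'I_(n + n)) : odd (rev_ord j) = ~~ odd j.
Proof. by rewrite /=; have := ltn_ord j; lia. Qed.

Section StackTheory.
Variables (n : nat) (B : choiceType) (X Y : diagram n B).
Local Notation pt := 'I_(n + n).
Implicit Types (w x u : stack_pt n) (i j : pt).
Local Notation send := (stack_end X Y).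
Local Notation next := (stack_next X Y).

Lemma dmatch_planar (Z : diagram n B) : planar_matching (dmatch Z).
Proof. by case/andP: (valP Z). Qed.

Lemma dlabel_match (Z : diagram n B) j : dlabel Z (dmatch Z j) = dlabel Z j.
Proof. by case/andP: (valP Z) => _ /forallP/(_ j)/eqP. Qed.

Lemma dmatchK (Z : diagram n B) : involutive (dmatch Z).
Proof. exact: matchK (dmatch_planar Z). Qed.

Lemma dmatch_parity (Z : diagram n B) j : odd (dmatch Z j) = ~~ odd j.
Proof. exact: match_parity (dmatch_planar Z) j. Qed.

Definition cross w : stack_pt n := (~~ w.1, rev_ord w.2).

Lemma crossK : involutive cross.
Proof. by case=> b j; rewrite /cross /= negbK rev_ordK. Qed.

Lemma stack_endK : involutive send.
Proof. by case=> [[] j]; rewrite /stack_end /= dmatchK. Qed.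

Lemma stack_nextE w : next w = cross (send w). Proof. by []. Qed.

Lemma stack_next_inj : injective next.
Proof. exact: inj_comp (can_inj crossK) (can_inj stack_endK). Qed.

Lemma enters_end w : odd (send w).2 = ~~ odd w.2.
Proof. by case: w => [[] j]; rewrite /stack_end /= dmatch_parity. Qed.

Lemma enters_next w : odd (next w).2 = odd w.2.
Proof. by rewrite stack_nextE odd_rev_ord enters_end negbK. Qed.

Lemma outer_cross w : stack_outer (cross w) = stack_outer w.
Proof. by case: w => [b j]; rewrite /stack_outer /=; have := ltn_ord j; case: b; lia. Qed.

Lemma outer_in j : stack_outer (stack_in j).
Proof. by rewrite /stack_outer eqxx. Qed.

Lemma outer_inE w : stack_outer w -> w = stack_in w.2.
Proof. by case: w => b j /eqP /= ->. Qed.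

(** The path from j ends with its edge number k, the first one to reach an outer
    point. *)
Definition is_path_to j k := (forall t, (t < k)%N -> ~~ stack_outer (send (iter t next (stack_in j)))) /\
  stack_outer (send (iter k next (stack_in j))).

(** The path returns to j since [stack_next] is a permutation, and the step back to
    j starts from an outer point. *)
Lemma ex_path_to j : exists k, is_path_to j k.
Proof.
have ex : exists k, stack_outer (send (iter k next (stack_in j))).
  exists (order next (stack_in j)).-1; rewrite -outer_cross -stack_nextE -iterS.
  by rewrite prednK ?order_gt0 // iter_order ?outer_in //; apply: stack_next_inj.
exists (ex_minn ex); case: ex_minnP => k kP kmin; split=> // i ik.
by apply/negP=> /kmin; rewrite leqNgt ik.
Qed.

Lemma stack_pathE j k : is_path_to j k -> stack_path X Y j = traject next (stack_in j) k.+1.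
Proof.
case=> kmin kP; rewrite /stack_path /orbit.
set o := order _ _; have ko : (k < o)%N.
  rewrite ltnNge; apply/negP=> ok; have := kmin (k - o)%N.
  rewrite -(subnK ok) iterD iter_order in kP; last exact: stack_next_inj.
  by rewrite kP => /(_ _)/negP[] //; have := order_gt0 next (stack_in j); rewrite -/o; lia.
have -> : find (fun w => stack_outer (send w)) (traject next (stack_in j) o) = k.
  apply/eqP; rewrite eqn_leq; apply/andP; split.
    rewrite leqNgt; apply/negP=> /(before_find (stack_in j)).
    by rewrite nth_traject // kP.
  rewrite leqNgt; apply/negP=> lt; have /negP[] := kmin _ lt.
  rewrite -(nth_traject next (ltn_trans lt ko)).
  by apply: (@nth_find _ _ (fun w => stack_outer (send w))); rewrite has_find size_traject (ltn_trans lt ko).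
by rewrite take_traject.
Qed.

Lemma comp_in j k : is_path_to j k ->
  send (iter k next (stack_in j)) = stack_in (comp_match X Y j).
Proof.
move=> kP; rewrite [LHS]outer_inE; last by case: kP.
by rewrite ffunE (stack_pathE kP) /= last_traject.
Qed.

Lemma comp_matchE j k : is_path_to j k ->
  comp_match X Y j = (send (iter k next (stack_in j))).2.
Proof. by move/comp_in->. Qed.

Lemma iter_inner j k t : is_path_to j k -> (t < k)%N ->
  ~~ stack_outer (iter t.+1 next (stack_in j)).
Proof. by case=> kmin _ /kmin; rewrite iterS stack_nextE outer_cross. Qed.

(** The path from the other end is the same path read backwards. *)
Lemma comp_matchK : involutive (comp_match X Y).
Proof.
move=> j; have [k kP] := ex_path_to j.
have it t : (t <= k)%N -> iter t next (stack_in (comp_match X Y j))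
    = send (iter (k - t) next (stack_in j)).
  elim: t => [|t IHt] tk; first by rewrite subn0 (comp_in kP).
  rewrite iterS IHt 1?ltnW // stack_nextE stack_endK -(subnSK tk) iterS.
  by rewrite stack_nextE crossK.
have kP' : is_path_to (comp_match X Y j) k.
  split=> [t tk|]; last by rewrite it // stack_endK subnn outer_in.
  rewrite it 1?ltnW // stack_endK -(subnSK tk); apply: (iter_inner kP); lia.
by rewrite (comp_matchE kP') it // subnn stack_endK.
Qed.

Lemma enters_iter t w : odd (iter t next w).2 = odd w.2.
Proof. by elim: t => //= t IHt; rewrite enters_next. Qed.

Lemma comp_match_parity j : odd (comp_match X Y j) = ~~ odd j.
Proof.
have [k kP] := ex_path_to j.
by rewrite (comp_matchE kP) enters_end enters_iter.
Qed.

(** The two boxes laid side by side, so that the glued points are nested around the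
    junction. The parities chi w x and gam u x tell whether the edge from w, resp.
    the gluing at u, has exactly one end before x. *)
Let pos w := ((if w.1 then 0 else n + n) + w.2)%N.
Let chi w x := (pos w < pos x)%N (+) (pos (send w) < pos x)%N.
Let gam u x := (pos u < pos x)%N (+) (pos (cross u) < pos x)%N.

Lemma chi_end w x : x != w -> x != send w -> chi w (send x) = chi w x.
Proof.
case: w x => [b a] [c d]; rewrite /chi /pos /stack_end /=.
have la := ltn_ord a; have ld := ltn_ord d.
have lX (Z : diagram n B) j := ltn_ord (dmatch Z j).
move=> da db; have {}da : ~~ ((c == b) && (d == a)) := da.
have {}db : ~~ ((c == b) && (d == (if b then dmatch X else dmatch Y) a)) := db.
case: b c da db => [] [] /=; rewrite ?add0n => da db.
- by rewrite -(match_separate (dmatch_planar X)).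
- have := lX X a; have := lX Y d; lia.
- have := lX Y a; have := lX X d; lia.
by rewrite !ltn_add2l -(match_separate (dmatch_planar Y)).
Qed.

Lemma gam_cross u x : ~~ stack_outer u -> ~~ stack_outer x -> x != u -> x != cross u ->
  gam u (cross x) = gam u x.
Proof.
case: u x => [b a] [c d]; rewrite /gam /pos /cross /stack_outer /=.
have la := ltn_ord a; have ld := ltn_ord d.
move=> ub xc da db; have {}da : ~~ ((c == b) && (d == a)) := da.
have {}db : ~~ ((c == ~~ b) && (d == rev_ord a)) := db.
by case: b c ub xc da db => [] [] /=; rewrite -?val_eqE /=; lia.
Qed.

Lemma gam_outer u x : ~~ stack_outer u -> stack_outer x -> gam u x = false.
Proof.
case: u x => [b a] [c d]; rewrite /gam /pos /cross /stack_outer /=.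
have la := ltn_ord a; have ld := ltn_ord d.
by case: b c => [] [] /=; lia.
Qed.

Lemma pos_outer u x : stack_outer u -> ~~ stack_outer x -> (pos u < pos (cross x))%N = (pos u < pos x)%N.
Proof.
case: u x => [b a] [c d]; rewrite /gam /pos /cross /stack_outer /=.
have la := ltn_ord a; have ld := ltn_ord d.
by case: b c => [] [] /=; lia.
Qed.

Section TwoPaths.
Variables (i : pt) (k : nat).
Hypothesis kP : is_path_to i k.
Let v t := iter t next (stack_in i).
(* The edges of the path from i, then its gluings, then its two ends. *)
Let e x := \big[addb/false]_(t < k.+1) chi (v t) x.
Let g x := \big[addb/false]_(t < k) gam (send (v t)) x.
Let ends x := (pos (stack_in i) < pos x)%N (+) (pos (stack_in (comp_match X Y i)) < pos x)%N.
Let on x := exists2 t, (t <= k)%N & x = v t \/ x = send (v t).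

(** The ends of the path are those of its edges that are not glued: all the others
    are counted twice. *)
Lemma e_telescope x : e x (+) g x = ends x.
Proof.
rewrite /ends -(comp_in kP) /e /g -/(v k).
elim: (k) => [|k' IHk]; first by rewrite big_ord0 big_ord1 addbF /chi /v.
rewrite big_ord_recr [X in _ (+) X]big_ord_recr /=.
rewrite addbACA IHk /chi /gam -stack_nextE -[next _]/(v k'.+1).
by do 4!case: (_ < _)%N.
Qed.

Lemma on_end x : on (send x) -> on x.
Proof.
case=> t tk [] E; exists t => //; [right|left]; last by rewrite -[x]stack_endK E stack_endK.
by rewrite -E stack_endK.
Qed.

Lemma on_cross x : ~~ stack_outer x -> on (cross x) -> on x.
Proof.
rewrite -outer_cross => xin [t tk [E|E]].
  case: t tk E => [|t] tk E; first by rewrite E outer_in in xin.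
  exists t; first exact: ltnW.
  by right; rewrite -[x]crossK E /v iterS stack_nextE crossK.
have [tk'|kt] := ltnP t k; last first.
  have tE : t = k by apply/eqP; rewrite eqn_leq tk.
  by case: kP => _; rewrite -/(v k) -tE -E (negPf xin).
by exists t.+1 => //; left; rewrite -[x]crossK E /v iterS stack_nextE.
Qed.

Lemma e_end x : ~ on x -> e (send x) = e x.
Proof.
move=> nx; apply: eq_bigr => -[t tk] _ /=; apply: chi_end; apply/eqP=> E; apply: nx.
  by exists t => //; left.
by exists t => //; right.
Qed.

Lemma e_cross x : ~ on x -> ~~ stack_outer x -> e (cross x) = e x.
Proof.
move=> nx xin; have Eg : g (cross x) = g x.
  apply: eq_bigr => -[t tk] _ /=; apply: gam_cross => //.
  - by case: kP => kmin _; apply: kmin.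
  - by apply/eqP=> E; apply: nx; exists t; [apply: ltnW|right].
  by apply/eqP=> E; apply: nx; exists t.+1 => //; left.
have Ee : ends (cross x) = ends x by rewrite /ends !pos_outer ?outer_in.
by move: Ee; rewrite -!e_telescope Eg; apply: addIb.
Qed.

Lemma e_outer x : stack_outer x -> e x = ends x.
Proof.
move=> xo; rewrite -e_telescope /g big1 ?addbF // => -[t tk] _ /=.
by apply: gam_outer => //; case: kP => kmin _; apply: kmin.
Qed.

(** The parity of the number of edges of one path that separate a point from
    the left end does not change along another path, and only depends on the
    ends of the first path when the point is outer. *)
Lemma ends_comp j : j != i -> j != comp_match X Y i ->
  ends (stack_in (comp_match X Y j)) = ends (stack_in j).
Proof.
move=> ji jm; have [l lP] := ex_path_to j.
have inI (a b : pt) : stack_in a = stack_in b -> a = b by case.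
have nj : ~ on (stack_in j).
  case=> t tk [] E.
    case: t tk E => [|t] tk E; first by move/inI: E ji => ->; rewrite eqxx.
    by have := iter_inner kP tk; rewrite -/(v t.+1) -E outer_in.
  move: tk; rewrite leq_eqVlt => /orP[/eqP tk|tk]; last first.
    by have := (proj1 kP) _ tk; rewrite -/(v t) -E outer_in.
  by move: E jm; rewrite tk (comp_in kP) => /inI->; rewrite eqxx.
have nq t : (t <= l)%N -> ~ on (iter t next (stack_in j)) /\ e (iter t next (stack_in j)) = ends (stack_in j).
  elim: t => [|t IHt] tl; first by rewrite e_outer ?outer_in.
  have [nt et] := IHt (ltnW tl); have innt := (proj1 lP) _ tl.
  have ns : ~ on (send (iter t next (stack_in j))) by move/on_end.
  rewrite iterS stack_nextE; split; first by move/(on_cross innt).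
  by rewrite e_cross // e_end.
have [nl el] := nq l (leqnn l).
by rewrite -e_outer ?outer_in // -(comp_in lP) e_end.
Qed.

End TwoPaths.

(** If the paths from i and from j crossed, exactly one end of the second would lie
    between the ends of the first, against [ends_comp]. *)
Lemma comp_planar : planar_matching (comp_match X Y).
Proof.
apply/and3P; split.
- by apply/forallP=> j; rewrite comp_matchK.
- apply/forallP=> j; apply/eqP=> E.
  by have := comp_match_parity j; rewrite E; case: odd.
apply/forallP=> i; apply/forallP=> j; apply/negP=> /and3P[ij jm mm].
have [k kP] := ex_path_to i.
have := @ends_comp i k kP j; rewrite -!val_eqE /= gtn_eqF // ltn_eqF // => /(_ isT isT).
have posE (a b : pt) : (pos (stack_in a) < pos (stack_in b))%N = (a < b)%N.
  rewrite /pos /=; have := ltn_ord a; have := ltn_ord b.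
  by case: (ltnP a n); case: (ltnP b n) => /=; lia.
by rewrite !posE; lia.
Qed.

End StackTheory.

(** * Hypergroups *)

Section HypergroupTheory.
Variable H : hypergroup.
Local Notation B := (hg_bas H).
Local Notation emb := (@hg_emb H).
Local Notation coord := (@hg_coord H).

Let ev (f : {malg int[B]}) : H := \sum_(b <- msupp f) emb b *~ f@_b.

Let evEw f (d : {fset B}) : (msupp f `<=` d)%fset -> ev f = \sum_(b <- d) emb b *~ f@_b.
Proof.
by move=> sfd; apply: big_fset_incl => // x _ /mcoeff_outdom ->; rewrite mulr0z.
Qed.

Let evB f g : ev (f - g) = ev f - ev g.
Proof.
pose d := (msupp (f - g) `|` (msupp f `|` msupp g))%fset.
rewrite (@evEw _ d) ?fsubsetUl // (@evEw f d) ?(@evEw g d).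
- by rewrite -sumrB; apply: eq_bigr => b _; rewrite mcoeffB mulrzBr.
- by rewrite /d fsetUA fsubsetUr.
by rewrite /d fsetUCA fsubsetUl.
Qed.

Lemma hg_coordB a b : coord (a - b) = coord a - coord b.
Proof. by rewrite -[in LHS](hg_coordK a) -[in LHS](hg_coordK b) -[_ - _]evB; apply: hg_embK. Qed.

HB.instance Definition _ := GRing.isAdditive.Build H {malg int[B]} coord hg_coordB.

Lemma hg_coord_emb b : coord (emb b) = << b >>.
Proof.
rewrite -[RHS]hg_embK; congr (coord _).
by rewrite -/(ev _) (evEw msuppU_le) big_seq_fset1 mcoeffUU.
Qed.

Lemma hg_emb_inj : injective emb.
Proof.
move=> b c /(congr1 coord); rewrite !hg_coord_emb => /malgP/(_ b).
by rewrite !mcoeffU eqxx; case: eqP.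
Qed.

Lemma hg_gen : additive_gen (fun a : H => exists b, a = emb b).
Proof.
move=> Q Q0 QB QU a; have QN x : Q x -> Q (- x) by move=> Qx; rewrite -sub0r; apply: QB.
have QD x y : Q x -> Q y -> Q (x + y) by move=> Qx Qy; rewrite -[y]opprK; apply: QB => //; apply: QN.
have QM x k : Q x -> Q (x *+ k) by move=> Qx; elim: k => [|k IHk]; rewrite ?mulr0n // mulrS; apply: QD.
have Qe b : Q (emb b) by apply: QU; exists b.
rewrite -(hg_coordK a); elim/big_ind: _ => // b _.
by case: (_@_b) => k; [apply: QM|apply: QN; apply: QM].
Qed.

(** Axiom (H3) for the coefficient of 1. *)
Lemma hg_trace_emb b c : hg_trace (emb b * emb c) = (b == hg_barB c)%:R.
Proof.
rewrite /hg_trace hg_frob hg_emb1 mul1r (bna_basis (hg_bar_antiaut H)).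
by rewrite hg_coord_emb mcoeffU eq_sym; case: eqP.
Qed.

Lemma hg_barBK : involutive (@hg_barB H).
Proof.
move=> b; apply: hg_emb_inj.
by rewrite -!(bna_basis (hg_bar_antiaut H)) hg_bar_invol.
Qed.

Lemma hg_traceB (a b : H) : hg_trace (a - b) = hg_trace a - hg_trace b.
Proof. by rewrite /hg_trace raddfB mcoeffB. Qed.

HB.instance Definition _ := GRing.isAdditive.Build H int (@hg_trace H) hg_traceB.

(** On the basis, t(bc) only tests whether b and c are conjugate to each other. *)
Lemma hg_traceC (a b : H) : hg_trace (a * b) = hg_trace (b * a).
Proof.
move: a b; apply: hg_gen => [b|x y Ex Ey b|_ [c ->]]; first by rewrite mul0r mulr0.
  by rewrite mulrBl mulrBr !hg_traceB Ex Ey.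
apply: hg_gen => [|x y Ex Ey|_ [b ->]]; first by rewrite mul0r mulr0.
  by rewrite mulrBl mulrBr !hg_traceB Ex Ey.
rewrite !hg_trace_emb; congr (nat_of_bool _)%:R.
by apply/eqP/eqP=> ->; rewrite hg_barBK.
Qed.

End HypergroupTheory.

(** * Diagrams with labels in the algebra *)

Lemma base_changeR_coef (R : comNzRingType) (X : choiceType) (f : {malg (laurent int)[X]}) x :
  (base_change (laurent_map (fun z : int => z%:~R : R)) f)@_x = laurent_map (fun z : int => z%:~R : R) f@_x.
Proof. exact: base_changeE. Qed.

Section Expansion.
Variables (n : nat) (H : hypergroup) (R : comNzRingType).
Local Notation pt := 'I_(n + n).
Local Notation B := (hg_bas H).
Local Notation D := (diagram n B).
Local Notation emb := (@hg_emb H).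
Local Notation coord := (@hg_coord H).
Local Notation K := (laurent R).

(** The product of two diagrams is a scalar times such an expansion; here the labels
    are arbitrary elements of the algebra, to be varied one at a time. *)
Definition expandZ (m : {ffun pt -> pt}) (l : pt -> H) : {malg (laurent int)[D]} :=
  let S := (\bigcup_(j <- enum pt | enters j) msupp (coord (l j)))%fset in
  \sum_(k : {ffun pt -> S} | [forall j : pt, k (m j) == k j])
     laurentC (\prod_(j : pt | enters j) (coord (l j))@_(val (k j)))
       *: diagram_elt (laurent int) m [ffun j => val (k j)].

Fact expand_key : unit. Proof. exact: tt. Qed.
Definition expand : {ffun pt -> pt} -> (pt -> H) -> {malg K[D]} := locked_with expand_key
  (fun m l => base_change (laurent_map (fun z : int => z%:~R : R)) (expandZ m l)).

Lemma diagram_mulE (X Y : D) :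
  diagram_mul X Y = loop_scalar X Y *: expandZ (comp_match X Y) (comp_label X Y).
Proof. by []. Qed.

Lemma diagram_eltE (Kr : comNzRingType) m (l : {ffun pt -> B}) Z :
  is_diagram (m, l) -> (diagram_elt Kr m l)@_Z = (val Z == (m, l))%:R.
Proof.
rewrite /diagram_elt => dml; rewrite insubT mcoeffU -[in RHS](SubK D dml) val_eqE eq_sym.
by case: eqP.
Qed.

(** In this form neither the choice of the finite set of labels nor the labels at
    the exiting ends of the edges matter. *)
Lemma expandZ_coef m l Z : planar_matching m -> (expandZ m l)@_Z =
  if dmatch Z == m then laurentC (\prod_(j | enters j) (coord (l j))@_(dlabel Z j)) else 0.
Proof.
move=> mP; have mK := matchK mP; rewrite /expandZ; set S := (\bigcup_(_ <- _ | _) _)%fset.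
rewrite raddf_sum /=.
have symk (k : {ffun pt -> S}) : [forall j : pt, k (m j) == k j] ->
    is_diagram (m, [ffun j => val (k j)]).
  by move=> /forallP km; rewrite /is_diagram mP; apply/forallP=> j; rewrite !ffunE /= (eqP (km j)).
under eq_bigr => k km do rewrite mcoeffZ diagram_eltE ?symk //.
have [mZ|mZ] := eqVneq (dmatch Z) m; last first.
  apply: big1 => k _; rewrite (_ : _ == _ = false) ?mulr0 //.
  by apply: contraNF mZ => /eqP E; apply/eqP; apply: (congr1 fst E).
have [/forallP allS|] := boolP [forall j, dlabel Z j \in S].
  pose k0 : {ffun pt -> S} := [ffun j => [` allS j]%fset].
  rewrite (bigD1 k0) /=; last by apply/forallP=> j; rewrite !ffunE -val_eqE /= -mZ dlabel_match.
  rewrite [X in nat_of_bool X](_ : _ = true) ?mulr1; last first.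
    rewrite [val Z]surjective_pairing -/(dmatch Z) -/(dlabel Z) mZ; apply/eqP; congr (_, _).
    by apply/ffunP=> j; rewrite !ffunE.
  rewrite [X in _ + X]big1 ?addr0; first by congr laurentC; apply: eq_bigr => j _; rewrite ffunE.
  move=> k /andP[_ kk0]; rewrite (_ : _ == _ = false) ?mulr0 //; apply: contraNF kk0 => /eqP E.
  have El : dlabel Z = [ffun j => val (k j)] := congr1 snd E.
  by apply/eqP/ffunP=> j; apply: val_inj; rewrite ffunE /= El ffunE.
case/forallPn=> j jS.
have [i ie iS] : exists2 i, enters i & dlabel Z i \notin S.
  have [je|je] := boolP (odd j); first by exists j.
  exists (dmatch Z j); last by rewrite dlabel_match.
  by rewrite /enters dmatch_parity.
have lS : (coord (l i))@_(dlabel Z i) = 0.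
  apply: mcoeff_outdom; apply: contra iS => iS; rewrite /S.
  by apply/bigfcupP; exists i => //; rewrite mem_enum ie.
rewrite [X in laurentC X](bigD1 i) //= lS mul0r [RHS]raddf0; apply: big1 => k _.
rewrite (_ : _ == _ = false) ?mulr0 //; apply: contraNF iS => /eqP E.
have -> : dlabel Z = [ffun j => val (k j)] := congr1 snd E.
by rewrite ffunE; apply: valP.
Qed.

Lemma expand_coef m l Z : planar_matching m -> (expand m l)@_Z =
  if dmatch Z == m then laurentC (\prod_(j | enters j) ((coord (l j))@_(dlabel Z j))%:~R) else 0.
Proof.
move=> mP; rewrite /expand unlock base_changeR_coef expandZ_coef //; case: ifP => _; last exact: raddf0.
by rewrite laurent_mapC rmorph_prod.
Qed.

Lemma eq_expand m (l l' : pt -> H) : planar_matching m -> (forall j : pt, odd j -> l j = l' j) ->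
  expand m l = expand m l'.
Proof.
move=> mP ll; apply/malgP=> Z; rewrite (expand_coef l Z mP) (expand_coef l' Z mP); case: ifP => // _.
by congr laurentC; apply: eq_bigr => j je; rewrite ll.
Qed.

Lemma expand_additive m (l1 l2 l3 : pt -> H) (j0 : pt) : planar_matching m -> odd j0 ->
  l3 j0 = l1 j0 - l2 j0 -> (forall j : pt, odd j -> j != j0 -> l1 j = l3 j) ->
  (forall j : pt, odd j -> j != j0 -> l2 j = l3 j) ->
  expand m l3 = expand m l1 - expand m l2.
Proof.
move=> mP j0e E0 E1 E2; apply/malgP=> Z; rewrite mcoeffB (expand_coef l1 Z mP) (expand_coef l2 Z mP) (expand_coef l3 Z mP).
case: ifP => _; last by rewrite subr0.
rewrite -[RHS]raddfB; congr laurentC; rewrite !(bigD1 j0 j0e) /= E0 raddfB mcoeffB rmorphB mulrBl.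
by congr (_ * _ - _ * _); apply: eq_bigr => j /andP[je jj]; rewrite ?E1 ?E2.
Qed.

Lemma expand_emb m (l : pt -> H) (Z : D) : dmatch Z = m ->
  (forall j : pt, odd j -> l j = emb (dlabel Z j)) -> expand m l = << Z >>.
Proof.
move=> mZ lE; have mP : planar_matching m by rewrite -mZ dmatch_planar.
apply/malgP=> Z'; rewrite expand_coef // mcoeffU.
case: eqP => [mZ'|mZ']; last by case: eqP => // ZZ; rewrite -ZZ in mZ'.
have [ZZ|ZZ] := eqVneq Z Z'.
  rewrite big1 //= => j je; rewrite lE // hg_coord_emb mcoeffU -ZZ eqxx //.
have [j je jZ] : exists2 j : pt, odd j & dlabel Z j != dlabel Z' j.
  have [/forallP allE|] := boolP [forall j : pt, odd j ==> (dlabel Z j == dlabel Z' j)]; last first.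
    by case/forallPn=> j; rewrite negb_imply => /andP[]; exists j.
  case/eqP: ZZ; apply: val_inj; rewrite [LHS]surjective_pairing [RHS]surjective_pairing.
  congr (_, _); first by rewrite -/(dmatch Z) -/(dmatch Z') mZ.
  apply/ffunP=> j; rewrite -/(dlabel Z) -/(dlabel Z').
  have [je|je] := boolP (odd j); first by apply/eqP; apply: (implyP (allE j)).
  have := implyP (allE (m j)); rewrite -{3}mZ' -{2}mZ !dlabel_match => E; apply/eqP/E.
  by rewrite -mZ dmatch_parity.
by rewrite (bigD1 j) //= lE // hg_coord_emb mcoeffU (negPf jZ) mul0r [LHS]raddf0.
Qed.

Local Notation ept := {j : pt | odd j}.

(** Each edge has one entering end, so a family indexed by the entering points is
    one free choice of label for each edge. *)
Definition ext_label (l : {ffun ept -> H}) (j : pt) : H := oapp l 0 (insub j).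

Lemma ext_labelE (l : {ffun ept -> H}) (j : pt) (je : odd j) : ext_label l j = l (Sub j je).
Proof. by rewrite /ext_label insubT. Qed.

Lemma expand_multiadditive m : planar_matching m ->
  multiadditive (fun l => expand m (ext_label l)).
Proof.
move=> mP j0 l a b; apply: (@expand_additive _ _ _ _ (val j0)).
- exact: mP.
- exact: (valP j0).
- have E c : ext_label (upd l j0 c) (val j0) = c by rewrite /ext_label valK /= updE eqxx.
  by rewrite (E a) (E b) (E (a - b)).
- by move=> j je jj; rewrite !(ext_labelE _ je) !updE -val_eqE /= (negPf jj).
by move=> j je jj; rewrite !(ext_labelE _ je) !updE -val_eqE /= (negPf jj).
Qed.

(** A functional on diagrams extends to labels in the algebra; to identify the
    extension it is enough that it be additive in each label. *)
Lemma lincomb_expand (V : lmodType K) (F : D -> V) (Phi : {ffun ept -> H} -> V) m :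
  planar_matching m -> multiadditive Phi ->
  (forall (Z : D) (l : {ffun ept -> H}), dmatch Z = m -> (forall j, l j = emb (dlabel Z (val j))) -> Phi l = F Z) ->
  forall l, lincomb F (expand m (ext_label l)) = Phi l.
Proof.
move=> mP aPhi PhiF; apply: (multiadd_ext (@hg_gen H)) => //.
  by move=> j l a b; rewrite (expand_multiadditive mP) lincombB.
move=> l lb; have [k kP] := fin_all_exists lb.
pose lZ : {ffun pt -> B} := [ffun j => oapp k (oapp k (hg_one H) (insub (m j))) (insub j)].
have dZ : is_diagram (m, lZ).
  rewrite /is_diagram mP; apply/forallP=> j; rewrite !ffunE /= (matchK mP).
  have mo := match_parity mP j.
  case: (insubP ept (m j)) => [v vo _|vno]; case: (insubP ept j) => [u uo _|uno] /=.
  - by rewrite mo uo in vo.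
  - exact: eqxx.
  - exact: eqxx.
  by rewrite mo (negPf uno) in vno.
pose Z : D := Sub _ dZ.
have mZ : dmatch Z = m by rewrite /dmatch SubK.
have lE (j : ept) : l j = emb (dlabel Z (val j)).
  by rewrite kP /dlabel SubK /= ffunE valK.
rewrite (@expand_emb m _ Z mZ) ?lincombU1; first exact/esym/PhiF.
by move=> j je; rewrite ext_labelE lE.
Qed.

End Expansion.

(** * Rings of boxes *)

Section Rings.
Variables (n : nat) (H : hypergroup) (R : comNzRingType).
Local Notation pt := 'I_(n + n).
Local Notation B := (hg_bas H).
Local Notation emb := (@hg_emb H).
Local Notation K := (laurent R).

Definition loop_value (a : H) : K := deltaR R * laurentC (hg_trace a)%:~R.

Lemma loop_value_is_additive : additive loop_value.
Proof.
by move=> a b; rewrite /loop_value hg_traceB rmorphB [laurentC _]raddfB mulrBr.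
Qed.
HB.instance Definition _ := GRing.isAdditive.Build H K loop_value loop_value_is_additive.

Lemma loop_valueC a b : loop_value (a * b) = loop_value (b * a).
Proof. by rewrite /loop_value hg_traceC. Qed.

Lemma loop_value_emb b c : loop_value (emb b * emb c) = deltaR R * laurentC (b == hg_barB c)%:R.
Proof. by rewrite /loop_value hg_trace_emb rmorph_nat. Qed.

Section Ring.
Variables (I : finType) (u d : I -> I).
Variables (mm : I -> {ffun pt -> pt}) (ll : I -> pt -> H).

(** The boxes are arranged in a ring, the bottom of each of them being glued to the
    top of the next one: u i is the box above i and d i the one below. *)
Definition rnext (w : I * pt) : I * pt :=
  let q := mm w.1 w.2 in ((if (q < n)%N then u w.1 else d w.1), rev_ord q).

Definition rlabel (w : I * pt) : H := ll w.1 w.2.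
Definition renters (w : I * pt) : bool := odd w.2.

(** The scalar to which the closed diagram on the annulus evaluates, all its
    components being closed loops. *)
Definition ring_value : K := zeta loop_value rnext rlabel (fun w => odd w.2).

Hypotheses (uK : cancel u d) (dK : cancel d u) (mP : forall i, planar_matching (mm i)).

Lemma rnext_inj : injective rnext.
Proof.
move=> [i p] [j q] E; have /= E1 := congr1 fst E; have /= /rev_ord_inj E2 := congr1 snd E.
rewrite E2 in E1; have ij : i = j by case: ifP E1 => _; [move/(can_inj uK)|move/(can_inj dK)].
by rewrite -ij in E2 *; rewrite (match_inj (mP i) E2).
Qed.

Lemma rnext_enters w : renters w -> renters (rnext w).
Proof. by rewrite /renters odd_rev_ord match_parity ?negbK. Qed.

End Ring.

Lemma eq_ring_value (I : finType) (u d : I -> I) mm mm' ll ll' :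
  cancel u d -> cancel d u -> (forall i, planar_matching (mm i)) ->
  (forall i, mm i = mm' i) -> (forall i (p : pt), odd p -> ll i p = ll' i p) ->
  ring_value u d mm ll = ring_value u d mm' ll'.
Proof.
move=> uK dK mP Em El; have mP' i : planar_matching (mm' i) by rewrite -Em.
apply: (zeta_bij loop_valueC (h := id)) => //.
- exact: rnext_inj.
- exact: rnext_inj.
- by move=> y; exists y.
- exact: rnext_enters.
- by case=> i p; rewrite /rnext /= Em.
by case=> i p; rewrite /renters /rlabel /= => /El->.
Qed.

Lemma ring_value_bij (I J : finType) (u d : I -> I) (u' d' : J -> J) mm mm' ll ll' (h : I -> J) :
  cancel u d -> cancel d u -> (forall i, planar_matching (mm i)) ->
  bijective h -> (forall i, u' (h i) = h (u i)) -> (forall i, d' (h i) = h (d i)) ->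
  (forall i, mm' (h i) = mm i) -> (forall i (p : pt), odd p -> ll' (h i) p = ll i p) ->
  ring_value u' d' mm' ll' = ring_value u d mm ll.
Proof.
move=> uK dK mP hB uh dh Em El; case: (hB) => k hK kK.
have mP' i : planar_matching (mm' i) by rewrite -[i]kK Em.
have uK' : cancel u' d' by move=> i; rewrite -[i]kK uh dh uK.
have dK' : cancel d' u' by move=> i; rewrite -[i]kK dh uh dK.
apply: (zeta_bij loop_valueC (h := fun w => (h w.1, w.2))).
- exact: rnext_inj.
- exact: rnext_inj.
- by case=> i p [j q] [/(can_inj hK)-> ->].
- by case=> i p; exists (k i, p); rewrite /= kK.
- exact: rnext_enters.
- by case=> i p; rewrite /rnext /= Em uh dh; case: ifP.
- by [].
by case=> i p; rewrite /renters /rlabel /= => /El->.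
Qed.

(** Turning the ring upside down while reflecting every box inverts the
    permutation that follows the edges. *)
Lemma ring_value_reverse (I : finType) (u d : I -> I) (mm mm' : I -> {ffun pt -> pt}) ll ll' (psi : H -> H) :
  cancel u d -> cancel d u -> (forall i, planar_matching (mm i)) ->
  psi 1 = 1 -> (forall a b, psi (a * b) = psi b * psi a) ->
  (forall a, hg_trace (psi a) = hg_trace a) ->
  (forall i p, mm' i p = rev_ord (mm i (rev_ord p))) ->
  (forall i (p : pt), odd p -> ll' i p = psi (ll i (mm i (rev_ord p)))) ->
  ring_value d u mm' ll' = ring_value u d mm ll.
Proof.
move=> uK dK mP psi1 psiM psit Em El.
have mP' i : planar_matching (mm' i).
  have mK := matchK (mP i); apply/and3P; split.
  - by apply/forallP=> p; rewrite !Em !rev_ordK mK rev_ordK.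
  - apply/forallP=> p; rewrite Em; apply/eqP=> E.
    by have := match_neq (mP i) (rev_ord p); rewrite -{2}E rev_ordK eqxx.
  apply/forallP=> p; apply/forallP=> q; rewrite !Em /=.
  have := match_nocross (mP i) (mm i (rev_ord q)) (mm i (rev_ord p)); rewrite !mK /=.
  have := (ltn_ord (mm i (rev_ord q)), ltn_ord (mm i (rev_ord p)), ltn_ord p, ltn_ord q).
  by case=> -[[]]; lia.
have revn (q : pt) : (rev_ord q < n)%N = ~~ (q < n)%N.
  by rewrite /=; have := ltn_ord q; lia.
(* The inverse of the permutation for the ring (u, d), and the bijection nb that
   conjugates it to the permutation for the reflected ring. *)
pose nb (w : I * pt) := if (w.2 < n)%N then u w.1 else d w.1.
pose g (w : I * pt) := (nb w, mm (nb w) (rev_ord w.2)).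
have fK : cancel (rnext u d mm) g.
  case=> i p; rewrite /g /nb /rnext /= revn.
  by case: (mm i p < n)%N => /=; rewrite ?uK ?dK rev_ordK matchK.
have gK : cancel g (rnext u d mm).
  case=> i p; rewrite /rnext /= matchK // revn rev_ordK /nb /=.
  by case: (p < n)%N => /=; rewrite ?uK ?dK.
transitivity (zeta loop_value g (fun w => psi (rlabel ll (g w))) (fun w => odd w.2)).
  apply: (zeta_bij loop_valueC (h := fun w => (nb w, w.2))).
  + exact: rnext_inj.
  + exact: (can_inj gK).
  + apply: (can_inj (g := fun w : I * pt => ((if (w.2 < n)%N then d w.1 else u w.1), w.2))).
    by case=> i p; rewrite /nb /=; case: (p < n)%N; rewrite ?uK ?dK.
  + case=> i p; exists ((if (p < n)%N then d i else u i), p).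
    by rewrite /nb /=; case: (p < n)%N; rewrite ?uK ?dK.
  + exact: rnext_enters.
  + case=> i p; rewrite {1}/rnext [nb (g _)]/nb /= Em -[(_ < n)%N]negbK -revn.
    by rewrite rev_ordK; case: (_ < n)%N.
  + by [].
  by case=> i p po; rewrite /rlabel /= El.
rewrite /ring_value; apply: (zeta_inv loop_valueC (psi := psi) (can_inj fK) fK gK _ psi1 psiM).
- exact: rnext_enters.
- by move=> a; rewrite -[LHS]/(loop_value _) -[RHS]/(loop_value _) /loop_value psit.
by move=> x _.
Qed.

End Rings.

Arguments loop_valueC {H R}.

Section Merge.
Variables (n : nat) (H : hypergroup) (R : comNzRingType).
Local Notation pt := 'I_(n + n).
Local Notation B := (hg_bas H).
Local Notation D := (diagram n B).
Local Notation emb := (@hg_emb H).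
Local Notation K := (laurent R).

Definition loopK (X Y : D) : K := laurent_map (fun z : int => z%:~R : R) (loop_scalar X Y).

Lemma path_labelE (X Y : D) p :
  path_label X Y p = path_prod (fun w => emb (stack_label X Y w)) p.
Proof. by []. Qed.

Lemma loopKE X Y : loopK X Y =
  \prod_(w | is_loop_base X Y w) loop_value R (path_label X Y (orbit (stack_next X Y) w)).
Proof.
rewrite /loopK /loop_scalar rmorph_prod; apply: eq_bigr => w _.
by rewrite rmorphM /= laurent_map_delta laurent_mapC.
Qed.

Variables (I : finType) (u d : I -> I) (mm : I -> {ffun pt -> pt}) (ll : I -> pt -> H).
Variables (a : I) (X Y : D).
Hypotheses (uK : cancel u d) (dK : cancel d u) (mP : forall i, planar_matching (mm i)).
Hypotheses (mmE : mm a = comp_match X Y) (llE : forall p : pt, odd p -> ll a p = comp_label X Y p).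

(** The ring in which the box a is replaced by the stack of X, still called a,
    and of Y, a new box. *)
Definition split_u (o : option I) : option I :=
  if o is Some i then (if i == d a then None else Some (u i)) else Some a.
Definition split_d (o : option I) : option I :=
  if o is Some i then (if i == a then None else Some (d i)) else Some (d a).
Definition split_box (T : Type) (f : I -> T) (x y : T) (o : option I) : T :=
  if o is Some i then (if i == a then x else f i) else y.

Lemma split_uK : cancel split_u split_d.
Proof.
case=> [i|] /=; last by rewrite eqxx.
have [->//|ia] := eqVneq i (d a).
by rewrite /= (can2_eq uK dK) (negPf ia) uK.
Qed.

Lemma split_dK : cancel split_d split_u.
Proof.
case=> [i|] /=; last by rewrite eqxx.
have [->//|ia] := eqVneq i a.
by rewrite /= (can_eq dK) (negPf ia) dK.
Qed.

Local Notation next := (stack_next X Y).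
Let smm := split_box mm (dmatch X) (dmatch Y).
Let sll := split_box ll (emb \o dlabel X) (emb \o dlabel Y).
Let f := rnext split_u split_d smm.
Let f' := rnext u d mm.
(* The stack of X on Y inside the large ring, and the points at which the small
   ring is seen in it, with the paths between them. *)
Let inj w : option I * pt := ((if w.1 then Some a else None), w.2).
Let iota (x : I * pt) : option I * pt :=
  if x.1 == a then inj (stack_in x.2) else (Some x.1, x.2).
Let seg (x : I * pt) := if x.1 == a then map inj (stack_path X Y x.2) else [:: iota x].

Let smmP o : planar_matching (smm o).
Proof. by case: o => [i|] /=; [case: ifP => _|]; rewrite ?dmatch_planar. Qed.

Let fI : injective f.
Proof. exact: rnext_inj split_uK split_dK smmP. Qed.

Let f'I : injective f'.
Proof. exact: rnext_inj. Qed.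

Let injI : injective inj.
Proof.
by case=> b p [c q] E; have := congr1 fst E; have /= -> := congr1 snd E; case: b c {E} => [] [].
Qed.

Let rev_ltn (q : pt) : (rev_ord q < n)%N = ~~ (q < n)%N.
Proof. by rewrite /=; have := ltn_ord q; lia. Qed.

Let f_inj w : f (inj w) = if stack_outer (stack_end X Y w)
  then iota ((if ((stack_end X Y w).2 < n)%N then u a else d a), rev_ord (stack_end X Y w).2)
  else inj (cross (stack_end X Y w)).
Proof.
case: w => b p; rewrite /f /rnext /inj /stack_end /stack_outer /cross /iota /=.
case: b => /=; rewrite ?eqxx; set q := (_ : {ffun _}) _.
  case qn: (q < n)%N => //=.
  rewrite /inj /= rev_ltn qn /= (can2_eq uK dK).
  by case: (a == d a).
case qn: (q < n)%N => //=.
by rewrite /inj /= rev_ltn qn /=; case: eqP => [->|//].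
Qed.

Let f_out x : x.1 != a -> f (Some x.1, x.2) = iota (f' x).
Proof.
case: x => i p /= ia; rewrite /f /f' /rnext /= (negPf ia) /iota /inj /=.
set q := mm i p; rewrite rev_ltn; case: (q < n)%N => /=.
  by rewrite (can2_eq uK dK); case: (i == d a).
by case: eqP => [->|//].
Qed.

Let iota_outer w : inj w \in codom iota -> stack_outer w.
Proof.
case/codomP=> -[i p]; rewrite /iota /=; case: eqP => [_ /injI->|ia /(congr1 fst)]; first exact: outer_in.
by rewrite /inj /=; case: w.1 => // -[/esym].
Qed.

Let iter_inj w t : (forall s, (s < t)%N -> ~~ stack_outer (stack_end X Y (iter s next w))) ->
  iter t f (inj w) = inj (iter t next w).
Proof.
elim: t => //= t IHt Ht; rewrite IHt; last by move=> s st; apply: Ht; apply: ltnW.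
by rewrite f_inj /= (negPf (Ht t _)).
Qed.

Let loop_inner w : is_loop_base X Y w ->
  forall v, v \in orbit next w -> ~~ stack_outer (stack_end X Y v) && ~~ stack_outer v.
Proof.
case/and3P=> _ _ /hasPn noh v vw; rewrite noh //= -outer_cross.
have nI := stack_next_inj (X := X) (Y := Y).
have : finv next v \in orbit next w.
  by rewrite -fconnect_orbit (connect_trans _ (fconnect_finv _ v)) // fconnect_orbit.
by move/noh; rewrite -outer_cross -stack_nextE f_finv // outer_cross.
Qed.

(** The ring of boxes factors the product X * Y: its loops split off, and its
    edges are the first-return paths to the outer points of the stack. *)
Lemma ring_value_split : ring_value R split_u split_d smm sll = loopK X Y * ring_value R u d mm ll.
Proof.
have nI := stack_next_inj (X := X) (Y := Y).
have iotaI : injective iota.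
  move=> [i p] [j q]; rewrite /iota /=; case: eqP => [->|ia]; case: eqP => [->|ja].
  - by move/injI/(congr1 snd) => /= ->.
  - by move/(congr1 fst); rewrite /inj /=; case: ifP => // _ [/esym/ja].
  - by move/(congr1 fst); rewrite /inj /=; case: ifP => // _ [/ia].
  by case=> -> ->.
have segP x : seg x = traject f (iota x) (size (seg x)).
  rewrite /seg {2}/iota; case: eqP => [_|/eqP xa]; last by rewrite /= /iota (negPf xa).
  have [k kP] := ex_path_to X Y x.2.
  rewrite (stack_pathE kP) size_map size_traject.
  apply: (@eq_from_nth _ (inj (stack_in x.2))); rewrite size_map !size_traject // => t tk.
  rewrite (nth_map (stack_in x.2)) ?size_traject // !nth_traject // iter_inj // => s st.
  by case: kP => kmin _; apply: kmin; apply: leq_trans st _.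
have seg0 x : (0 < size (seg x))%N.
  rewrite /seg; case: eqP => // _; have [k kP] := ex_path_to X Y x.2.
  by rewrite (stack_pathE kP).
have segN x : f (last (iota x) (seg x)) = iota (f' x).
  rewrite /seg; case: eqP => [xa|/eqP xa]; last by rewrite /= {1}/iota (negPf xa) f_out.
  have [k kP] := ex_path_to X Y x.2.
  rewrite (stack_pathE kP) /= last_map last_traject f_inj.
  by rewrite (comp_in kP) outer_in /= /f' /rnext /= xa mmE.
have segF x y : y \in behead (seg x) -> y \notin codom iota.
  rewrite /seg; case: eqP => // _; have [k kP] := ex_path_to X Y x.2.
  rewrite (stack_pathE kP) /= => /mapP[w /trajectP[t tk ->] ->].
  rewrite -iterSr; apply/negP=> /iota_outer; apply/negP; exact: iter_inner kP tk.
have labE x : odd (iota x).2 -> rlabel ll x = path_prod (rlabel sll) (seg x).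
  case: x => i p; rewrite /rlabel /seg /=; case: eqP => [->|/eqP ia]; last first.
    by rewrite path_prod1 /iota /= (negPf ia) /= (negPf ia).
  rewrite /iota /= eqxx /= => po; rewrite llE //.
  rewrite path_prod_map /comp_label path_labelE; apply: eq_plab => -[b q] _ /=.
  by rewrite /inj /stack_label /rlabel /=; case: b; rewrite //= eqxx.
have fodd (w : option I * pt) : odd w.2 -> odd (f w).2 by apply: rnext_enters.
rewrite /ring_value mulrC (zeta_first_return loop_valueC fI f'I iotaI fodd segP seg0 segN segF labE).
congr (_ * _).
  by rewrite !zetaE; apply: eq_bigl => -[i p] /=; rewrite /iota /=; case: ifP.
have PC := @closed_connect _ f (fun w => odd w.2) fodd.
rewrite loopKE -(@prod_transversal _ _ f fI (fun w => cycle_value (loop_value R) f (rlabel sll) w)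
  (fun w => odd w.2 && ~~ has (mem (codom iota)) (orbit f w))
  (mem (inj @: [set w | is_loop_base X Y w]))).
- rewrite big_imset => [|x y _ _ /injI//].
  rewrite [LHS](eq_bigl (is_loop_base X Y)); last by move=> w; rewrite inE.
  apply: eq_bigr => w lw; have lin := loop_inner lw.
  rewrite (@cycle_value_cycle _ _ _ loop_valueC _ f _ (map inj (orbit next w))).
  + congr (loop_value R _); rewrite path_labelE path_prod_map; apply: eq_plab => -[b q] _.
    by rewrite /inj /stack_label /rlabel /=; case: b; rewrite //= eqxx.
  + apply: (homo_cycle_in (P := mem (orbit next w))) (cycle_orbit nI w); last exact/allP.
    move=> x y /lin /andP[xi _] _ /eqP <-; by rewrite /= f_inj /= (negPf xi).
  + by rewrite (map_inj_uniq injI) orbit_uniq.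
  by rewrite map_f ?in_orbit.
- exact: (cycle_value_connect loop_valueC fI (rlabel sll)).
- move=> x y xy /andP[xo nx]; rewrite (PC _ _ xy xo) /=; apply: contra nx => /hasP[z].
  rewrite -fconnect_orbit => yz zi; apply/hasP; exists z => //.
  by rewrite -fconnect_orbit (connect_trans xy).
- move=> x /imsetP[w]; rewrite inE => lw ->; have lin := loop_inner lw.
  have wo : odd (inj w).2 by case/and3P: lw.
  rewrite wo /=; apply/hasPn=> z; rewrite -fconnect_orbit => /iter_findex <-.
  have lt s : ~~ stack_outer (stack_end X Y (iter s next w)).
    by have /lin/andP[] : iter s next w \in orbit next w by rewrite -fconnect_orbit fconnect_iter.
  rewrite iter_inj => [|s _]; last exact: lt.
  apply/negP=> /iota_outer; apply/negP.
  by have /lin/andP[] : iter (findex f (inj w) z) next w \in orbit next w by rewrite -fconnect_orbit fconnect_iter.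
- case=> o p /andP[/= po /hasPn nx].
  have [w Ew] : exists w, (o, p) = inj w.
    case: o nx => [i|] nx; last by exists (false, p).
    have [->|ia] := eqVneq i a; first by exists (true, p).
    have /negP[] := nx _ (in_orbit f _).
    by apply/codomP; exists (i, p); rewrite /iota /= (negPf ia).
  rewrite Ew in nx *; have wo : odd w.2 by case: w Ew {nx} => b q [_ <-].
  have lt s : ~~ stack_outer (stack_end X Y (iter s next w)).
    elim/ltn_ind: s => s IHs; apply/negP=> so.
    have := nx (iter s.+1 f (inj w)); rewrite iterS iter_inj // f_inj /= so.
    rewrite codom_f => /(_ _)/negP; apply=> //.
    rewrite -fconnect_orbit; apply: (connect_trans (y := inj (iter s next w))).
      by rewrite -(iter_inj (t := s)) ?fconnect_iter.
    by apply: connect1; rewrite /= f_inj /= so.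
  exists (inj (froot next w)); last first.
    have := connect_root (frel next) w => /iter_findex <-.
    by rewrite -iter_inj ?fconnect_iter.
  apply/imsetP; exists (froot next w) => //; rewrite inE; apply/and3P; split.
  + by have := connect_root (frel next) w => /iter_findex <-; rewrite /enters enters_iter.
  + by apply/eqP/root_root; apply: fconnect_sym.
  apply/hasPn=> z; rewrite -fconnect_orbit => wz.
  by have := connect_trans (connect_root (frel next) w) wz => /iter_findex <-.
move=> x y /imsetP[w]; rewrite inE => lw -> /imsetP[v]; rewrite inE => lv ->.
have lin := loop_inner lw.
move/iter_findex; rewrite iter_inj => [/injI E|s _]; last first.
  by have /lin/andP[] : iter s next w \in orbit next w by rewrite -fconnect_orbit fconnect_iter.
congr inj; case/and3P: lw => _ /eqP <- _; case/and3P: lv => _ /eqP <- _.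
by apply/eqP; rewrite (root_connect (fconnect_sym nI)) -E fconnect_iter.
Qed.

End Merge.

(** * The trace pairing *)

Lemma malg_neq0P (X : choiceType) (G : zmodType) (f : {malg G[X]}) :
  f <> 0 -> exists x, f@_x != 0.
Proof.
move=> f0; have [E|[x xf]] := fset_0Vmem (msupp f); last by exists x; rewrite mcoeff_neq0.
by case: f0; apply/malgP=> x; rewrite mcoeff0; apply: mcoeff_outdom; rewrite E.
Qed.

Lemma card_odd_ord n : #|[set p : 'I_(n + n) | odd p]| = n.
Proof.
have := cardsC [set p : 'I_(n + n) | odd p]; rewrite card_ord.
have -> : ~: [set p : 'I_(n + n) | odd p] = @rev_ord (n + n) @: [set p : 'I_(n + n) | odd p].
  apply/setP=> p; rewrite !inE; apply/idP/imsetP=> [po|[q]].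
    by exists (rev_ord p); rewrite ?rev_ordK // inE odd_rev_ord.
  by rewrite inE => qo ->; rewrite odd_rev_ord negbK.
by rewrite card_imset; [lia|apply: rev_ord_inj].
Qed.

Section Pairing.
Variables (n : nat) (H : hypergroup) (R : comNzRingType).
Local Notation pt := 'I_(n + n).
Local Notation B := (hg_bas H).
Local Notation D := (diagram n B).
Local Notation emb := (@hg_emb H).
Local Notation K := (laurent R).

Lemma diagram_eqP (X Y : D) : dmatch X = dmatch Y ->
  (forall p : pt, odd p -> dlabel X p = dlabel Y p) -> X = Y.
Proof.
move=> Em El; apply: val_inj; rewrite [LHS]surjective_pairing [RHS]surjective_pairing.
congr (_, _); first exact: Em.
apply/ffunP=> j; rewrite -/(dlabel X) -/(dlabel Y).
have [je|je] := boolP (odd j); first exact: El.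
by rewrite -(dlabel_match X) -(dlabel_match Y) -Em El // dmatch_parity.
Qed.

Fact ring_valueD_key : unit. Proof. exact: tt. Qed.
Definition ring_valueD : forall I : finType, (I -> I) -> (I -> I) -> (I -> D) -> K :=
  locked_with ring_valueD_key (fun I u d bx =>
    ring_value R u d (fun i => dmatch (bx i)) (fun i j => emb (dlabel (bx i) j))).

Lemma ring_valueDE (I : finType) (u d : I -> I) (bx : I -> D) :
  ring_valueD u d bx = ring_value R u d (fun i => dmatch (bx i)) (fun i j => emb (dlabel (bx i) j)).
Proof. by rewrite /ring_valueD unlock. Qed.

Fact prodD_key : unit. Proof. exact: tt. Qed.
Definition prodD : D -> D -> {malg K[D]} := locked_with prodD_key
  (fun X Y => base_change (laurent_map (fun z : int => z%:~R : R)) (diagram_mul X Y)).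

Lemma prodDE X Y : prodD X Y = loopK R X Y *: expand R (comp_match X Y) (comp_label X Y).
Proof.
by rewrite /prodD unlock diagram_mulE base_changeZ /expand unlock.
Qed.

Section RingValue.
Variables (I : finType) (u d : I -> I).
Hypotheses (uK : cancel u d) (dK : cancel d u).

Lemma eq_ring_valueD bx bx' : (forall i, bx i = bx' i) -> ring_valueD u d bx = ring_valueD u d bx'.
Proof.
by move=> E; rewrite !ring_valueDE; apply: eq_ring_value => // [i|i|i p _]; rewrite ?E //; apply: dmatch_planar.
Qed.

Lemma ring_valueD_bij (J : finType) (u' d' : J -> J) bx bx' (h : I -> J) : bijective h ->
  (forall i, u' (h i) = h (u i)) -> (forall i, d' (h i) = h (d i)) ->
  (forall i, bx' (h i) = bx i) -> ring_valueD u' d' bx' = ring_valueD u d bx.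
Proof.
move=> hB uh dh E; rewrite !ring_valueDE; apply: (@ring_value_bij _ _ _ _ _ _ _ _ _ _ _ _ _ h) => // [i|i|i p _]; rewrite ?E //; apply: dmatch_planar.
Qed.

Lemma ring_value_additive (mm : I -> {ffun pt -> pt}) (ll1 ll2 ll3 : I -> pt -> H) a (p0 : pt) :
  (forall i, planar_matching (mm i)) -> odd p0 -> ll3 a p0 = ll1 a p0 - ll2 a p0 ->
  (forall i (p : pt), (i, p) != (a, p0) -> ll1 i p = ll3 i p) ->
  (forall i (p : pt), (i, p) != (a, p0) -> ll2 i p = ll3 i p) ->
  ring_value R u d mm ll3 = ring_value R u d mm ll1 - ring_value R u d mm ll2.
Proof.
move=> mP p0o E0 E1 E2; apply: (@zeta_additive _ _ _ _ _ (rnext_inj uK dK mP) _ _ _ _ (a, p0)).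
- exact: rnext_enters.
- exact: p0o.
- exact: E0.
- by case=> i p; apply: E1.
by case=> i p; apply: E2.
Qed.

(** The sum over the terms of the product is, by additivity in each label, the ring
    in which the labels of the product are left unexpanded, and [ring_value_split]
    applies to that ring. *)
Lemma ring_valueD_split bx a X Y :
  lincomb (fun Z => ring_valueD u d (fun i => if i == a then Z else bx i) : K^o) (prodD X Y) =
  ring_valueD (split_u u d a) (split_d d a) (split_box a bx X Y).
Proof.
have cP := comp_planar X Y.
pose mm i := if i == a then comp_match X Y else dmatch (bx i).
have mP i : planar_matching (mm i) by rewrite /mm; case: ifP => _; rewrite ?dmatch_planar.
pose ll (l : pt -> H) i p := if i == a then l p else emb (dlabel (bx i) p).
rewrite prodDE lincombZ.
pose l : {ffun {j : pt | odd j} -> H} := [ffun j => comp_label X Y (val j)].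
have lE (p : pt) : odd p -> ext_label l p = comp_label X Y p.
  by move=> po; rewrite (ext_labelE _ po) ffunE.
rewrite (@eq_expand _ _ _ _ (comp_label X Y) (ext_label l)) //; last by move=> j /lE.
rewrite (@lincomb_expand _ _ _ K^o _ (fun l => ring_value R u d mm (ll (ext_label l)))) //.
- rewrite -[_ *: _]/(loopK R X Y * _) -(@ring_value_split _ _ _ _ u d mm (ll (ext_label l)) a X Y) //.
  + rewrite [RHS]ring_valueDE; apply: eq_ring_value.
    * exact: split_uK.
    * exact: split_dK.
    * by case=> [i|] /=; [case: ifP => _|]; rewrite ?dmatch_planar.
    * by case=> [i|] //=; rewrite /mm; case: (i == a).
    by case=> [i|] p po //=; rewrite /ll; case: (i == a).
  + by rewrite /mm eqxx.
  by move=> p po; rewrite /ll eqxx lE.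
- move=> j k x y; apply: (@ring_value_additive _ _ _ _ a (val j)) => //.
  + exact: (valP j).
  + have E c : ext_label (upd k j c) (val j) = c by rewrite /ext_label valK /= updE eqxx.
    by rewrite /ll eqxx (E x) (E y) (E (x - y)).
  + move=> i p ip; rewrite /ll; case: eqP => // ia.
    rewrite /ext_label; case: insubP => //= q qo qp; rewrite !updE.
    case: eqP => // qj; move: ip; rewrite ia -qp qj eqxx //.
  move=> i p ip; rewrite /ll; case: eqP => // ia.
  rewrite /ext_label; case: insubP => //= q qo qp; rewrite !updE.
  by case: eqP => // qj; move: ip; rewrite ia -qp qj eqxx.
move=> Z k mZ kE; rewrite ring_valueDE; apply: eq_ring_value => //.
  by move=> i; rewrite /mm; case: eqP => [_|//]; rewrite mZ.
by move=> i p po; rewrite /ll; case: eqP => [_|//]; rewrite (ext_labelE _ po) kE.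
Qed.

End RingValue.

Definition tpairD (X Y : D) : K := ring_valueD negb negb (fun b => if b then X else Y).

Definition tpair (f : {malg K[D]}) (W : D) : K^o := lincomb (fun X => tpairD X W : K^o) f.

Local Notation refl := (reflect_diagram (@hg_barB H)).

Lemma dmatch_reflect g (X : D) p : dmatch (reflect_diagram g X) p = rev_ord (dmatch X (rev_ord p)).
Proof. by rewrite /dmatch SubK /= ffunE. Qed.

Lemma dlabel_reflect g (X : D) p : dlabel (reflect_diagram g X) p = g (dlabel X (rev_ord p)).
Proof. by rewrite /dlabel SubK /= ffunE. Qed.

Lemma reflect_involutive g : involutive g -> involutive (reflect_diagram g : D -> D).
Proof.
move=> gK X; apply: diagram_eqP => [|p _].
  by apply/ffunP=> p; rewrite !dmatch_reflect !rev_ordK.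
by rewrite !dlabel_reflect rev_ordK gK.
Qed.

(** The edges of X number n, and every loop contains one of them: there are at most n
    loops, and n of them only if each consists of one edge of X and one of Y, which
    makes Y the mirror image of X. Each loop then contributes the trace of a label
    of X times a label of Y, which is 1 or 0. *)
Lemma tpairD_lead X Y :
  (Y != refl X /\
    exists2 c, (c < n)%N & exists C, tpairD X Y = deltaR R ^+ c * laurentC C) \/
  tpairD X Y = deltaR R ^+ n * laurentC (Y == refl X)%:R.
Proof.
rewrite /tpairD ring_valueDE /ring_value; set mm := fun i : bool => _; set f := rnext _ _ mm.
set lab := rlabel _.
have mP i : planar_matching (mm i) by rewrite /mm; case: ifP => _; rewrite dmatch_planar.
have fI : injective f by apply: rnext_inj => //; apply: negbK.
have symf := fconnect_sym fI.
have fo (w : bool * pt) : odd w.2 -> odd (f w).2 by apply: rnext_enters.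
have f1 (w : bool * pt) : (f w).1 = ~~ w.1 by rewrite /f /rnext /=; case: ifP.
have fE b (p : pt) : f (b, p) = (~~ b, rev_ord (mm b p)).
  by rewrite /f /rnext /=; case: ifP.
have PC := closed_connect fo.
have [/forallP all2|] := boolP [forall p : pt, odd p ==> (f (f (true, p)) == (true, p))]; last first.
  case/forallPn=> p0; rewrite negb_imply => /andP[p0o ff0]; left; split.
    apply: contra ff0 => /eqP YX; rewrite (fE true p0) (fE false) -[mm false _]/(dmatch Y _) -[mm true _]/(dmatch X _) YX dmatch_reflect.
    by rewrite !rev_ordK dmatchK.
  pose Rt := [set w : bool * pt | odd w.2 && (froot f w == w)].
  exists #|Rt|; last first.
    exists (\prod_(w in Rt) (hg_trace (path_prod lab (orbit f w)))%:~R).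
    rewrite zetaE (eq_bigl (mem Rt)) => [|w]; last by rewrite !inE.
    by rewrite /cycle_value /= /loop_value big_split /= prodr_const [laurentC _]rmorph_prod.
  (* Each loop is represented by a point of X at which an edge is entered; were
     there n loops, each would contain only one such point. *)
  pose r (w : bool * pt) := if w.1 then w.2 else (f w).2.
  have rw w : fconnect f w (true, r w).
    case: w => [[] p]; rewrite /r ?connect0 //=; apply: connect1.
    by rewrite /= fE /= eqxx.
  have rI : {in Rt &, injective r}.
    move=> w v; rewrite !inE => /andP[_ /eqP rwE] /andP[_ /eqP rvE] E.
    rewrite -rwE -rvE; apply/eqP; rewrite (root_connect symf).
    by apply: connect_trans (rw w) _; rewrite E symf.
  rewrite -(card_in_imset rI) -[X in (_ < X)%N](card_odd_ord n); apply: proper_card.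
  rewrite properEneq; apply/andP; split; last first.
    apply/subsetP=> p /imsetP[w]; rewrite !inE => /andP[wo _] ->.
    exact: (PC _ _ (rw w)).
  pose p1 := (f (f (true, p0))).2.
  have Ep1 : f (f (true, p0)) = (true, p1) by rewrite [LHS]surjective_pairing !f1.
  have p1o : odd p1 by rewrite /p1 fo ?fo.
  apply/eqP=> ER; have /imsetP[w0 w0R E0] : p0 \in r @: Rt by rewrite ER inE.
  have /imsetP[w1 w1R E1] : p1 \in r @: Rt by rewrite ER inE.
  case/negP: ff0; rewrite Ep1; apply/eqP; congr (_, _); rewrite E0 E1.
  move: w0R w1R; rewrite !inE => /andP[_ /eqP r0] /andP[_ /eqP r1]; congr (r _).
  rewrite -r0 -r1; apply/eqP; rewrite (root_connect symf); apply: connect_trans (rw w1) _.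
  rewrite -E1 -Ep1 symf; apply: connect_trans (rw w0) _; rewrite -E0.
  exact: (connect_trans (fconnect1 _ _) (fconnect1 _ _)).
right.
have f2 (p : pt) : odd p -> f (f (true, p)) = (true, p) by move=> po; apply/eqP/(implyP (all2 p)).
have my (p : pt) : odd p -> dmatch Y (rev_ord (dmatch X p)) = rev_ord p.
  by move/f2; rewrite (fE true p) (fE false) => /(congr1 snd) /= E; rewrite -[LHS]rev_ordK E.
rewrite -(@zeta_transversal _ _ (loop_value R) loop_valueC _ f fI lab (fun w => odd w.2)
  (mem ([set (true, p) | p in [set p : pt | odd p]]))); first last.
- move=> x y /imsetP[p]; rewrite inE => po -> /imsetP[q]; rewrite inE => qo ->.
  case/iter_findex; elim/ltn_ind: (findex _ _ _) => -[|[|k]] IHk //.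
    by rewrite /= fE.
  by rewrite !iterSr f2 // => /IHk; apply.
- case=> [[] p] /= po; first by exists (true, p); rewrite ?connect0 // mem_imset ?inE // => ? ? [].
  exists (f (false, p)); last exact: fconnect1.
  by rewrite fE mem_imset ?inE; [rewrite odd_rev_ord match_parity ?negbK|move=> ? ? []].
- by move=> x /imsetP[p]; rewrite inE => po ->.
- exact: PC.
rewrite big_imset => [|? ? _ _ [] //] /=.
rewrite (eq_bigr (fun p => deltaR R * laurentC (dlabel Y (rev_ord (dmatch X p)) == hg_barB (dlabel X p))%:R)); last first.
  move=> p; rewrite inE => po.
  rewrite -[LHS]/(cycle_value (loop_value R) f lab (true, p)).
  rewrite (@cycle_value_cycle _ _ (loop_value R) loop_valueC _ f _ [:: (true, p); f (true, p)]) /=.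
  - by rewrite path_prod_cons path_prod1 fE /lab /rlabel /= loop_value_emb.
  - by rewrite f2 ?eqxx.
  - by rewrite inE fE.
  by rewrite mem_head.
rewrite big_split /= prodr_const card_odd_ord; congr (_ * _).
rewrite -[RHS]/(laurentC _) -[LHS](rmorph_prod (@laurentC R)); congr laurentC.
case: eqP => [->|YX].
  rewrite big1 // => p _; rewrite dlabel_reflect rev_ordK dlabel_match eqxx //.
have [p po pL] : exists2 p : pt, odd p & dlabel Y (rev_ord (dmatch X p)) != hg_barB (dlabel X p).
  have [/forallP allE|] := boolP [forall p : pt, odd p ==>
     (dlabel Y (rev_ord (dmatch X p)) == hg_barB (dlabel X p))]; last first.
    by case/forallPn=> p; rewrite negb_imply => /andP[]; exists p.
  case: YX; apply: diagram_eqP => [|q qo].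
    have Eo (q : pt) : odd q -> dmatch Y q = rev_ord (dmatch X (rev_ord q)).
      move=> qo; rewrite -{1}(rev_ordK q) -{1}(dmatchK X (rev_ord q)) my //.
      by rewrite dmatch_parity odd_rev_ord negbK.
    apply/ffunP=> q; rewrite dmatch_reflect; have [|qo] := boolP (odd q); first exact: Eo.
    apply: (can_inj (dmatchK Y)); rewrite dmatchK Eo ?rev_ordK ?dmatchK ?rev_ordK //.
    by rewrite odd_rev_ord dmatch_parity odd_rev_ord negbK.
  rewrite dlabel_reflect; have := implyP (allE (dmatch X (rev_ord q))).
  rewrite dmatchK rev_ordK dlabel_match dmatch_parity odd_rev_ord negbK => /(_ qo)/eqP //.
by rewrite (bigD1 p) ?inE //= (negPf pL) mul0r.
Qed.

(** The highest power of v occurring in the coefficients of f is detected by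
    pairing f with mirror images, so that the pairing is nondegenerate. *)
Lemma tpair_nondeg f : (forall W, tpair f W = 0) -> f = 0.
Proof.
move=> f0; apply/eqP; apply: contraT => fn0.
(* d is the highest exponent of v in the coefficients of f; pairing with the
   mirror image of X0 then isolates the coefficient of v ^ (d + n). *)
pose s := flatten [seq enum_fset (msupp f@_X) | X <- enum_fset (msupp f)].
have sP X k : f@_X@_k != 0 -> k \in s.
  move=> nz; apply/flatten_mapP; exists X; last by rewrite -mcoeff_neq0.
  by rewrite -mcoeff_neq0; apply: contraNneq nz => ->; rewrite mcoeff0.
have /seq_max[d ds dmax] : s != [::].
  have [X /eqP/malg_neq0P[k ks]] := malg_neq0P (elimN eqP fn0).
  by apply/eqP=> s0; have := sP X k ks; rewrite s0.
have dP X k : d < k -> f@_X@_k = 0.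
  by move=> dk; apply/eqP; apply: contraLR dk => /sP/dmax; rewrite -leNgt.
have [X0 nz] : exists X0, f@_X0@_d != 0.
  by case/flatten_mapP: ds => X _ dX; exists X; rewrite mcoeff_neq0.
have := f0 (refl X0); rewrite /tpair lincomb_sum => /(congr1 (mcoeff (d + n%:Z))).
rewrite mcoeff0 raddf_sum /= (eq_big_seq (fun X => if X == X0 then f@_X@_d else 0)); last first.
  move=> X Xs; rewrite -[_ *: _]/(f@_X * tpairD X (refl X0)).
  have Cf C k : d < k -> (laurentC C * f@_X)@_k = 0.
    by move=> dk; rewrite laurentC_coef dP // mulr0.
  case: (tpairD_lead X (refl X0)) => [[/negPf YX [c cn [C ->]]]|->]; rewrite mulrCA [f@_X * _]mulrC.
    have [_ ->] := deltaR_lead c (Cf C); last by lia.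
    by case: eqP => // EX; rewrite EX eqxx in YX.
  have [-> _] := deltaR_lead n (Cf (refl X0 == refl X)%:R).
  rewrite laurentC_coef (inj_eq (can_inj (reflect_involutive (@hg_barBK H)))) eq_sym.
  by case: eqP => _; rewrite ?mul1r ?mul0r.
rewrite (big_fsetD1 X0) /=; last first.
  by rewrite -mcoeff_neq0; apply: contraNneq nz => ->; rewrite mcoeff0.
rewrite eqxx big1_seq ?addr0; last by move=> X /andP[_]; rewrite !inE => /andP[/negPf->].
by move/eqP; rewrite (negPf nz).
Qed.

End Pairing.

(** * The algebra structure *)

Section BasedMaps.
Variables (H : hypergroup) (f : H -> H) (fB : hg_bas H -> hg_bas H).
Local Notation emb := (@hg_emb H).
Hypotheses (fD : {morph f : x y / x + y}) (f1 : f 1 = 1) (fE : forall b, f (emb b) = emb (fB b)).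
Hypothesis fBI : injective fB.

Lemma based_map0 : f 0 = 0.
Proof. by apply: (addrI (f 0)); rewrite -fD !addr0. Qed.

Lemma based_mapB a b : f (a - b) = f a - f b.
Proof. by apply: (addIr (f b)); rewrite -fD !subrK. Qed.

Lemma based_map_one : fB (hg_one H) = hg_one H.
Proof. by apply: hg_emb_inj; rewrite -fE !hg_emb1 f1. Qed.

Lemma based_map_trace a : hg_trace (f a) = hg_trace a.
Proof.
move: a; apply: hg_gen => [|x y Ex Ey|_ [b ->]]; first by rewrite based_map0.
  by rewrite based_mapB !hg_traceB Ex Ey.
by rewrite fE /hg_trace !hg_coord_emb !mcoeffU -{1}based_map_one (inj_eq fBI).
Qed.

End BasedMaps.

Lemma based_antiaut_trace (H : hypergroup) f fB :
  is_based_antiaut (@hg_emb H) f fB -> forall a, hg_trace (f a) = hg_trace a.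
Proof. by case=> fD _ f1 _ /bij_inj fBI fE; apply: (@based_map_trace H f fB). Qed.

Section Algebra.
Variables (n : nat) (H : hypergroup) (R : comNzRingType).
Local Notation pt := 'I_(n + n).
Local Notation B := (hg_bas H).
Local Notation D := (diagram n B).
Local Notation emb := (@hg_emb H).
Local Notation K := (laurent R).
Local Notation mul := (@tlR_mul n H R).

Lemma tlR_mulUU (X Y : D) : mul << X >> << Y >> = prodD R X Y.
Proof. by rewrite [LHS]bilinUU /prodD unlock. Qed.

Lemma tlR_mul_linearl y : linear (fun x => mul x y).
Proof. exact: bilin_linearl. Qed.

Lemma tlR_mul_linearr x : linear (mul x).
Proof. exact: bilin_linearr. Qed.

Local Opaque tlR_mul.

Lemma tlR_mulUl (X : D) g : mul << X >> g = lincomb (prodD R X) g.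
Proof. by rewrite (linear_malgE (tlR_mul_linearr _)); apply: eq_lincomb => Y; apply: tlR_mulUU. Qed.

Lemma tlR_mulUr f (Y : D) : mul f << Y >> = lincomb (fun X => prodD R X Y) f.
Proof. by rewrite (linear_malgE (tlR_mul_linearl _)); apply: eq_lincomb => X; apply: tlR_mulUU. Qed.

Lemma tpair_linear (W : D) : linear (fun f : {malg K[D]} => tpair f W).
Proof. exact: lincomb_linear. Qed.

Lemma tpair_lincomb (Z : choiceType) (e : Z -> {malg K[D]}) (f : {malg K[Z]}) W :
  tpair (lincomb e f) W = lincomb (fun z => tpair (e z) W) f.
Proof. exact: (linear_lincomb _ _ (tpair_linear W)). Qed.

Lemma tpair_eq (f g : {malg K[D]}) : (forall W, tpair f W = tpair g W) -> f = g.
Proof.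
move=> E; apply/eqP; rewrite -subr_eq0; apply/eqP/tpair_nondeg => W.
by rewrite /tpair lincombB -/(tpair f W) -/(tpair g W) E subrr.
Qed.

Local Notation u3 := (split_u negb negb true).
Local Notation d3 := (split_d negb true).
(** The ring of the product X * Y and of W, with the product replaced by the stack of
    X on Y. *)
Definition box3 (X Y W : D) : option bool -> D := split_box true (fun b => if b then X else W) X Y.
Definition ring3 X Y W : K := ring_valueD R u3 d3 (box3 X Y W).

Lemma u3K : cancel u3 d3. Proof. exact: (split_uK true negbK negbK). Qed.
Lemma d3K : cancel d3 u3. Proof. exact: (split_dK true negbK). Qed.

Lemma tpair_prodD X Y W : tpair (prodD R X Y) W = ring3 X Y W.
Proof.
rewrite /ring3 -(@ring_valueD_split n H R bool negb negb negbK negbK (fun b => if b then X else W) true X Y).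
by apply: eq_lincomb => Z; apply: (eq_ring_valueD R negbK negbK) => -[].
Qed.

(** Closed with W, both bracketings evaluate to the ring of the four boxes X, Y, Z
    and W, with two different names for the boxes; the pairing is nondegenerate. *)
Lemma prodD_assoc (X Y Z : D) :
  lincomb (fun U => prodD R U Z) (prodD R X Y) = lincomb (prodD R X) (prodD R Y Z).
Proof.
apply: tpair_eq => W; rewrite [LHS]tpair_lincomb [RHS]tpair_lincomb.
pose bl := box3 X Z W; pose br := box3 X Y W.
rewrite (eq_lincomb (e' := fun U => ring_valueD R u3 d3 (fun i => if i == Some true then U else bl i) : K^o));
  last first.
  by move=> U /=; rewrite tpair_prodD; apply: (eq_ring_valueD R u3K d3K) => -[[]|].
rewrite [RHS](eq_lincomb (e' := fun V => ring_valueD R u3 d3 (fun i => if i == None then V else br i) : K^o));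
  last first.
  by move=> V /=; rewrite tpair_prodD; apply: (eq_ring_valueD R u3K d3K) => -[[]|].
rewrite !(ring_valueD_split R u3K d3K); pose h (o : option (option bool)) :=
  match o with None => Some None | Some None => None | _ => o end.
apply: (@ring_valueD_bij n H R _ _ _ (split_uK None u3K d3K) (split_dK None d3K) _ _ _ _ _ h).
- by exists h => -[[[]|]|].
- by case=> [[[]|]|].
- by case=> [[[]|]|].
by case=> [[[]|]|].
Qed.

Section Reflection.
Variables (psi : H -> H) (psiB : B -> B).
Hypothesis psiP : is_based_antiaut emb psi psiB.
Hypothesis psiK : involutive psiB.
Local Notation refl := (reflect_diagram psiB : D -> D).

Definition reflR : {malg K[D]} -> {malg K[D]} := lincomb (fun X => << refl X >>).

Lemma reflRK : involutive reflR.
Proof.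
move=> f; rewrite /reflR lincomb_lincomb -[RHS]lincomb_id; apply: eq_lincomb => X.
by rewrite lincombU1 (reflect_involutive psiK).
Qed.

Lemma reflR_coef f Z : (reflR f)@_(refl Z) = f@_Z.
Proof.
exact: (lincomb_inj_coef f Z (can_inj (reflect_involutive psiK))).
Qed.

Lemma ring_valueD_reverse (I : finType) (u d : I -> I) (bx : I -> D) : cancel u d -> cancel d u ->
  ring_valueD R d u (refl \o bx) = ring_valueD R u d bx.
Proof.
move=> uK dK; rewrite !ring_valueDE; apply: (@ring_value_reverse _ _ _ _ _ _ _ _ _ _ psi) => //.
- by move=> i; apply: dmatch_planar.
- exact: bna_one psiP.
- exact: bna_mul psiP.
- exact: based_antiaut_trace psiP.
- by move=> i p; rewrite dmatch_reflect.
by move=> i p po; rewrite dlabel_reflect dlabel_match (bna_basis psiP).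
Qed.

Lemma tpair_refl f W : tpair (reflR f) (refl W) = tpair f W.
Proof.
rewrite /reflR tpair_lincomb; apply: eq_lincomb => X /=.
rewrite /tpair lincombU1 /tpairD -[RHS](ring_valueD_reverse _ negbK negbK).
by apply: (eq_ring_valueD R negbK negbK) => -[].
Qed.

(** After pairing with a mirror image, both sides are the ring of the boxes X, Y and
    W, read in the two directions around the annulus. *)
Lemma prodD_refl X Y : reflR (prodD R X Y) = prodD R (refl Y) (refl X).
Proof.
apply: tpair_eq => W; rewrite -[W](reflect_involutive psiK) tpair_refl !tpair_prodD /ring3.
rewrite -[LHS](ring_valueD_reverse _ u3K d3K).
pose h o : option bool := match o with Some true => None | None => Some true | _ => o end.
apply: (@ring_valueD_bij _ _ R _ _ _ u3K d3K _ _ _ _ _ h).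
- by exists h => -[[]|].
- by case=> [[]|].
- by case=> [[]|].
by case=> [[]|].
Qed.

Lemma reflR_antimul a b : reflR (mul a b) = mul (reflR b) (reflR a).
Proof.
rewrite [mul a b](linear_malgE (tlR_mul_linearl b)) [LHS]linear_lincomb; last exact: lincomb_linear.
rewrite {2}/reflR (linear_lincomb _ _ (tlR_mul_linearr _)); apply: eq_lincomb => X /=.
rewrite [mul _ b](linear_malgE (tlR_mul_linearr _)) [LHS]linear_lincomb; last exact: lincomb_linear.
rewrite [RHS](linear_lincomb _ _ (tlR_mul_linearl _)); apply: eq_lincomb => Y /=.
by rewrite [in LHS]tlR_mulUU [RHS]tlR_mulUU prodD_refl.
Qed.

End Reflection.

Section Paths.
Variables (X Y : D).
Local Notation send := (stack_end X Y).

Lemma path_to0 j : stack_outer (send (stack_in j)) -> is_path_to X Y j 0.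
Proof. by []. Qed.

Lemma path_to1 j : ~~ stack_outer (send (stack_in j)) ->
  stack_outer (send (stack_next X Y (stack_in j))) -> is_path_to X Y j 1.
Proof. by move=> o0 o1; split=> // -[]. Qed.

Lemma path_to2 j : ~~ stack_outer (send (stack_in j)) ->
  ~~ stack_outer (send (stack_next X Y (stack_in j))) ->
  stack_outer (send (stack_next X Y (stack_next X Y (stack_in j)))) -> is_path_to X Y j 2.
Proof. by move=> o0 o1 o2; split=> // -[|[]]. Qed.

Lemma comp_labelE j k : is_path_to X Y j k ->
  comp_label X Y j = path_prod (fun w => emb (stack_label X Y w)) (traject (stack_next X Y) (stack_in j) k.+1).
Proof. by move=> kP; rewrite /comp_label (stack_pathE kP) path_labelE. Qed.

Lemma loop_base_inner w : is_loop_base X Y w -> forall t,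
  ~~ stack_outer (send (iter t (stack_next X Y) w)).
Proof.
by case/and3P=> _ _ /hasPn noh t; apply: noh; rewrite -fconnect_orbit fconnect_iter.
Qed.

End Paths.

Section Unit.
Variable X : D.
Local Notation one := (id_diagram n (hg_one H)).

Lemma dmatch_one (p : pt) : dmatch one p = rev_ord p.
Proof. by rewrite /dmatch SubK /= ffunE. Qed.

Lemma dlabel_one (p : pt) : dlabel one p = hg_one H.
Proof. by rewrite /dlabel SubK /= ffunE. Qed.

Lemma one_top (p : pt) : stack_end one X (true, p) = (true, rev_ord p).
Proof. by rewrite /stack_end /= dmatch_one. Qed.

Lemma one_next (p : pt) : stack_next one X (true, p) = (false, p).
Proof. by rewrite stack_nextE one_top /cross /= rev_ordK. Qed.

Lemma rev_ltn (p : pt) : (rev_ord p < n)%N = ~~ (p < n)%N.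
Proof. by rewrite /=; have := ltn_ord p; lia. Qed.

Lemma one_bot (p : pt) : stack_end one X (false, p) = (false, dmatch X p).
Proof. by []. Qed.

Lemma one_next_bot (p : pt) : stack_next one X (false, p) = (true, rev_ord (dmatch X p)).
Proof. by []. Qed.

Lemma outerE (b : bool) (p : pt) : stack_outer (b, p) = (b == (p < n)%N).
Proof. by []. Qed.

Lemma stack_inE (j : pt) : stack_in j = ((j < n)%N, j).
Proof. by []. Qed.

Let oneE := (one_next, one_next_bot, one_top, one_bot, @rev_ordK, outerE, rev_ltn).

(** Each edge of X is prolonged by vertical edges with label 1. *)
Lemma comp_one (j : pt) : comp_match one X j = dmatch X j /\ comp_label one X j = emb (dlabel X j).
Proof.
have lab p : emb (dlabel one p) = 1 by rewrite dlabel_one hg_emb1.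
case jn: (j < n)%N; case qn: (dmatch X j < n)%N.
- have P2 : is_path_to one X j 2.
    by apply: path_to2; rewrite stack_inE jn !oneE ?jn ?qn.
  rewrite (comp_matchE P2) (comp_labelE P2) stack_inE jn [iter _ _ _]/= [traject _ _ _]/= !oneE; split=> //.
  by rewrite !path_prod_cons path_prod_nil /stack_label !lab !mulr1 !mul1r.
- have P1 : is_path_to one X j 1 by apply: path_to1; rewrite stack_inE jn !oneE ?jn ?qn.
  rewrite (comp_matchE P1) (comp_labelE P1) stack_inE jn [iter _ _ _]/= [traject _ _ _]/= !oneE; split=> //.
  by rewrite !path_prod_cons path_prod_nil /stack_label !lab !mulr1 !mul1r.
- have P1 : is_path_to one X j 1 by apply: path_to1; rewrite stack_inE jn !oneE ?jn ?qn.
  rewrite (comp_matchE P1) (comp_labelE P1) stack_inE jn [iter _ _ _]/= [traject _ _ _]/= !oneE; split=> //.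
  by rewrite !path_prod_cons path_prod_nil /stack_label !lab !mul1r.
have P0 : is_path_to one X j 0 by apply: path_to0; rewrite stack_inE jn !oneE qn.
by rewrite (comp_matchE P0) (comp_labelE P0) stack_inE jn /=; split=> //; rewrite path_prod1.
Qed.

Lemma loopK_one : loopK R one X = 1.
Proof.
rewrite loopKE big_pred0 // => w; apply/negP=> /loop_base_inner lw.
have bot p : (forall t, ~~ stack_outer (stack_end one X (iter t (stack_next one X) (false, p)))) -> False.
  move=> lp; have := lp 0%N; have := lp 1%N; rewrite [iter _ _ _]/= !oneE.
  by case: (_ < n)%N.
case: w lw => [[] p] lw; last exact: (bot p).
by apply: (bot p) => t; have := lw t.+1; rewrite iterSr one_next.
Qed.

Lemma prodD_one : prodD R one X = << X >>.
Proof.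
rewrite prodDE loopK_one scale1r.
have -> : comp_match one X = dmatch X by apply/ffunP=> j; case: (comp_one j).
by apply: expand_emb => // j _; case: (comp_one j).
Qed.

End Unit.

Lemma tlR_algebra : assoc_unital_algebra mul (@tlR_one n H R).
Proof.
have antiB := hg_bar_antiaut H.
have mul1 : left_id (@tlR_one n H R) mul.
  by move=> f; rewrite [LHS]tlR_mulUl -[RHS]lincomb_id; apply: eq_lincomb => X; apply: prodD_one.
have refl1 : reflR (@hg_barB H) (tlR_one n H R) = tlR_one n H R.
  rewrite /reflR lincombU1; congr << _ >>; apply: diagram_eqP => [|p _].
    by apply/ffunP=> p; rewrite dmatch_reflect !dmatch_one rev_ordK.
  rewrite dlabel_reflect !dlabel_one.
  exact: (based_map_one (bna_one antiB) (bna_basis antiB)).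
split.
- exact: tlR_mul_linearl.
- exact: tlR_mul_linearr.
- move=> x y z.
  rewrite (linear_malgE (phi := fun x => mul x (mul y z))); last exact: tlR_mul_linearl.
  rewrite (linear_malgE (phi := fun x => mul (mul x y) z)); last first.
    exact: (linear_fun_comp (tlR_mul_linearl _) (tlR_mul_linearl _)).
  apply: eq_lincomb => X.
  rewrite (linear_malgE (phi := fun y => mul << X >> (mul y z))); last first.
    exact: (linear_fun_comp (tlR_mul_linearr _) (tlR_mul_linearl _)).
  rewrite (linear_malgE (phi := fun y => mul (mul << X >> y) z)); last first.
    exact: (linear_fun_comp (tlR_mul_linearl _) (tlR_mul_linearr _)).
  apply: eq_lincomb => Y.
  rewrite (linear_malgE (phi := fun z => mul << X >> (mul << Y >> z))); last first.
    exact: (linear_fun_comp (tlR_mul_linearr _) (tlR_mul_linearr _)).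
  rewrite (linear_malgE (phi := fun z => mul (mul << X >> << Y >>) z)); last exact: tlR_mul_linearr.
  apply: eq_lincomb => Z.
  apply: etrans (congr1 (mul << X >>) (tlR_mulUU Y Z)) _; apply: etrans (tlR_mulUl _ _) _.
  apply: etrans (esym (prodD_assoc X Y Z)) _; apply: etrans (esym (tlR_mulUr _ _)) _.
  exact: (congr1 (fun f => mul f << Z >>) (esym (tlR_mulUU X Y))).
- exact: mul1.
(* The right unit law is the mirror image of the left one. *)
move=> f; have reflI := can_inj (reflRK (@hg_barBK H)).
by apply: reflI; rewrite (reflR_antimul antiB) ?refl1 ?mul1 //; apply: hg_barBK.
Qed.

End Algebra.

(** * Half diagrams and the table basis *)

Section Halves.
Variables (n : nat) (B : choiceType).
Local Notation pt := 'I_(n + n).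
Local Notation top := (@lshift n n).
Local Notation bot := (@bottom_point n).

Lemma top_bot_ind (P : pt -> Prop) : (forall i, P (top i)) -> (forall i, P (bot i)) -> forall j, P j.
Proof.
move=> Pt Pb j; rewrite -(splitK j); case: (split j) => i //=.
rewrite -[i]rev_ordK (_ : rshift n _ = bot (rev_ord i)) //.
by apply: val_inj => /=; have := ltn_ord i; lia.
Qed.

Lemma rev_top i : rev_ord (top i) = bot i. Proof. by []. Qed.
Lemma rev_bot i : rev_ord (bot i) = top i. Proof. exact: rev_ordK. Qed.
Lemma top_inj : injective top. Proof. exact: lshift_inj. Qed.
Lemma bot_inj : injective bot. Proof. by move=> i j /rev_ord_inj/top_inj. Qed.

Lemma top_ltn i : (top i < n)%N. Proof. exact: (ltn_ord i). Qed.
Lemma bot_ltn i : (bot i < n)%N = false.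
Proof. by rewrite /=; have := ltn_ord i; lia. Qed.

Lemma top_neq_bot i j : top i != bot j.
Proof. by apply/eqP=> E; have := top_ltn i; rewrite E bot_ltn. Qed.

Lemma split_top i : split (top i) = inl i.
Proof. by rewrite -[top i]/(unsplit (inl i)) unsplitK. Qed.

Lemma split_bot i : split (bot i) = inr (rev_ord i).
Proof.
rewrite (_ : bot i = unsplit (inr (rev_ord i))) ?unsplitK //.
by apply: val_inj => /=; have := ltn_ord i; lia.
Qed.

Lemma odd_bot i : odd (bot i) = ~~ odd i.
Proof. by rewrite /=; have := ltn_ord i; lia. Qed.

Lemma top_arcP m i k : (top_arc m i = Some k) <-> (m (top i) = top k).
Proof.
rewrite /top_arc; elim/top_bot_ind: (m (top i)) => j; rewrite ?split_top ?split_bot; split=> //.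
- by case=> ->.
- by move/top_inj->.
by move/esym/eqP; rewrite (negPf (top_neq_bot _ _)).
Qed.

Lemma top_arcN m i : (top_arc m i == None) = (n <= m (top i))%N.
Proof.
rewrite /top_arc; elim/top_bot_ind: (m (top i)) => j; rewrite ?split_top ?split_bot /=.
  by rewrite leqNgt ltn_ord.
by rewrite eqxx; have := ltn_ord j; lia.
Qed.

Section OneHalf.
Variables (r : nat) (S : half n B r).
Local Notation c := (val S).
Local Notation free := (free_points S).

Lemma half_sym i k b : c i = Some (k, b) -> c k = Some (i, b).
Proof. by case/and3P: (valP S) => /forallP/(_ i) + _ _ E; rewrite E => /eqP. Qed.

Lemma half_witness : exists2 m, planar_matching m & forall j, omap fst (c j) = top_arc m j.
Proof.
by case/and3P: (valP S) => _ _ /existsP[m /andP[mP /forallP E]]; exists m => // j; apply/eqP.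
Qed.

Lemma half_card : #|[pred j | c j == None]| = r.
Proof. by case/and3P: (valP S) => _ /eqP. Qed.

Lemma half_parity i k b : c i = Some (k, b) -> odd k = ~~ odd i.
Proof.
have [m mP mE] := half_witness => ci; have /esym := mE i; rewrite ci => /top_arcP E.
by have := match_parity mP (top i); rewrite E.
Qed.

Lemma half_nocross i i' b j j' b' : c i = Some (i', b) -> c j = Some (j', b') ->
  (i < j)%N -> (j < i')%N -> (i' < j')%N -> False.
Proof.
have [m mP mE] := half_witness => ci cj; have := mE i; have := mE j; rewrite ci cj.
move=> /esym/top_arcP Ej /esym/top_arcP Ei ij ji ii.
by have := match_nocross mP (top i) (top j); rewrite Ei Ej /= ij ji ii.
Qed.

Lemma half_free i i' b f : c i = Some (i', b) -> c f = None -> (i < f)%N -> (f < i')%N -> False.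
Proof.
have [m mP mE] := half_witness => ci cf; have := mE i; have := mE f; rewrite ci cf.
move=> /esym/eqP; rewrite top_arcN => Ef /esym/top_arcP Ei lt1 lt2.
have := match_nocross mP (top i) (top f); rewrite Ei /= lt1 lt2 /=.
by have := ltn_ord i'; lia.
Qed.

Lemma mem_free i : (i \in free) = (c i == None).
Proof. by rewrite mem_filter mem_enum andbT. Qed.

Lemma uniq_free : uniq free.
Proof. by rewrite filter_uniq ?enum_uniq. Qed.

Lemma size_free : size free = r.
Proof.
apply: etrans half_card; rewrite cardE /free_points; congr size.
by rewrite {2}/enum_mem -enumT; apply: eq_filter => i; rewrite !inE.
Qed.

Lemma sorted_free : sorted (fun i j : 'I_n => (i < j)%N) free.
Proof.
apply: sorted_filter; first by move=> ? ? ?; apply: ltn_trans.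
by have := iota_ltn_sorted 0 n; rewrite -val_enum_ord sorted_map.
Qed.

Lemma index_free i : c i = None -> (index i free < r)%N.
Proof. by move=> ci; have := index_mem i free; rewrite size_free mem_free ci. Qed.

Lemma free_nth i0 k : (k < r)%N -> c (nth i0 free k) = None.
Proof. by move=> kr; apply/eqP; rewrite -mem_free mem_nth ?size_free. Qed.

Lemma index_free_nth i0 k : (k < r)%N -> index (nth i0 free k) free = k.
Proof. by move=> kr; rewrite index_uniq ?uniq_free ?size_free. Qed.

(** To the left of a free point the points that are not free are matched among
    themselves. *)
Lemma odd_index_free i : c i = None -> odd (index i free) = odd i.
Proof.
move=> ci; pose A := [set j : 'I_n | (j < i)%N & c j != None].
pose m j := if c j is Some (k, _) then k else j.
have Aeven : ~~ odd #|A|.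
  apply: (@even_card_involution _ _ m) => [j|j|j]; rewrite !inE /m.
  - case E: (c j) => [[k b]|] /andP[ji _] //; have Ek := half_sym E.
    rewrite Ek andbT ltnNge; apply/negP=> ik.
    have ki : i != k by apply: contra_eq_neq ci => ->; rewrite Ek.
    by apply: (half_free E ci ji); rewrite ltn_neqAle ki ik.
  - by case E: (c j) => [[k b]|] /andP[ji _] //; rewrite (half_sym E).
  case E: (c j) => [[k b]|] /andP[_ //] _; apply: contra_eq_neq (half_parity E) => ->.
  by case: odd.
suff E : (index i free + #|A| = i)%N by rewrite -[in RHS]E oddD (negPf Aeven) addbF.
have iE := index_enum_ord i.
have enumE := cat_take_drop i (enum 'I_n).
have memt j : (j \in take i (enum 'I_n)) = (j < i)%N by rewrite in_take ?mem_enum // index_enum_ord.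
have -> : #|A| = count (fun j => c j != None) (take i (enum 'I_n)).
  have -> : #|A| = count (mem A) (enum 'I_n).
    by rewrite cardE -size_filter /enum_mem -filter_predI; congr size; apply: eq_filter => j /=; rewrite andbT.
  rewrite -{1}enumE count_cat.
  rewrite (eq_in_count (a2 := fun j => c j != None)); last by move=> j; rewrite memt !inE => ->.
  rewrite (eq_in_count (a2 := pred0) (s := drop _ _)) ?count_pred0 ?addn0 // => j jd; rewrite !inE.
  have := enum_uniq 'I_n; rewrite -enumE cat_uniq => /and3P[_ /hasPn/(_ j jd) + _] /=.
  by rewrite memt => /negPf->.
have -> : index i free = count (fun j => c j == None) (take i (enum 'I_n)).
  rewrite /free_points -{1}enumE filter_cat index_cat mem_filter memt ltnn andbF size_filter.
  have : i \in drop i (enum 'I_n).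
    by have := mem_enum 'I_n i; rewrite -{1}enumE mem_cat memt ltnn.
  rewrite (drop_nth i) ?size_enum_ord // nth_ord_enum /= ci /= eqxx addn0 //.
have := count_predC (fun j => c j == None) (take i (enum 'I_n)).
by rewrite size_takel ?size_enum_ord // ltnW.
Qed.

End OneHalf.

Section TableMatch.
Variables (r : nat).
Implicit Types S T : half n B r.

Lemma table_match_top S T i : table_match S T (top i) =
  if val S i is Some (k, _) then top k
  else bot (nth i (free_points T) (index i (free_points S))).
Proof. by rewrite ffunE split_top. Qed.

Lemma table_match_bot S T i : table_match S T (bot i) =
  if val T i is Some (k, _) then bot k
  else top (nth i (free_points S) (index i (free_points T))).
Proof. by rewrite ffunE split_bot rev_ordK. Qed.

Lemma table_match_rev S T j : table_match T S j = rev_ord (table_match S T (rev_ord j)).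
Proof.
elim/top_bot_ind: j => i; rewrite ?rev_top ?rev_bot ?table_match_top ?table_match_bot.
  by case: (val T i) => [[k b]|]; rewrite ?rev_bot ?rev_top.
by case: (val S i) => [[k b]|]; rewrite ?rev_bot ?rev_top.
Qed.

Definition free_pair S T i := nth i (free_points T) (index i (free_points S)).

Lemma free_pairN S T i : val S i = None -> val T (free_pair S T i) = None.
Proof. by move=> Si; apply: free_nth; apply: index_free. Qed.

Lemma index_free_pair S T i : val S i = None ->
  index (free_pair S T i) (free_points T) = index i (free_points S).
Proof. by move=> Si; apply: index_free_nth; apply: index_free. Qed.

Lemma free_pairK S T i : val S i = None -> free_pair T S (free_pair S T i) = i.
Proof.
move=> Si; rewrite {1}/free_pair index_free_pair //.
by rewrite (set_nth_default i) ?size_free ?index_free // nth_index // mem_free Si.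
Qed.

Lemma free_pair_odd S T i : val S i = None -> odd (free_pair S T i) = odd i.
Proof.
by move=> Si; rewrite -(odd_index_free (free_pairN T Si)) index_free_pair // odd_index_free.
Qed.

Lemma free_pair_ltn S T i j : val S i = None -> val S j = None ->
  (i < j)%N -> (free_pair S T i < free_pair S T j)%N.
Proof.
move=> Si Sj ij; pose lt := (fun i j : 'I_n => (i < j)%N).
have tr : transitive lt by move=> ? ? ?; apply: ltn_trans.
have ir : irreflexive lt by move=> ?; apply: ltnn.
have Iij : (index i (free_points S) < index j (free_points S))%N.
  have := sorted_ltn_index tr (sorted_free S); rewrite ltnNge => H; apply/negP=> ji.
  have [E|neq] := eqVneq (index j (free_points S)) (index i (free_points S)).
    by move: ij; rewrite -(@nth_index _ i i (free_points S)) ?mem_free ?Si // -E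
      nth_index ?mem_free ?Sj // ltnn.
  have lt' : (index j (free_points S) < index i (free_points S))%N by rewrite ltn_neqAle neq.
  have := sorted_ltn_nth tr i (sorted_free S); move/(_ (index j (free_points S)) (index i (free_points S))).
  rewrite !inE !size_free !index_free // => /(_ isT isT lt'); rewrite !nth_index ?mem_free ?Si ?Sj //.
  by rewrite /lt; lia.
rewrite /free_pair (set_nth_default i j) ?size_free ?index_free //.
by apply: (sorted_ltn_nth tr i (sorted_free T)); rewrite ?inE ?size_free ?index_free.
Qed.

Lemma table_matchK S T : involutive (table_match S T).
Proof.
suff topK (S' T' : half n B r) i : table_match S' T' (table_match S' T' (top i)) = top i.
  elim/top_bot_ind => i; first exact: topK.
  have := topK T S i; rewrite (table_match_rev S T (top i)) (table_match_rev S T (rev_ord _)).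
  by rewrite rev_ordK rev_top => E; apply: rev_ord_inj; rewrite rev_bot.
rewrite table_match_top; case E: (val S' i) => [[k b]|].
  by rewrite table_match_top (half_sym E).
rewrite -/(free_pair S' T' i) table_match_bot free_pairN //.
by rewrite -/(free_pair _ _ _) free_pairK.
Qed.

Lemma table_match_parity S T j : odd (table_match S T j) = ~~ odd j.
Proof.
suff topP (S' T' : half n B r) i : odd (table_match S' T' (top i)) = ~~ odd i.
  elim/top_bot_ind: j => i; first exact: topP.
  by have := topP T S i; rewrite (table_match_rev S T) rev_top odd_rev_ord => /negb_inj->; rewrite odd_bot negbK.
rewrite table_match_top; case E: (val S' i) => [[k b]|]; first exact: half_parity E.
by rewrite odd_bot free_pair_odd.
Qed.

Lemma table_match_planar S T : planar_matching (table_match S T).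
Proof.
apply/and3P; split.
- by apply/forallP=> j; rewrite table_matchK.
- apply/forallP=> j; apply/eqP=> E.
  by have := table_match_parity S T j; rewrite E; case: odd.
have botE i : val (bot i) = (n + n - i.+1)%N by [].
have lt (i : 'I_n) := ltn_ord i.
apply/forallP=> i; apply/forallP=> j; apply/negP=> /and3P[].
elim/top_bot_ind: i => i; rewrite ?table_match_top ?table_match_bot.
  case Ei: (val S i) => [[i' b]|].
    elim/top_bot_ind: j => j; last by rewrite botE /=; have := lt i'; have := lt j; lia.
    rewrite table_match_top; case Ej: (val S j) => [[j' b']|] /= ij ji ii.
      exact: (half_nocross Ei Ej ij ji ii).
    exact: (half_free Ei Ej ij ji).
  rewrite -/(free_pair S T i) botE; have := lt (free_pair S T i) => lp.
  elim/top_bot_ind: j => j; rewrite ?table_match_top ?table_match_bot; last first.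
    case Ej: (val T j) => [[j' b']|]; rewrite !botE /= => ij ji ii; last by have := lt (nth j (free_points S) (index j (free_points T))); lia.
    have := lt j; have := lt j' => l1 l2.
    by apply: (half_free (half_sym Ej) (free_pairN T Ei)); lia.
  case Ej: (val S j) => [[j' b']|] /= ij ji; first by have := lt j'; lia.
  rewrite -/(free_pair S T j).
  have := free_pair_ltn T Ei Ej ij; have := lt (free_pair S T j); lia.
case Ei: (val T i) => [[i' b]|]; last first.
  by elim/top_bot_ind: j => j; rewrite !botE /=; have := lt (nth i (free_points S) (index i (free_points T))); have := lt j; have := lt i; lia.
rewrite !botE; elim/top_bot_ind: j => j; first by rewrite /=; have := lt i; have := lt j; lia.
rewrite table_match_bot botE; case Ej: (val T j) => [[j' b']|].
  rewrite botE => ij ji ii; have := lt i; have := lt i'; have := lt j; have := lt j' => l1 l2 l3 l4.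
  by apply: (half_nocross (half_sym Ej) (half_sym Ei)); lia.
move=> ij ji _; have := lt i; have := lt i'; have := lt j => l1 l2 l3.
by apply: (half_free (half_sym Ei) Ej); lia.
Qed.

End TableMatch.
End Halves.

Section TableDiagrams.
Variables (n : nat) (H : hypergroup).
Local Notation pt := 'I_(n + n).
Local Notation B := (hg_bas H).
Local Notation D := (diagram n B).
Local Notation top := (@lshift n n).
Local Notation bot := (@bottom_point n).
Local Notation bar := (@hg_barB H).
Local Notation refl := (reflect_diagram bar : D -> D).

Section Fixed.
Variables (r : nat) (S T : half n B r) (b : r.-tuple B).

Lemma table_label_top i : table_label S T b (top i) =
  if val S i is Some (_, c) then c else prop_label b (index i (free_points S)).
Proof. by rewrite ffunE split_top. Qed.

Lemma table_label_bot i : table_label S T b (bot i) =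
  if val T i is Some (_, c) then bar c else prop_label b (index i (free_points T)).
Proof. by rewrite ffunE split_bot rev_ordK. Qed.

Lemma table_is_diagram : is_diagram (table_match S T, table_label S T b).
Proof.
rewrite /is_diagram table_match_planar; apply/forallP=> /= j; apply/eqP.
elim/top_bot_ind: j => i; rewrite ?table_match_top ?table_match_bot.
  rewrite table_label_top; case E: (val S i) => [[k c]|].
    by rewrite table_label_top (half_sym E).
  by rewrite -/(free_pair S T i) table_label_bot free_pairN // index_free_pair.
rewrite table_label_bot; case E: (val T i) => [[k c]|].
  by rewrite table_label_bot (half_sym E).
by rewrite -/(free_pair T S i) table_label_top free_pairN // index_free_pair.
Qed.

Definition tdiag : D := Sub _ table_is_diagram.

Lemma dmatch_tdiag : dmatch tdiag = table_match S T.
Proof. by rewrite /dmatch SubK. Qed.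

Lemma dlabel_tdiag : dlabel tdiag = table_label S T b.
Proof. by rewrite /dlabel SubK. Qed.

Lemma table_CE (R : comNzRingType) : table_C R S T b = << tdiag >>.
Proof. by rewrite /table_C /diagram_elt (insubT _ table_is_diagram). Qed.

End Fixed.

Definition top_config (Z : D) : config n B :=
  [ffun j => omap (fun k => (k, dlabel Z (top j))) (top_arc (dmatch Z) j)].

Definition rank (Z : D) := #|[pred i : 'I_n | (n <= dmatch Z (top i))%N]|.

Lemma top_configN Z i : (top_config Z i == None) = (n <= dmatch Z (top i))%N.
Proof. by rewrite ffunE -top_arcN; case: top_arc. Qed.

Lemma top_configP Z i k c : top_config Z i = Some (k, c) <->
  dmatch Z (top i) = top k /\ dlabel Z (top i) = c.
Proof.
rewrite ffunE; split=> [|[/top_arcP-> ->] //].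
by case E: top_arc => [k'|] //= [<- <-]; split=> //; apply/top_arcP.
Qed.

Lemma top_config_half Z : is_half (rank Z) (top_config Z).
Proof.
apply/and3P; split.
- apply/forallP=> i; case E: (top_config Z i) => [[k c]|] //; apply/eqP.
  move/top_configP: E => [E1 E2]; apply/top_configP.
  by rewrite -E1 dmatchK dlabel_match.
- by apply/eqP; apply: eq_card => i; rewrite !inE top_configN.
apply/existsP; exists (dmatch Z); rewrite dmatch_planar; apply/forallP=> i.
by rewrite ffunE; case: top_arc.
Qed.

(** The points without a propagating edge are matched among themselves. *)
Lemma rank_even Z : ~~ odd (n - rank Z).
Proof.
pose A := [set j : 'I_n | top_arc (dmatch Z) j != None].
have -> : (n - rank Z = #|A|)%N.
  have := cardC [pred i : 'I_n | (n <= dmatch Z (top i))%N]; rewrite card_ord -/(rank Z) => E.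
  rewrite -[X in (X - _)%N]E addKn; apply: eq_card => j; rewrite !inE -top_arcN //.
apply: (@even_card_involution _ _ (fun j => odflt j (top_arc (dmatch Z) j))) => [j|j|j].
- rewrite !inE; case E: top_arc => [k|] //= _; move/top_arcP: E => E.
  by have /top_arcP-> : dmatch Z (top k) = top j by rewrite -E dmatchK.
- rewrite inE; case E: top_arc => [k|] //= _; move/top_arcP: E => E.
  by have /top_arcP-> : dmatch Z (top k) = top j by rewrite -E dmatchK.
rewrite inE; case E: top_arc => [k|] //= _; move/top_arcP: E => E.
apply/eqP=> kj; have := dmatch_parity Z (top j); rewrite E kj /=; by case: odd.
Qed.

Lemma rank_lt Z : (rank Z < n.+1)%N.
Proof. by rewrite ltnS -[X in (_ <= X)%N](card_ord n) max_card. Qed.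

Lemma rank_reflect g Z : rank (reflect_diagram g Z) = rank Z.
Proof.
pose A := [set j : pt | (j < n)%N & (n <= dmatch Z j)%N].
pose A' := [set j : pt | (n <= j)%N & (dmatch Z j < n)%N].
have topn i := ltn_ord (top i); have lt (i : 'I_n) := ltn_ord i.
have EA : rank Z = #|A|.
  rewrite /rank -cardsE -(card_imset _ (@top_inj n)); apply: eq_card => j; elim/top_bot_ind: j => i; rewrite !inE.
    by rewrite (mem_imset _ _ (@top_inj n)) inE /= ltn_ord.
  rewrite bot_ltn /=; apply/negbTE/imsetP=> -[k _ /esym/eqP]; exact/negP/top_neq_bot.
have EA' : rank (reflect_diagram g Z) = #|A'|.
  rewrite /rank -cardsE -(card_imset _ (@bot_inj n)); apply: eq_card => j; elim/top_bot_ind: j => i; rewrite !inE.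
    rewrite [(n <= top i)%N]leqNgt top_ltn; apply/negbTE/imsetP=> -[k _ /eqP]; exact/negP/top_neq_bot.
  rewrite (mem_imset _ _ (@bot_inj n)) inE dmatch_reflect rev_top [(_ <= rev_ord _)%N]leqNgt rev_ltn negbK.
  by have := bot_ltn i; rewrite ltnNge => /negbFE->.
rewrite EA EA' -(card_imset _ (can_inj (dmatchK Z))); apply: eq_card => j.
rewrite [in RHS]inE; apply/imsetP/andP=> [[k]|[jn nj]].
  by rewrite inE => /andP[nk kn] ->; rewrite dmatchK.
by exists (dmatch Z j); rewrite ?dmatchK // inE dmatchK nj.
Qed.

Lemma top_config_tdiag r (S T : half n B r) b : top_config (tdiag S T b) = val S.
Proof.
apply/ffunP=> i; case E: (val S i) => [[k c]|].
  apply/top_configP; rewrite dmatch_tdiag dlabel_tdiag table_match_top E.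
  by rewrite table_label_top E.
apply/eqP; rewrite top_configN dmatch_tdiag table_match_top E.
by rewrite leqNgt bot_ltn.
Qed.

Lemma bot_config_tdiag r (S T : half n B r) b : top_config (refl (tdiag S T b)) = val T.
Proof.
apply/ffunP=> i; case E: (val T i) => [[k c]|].
  apply/top_configP; rewrite dmatch_reflect dlabel_reflect rev_top dmatch_tdiag dlabel_tdiag.
  by rewrite table_match_bot table_label_bot E rev_bot hg_barBK.
apply/eqP; rewrite top_configN dmatch_reflect rev_top dmatch_tdiag table_match_bot E rev_top.
by rewrite leqNgt bot_ltn.
Qed.

Lemma rank_tdiag r (S T : half n B r) b : rank (tdiag S T b) = r.
Proof.
rewrite -[RHS](half_card S) -(top_config_tdiag S T b); apply: eq_card => i.
by rewrite !inE top_configN.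
Qed.

(** The propagating edges of a planar diagram join the free points at the top
    and at the bottom in increasing order. *)
Lemma free_increasing Z (S T : half n B (rank Z)) (phi : 'I_n -> 'I_n) :
  val S = top_config Z -> val T = top_config (refl Z) ->
  (forall i, val S i = None -> dmatch Z (top i) = bot (phi i)) ->
  [seq phi i | i <- free_points S] = free_points T.
Proof.
move=> ES ET phiE; pose lt := (fun i j : 'I_n => (i < j)%N).
have tr : transitive lt by move=> ? ? ?; apply: ltn_trans.
have ir : irreflexive lt by move=> ?; apply: ltnn.
apply: (irr_sorted_eq tr ir); last first.
- move=> p; rewrite mem_free ET top_configN dmatch_reflect rev_top leqNgt rev_ltn negbK.
  apply/mapP/idP=> [[i]|pn].
    by rewrite mem_free => /eqP/phiE E ->; rewrite -E dmatchK; apply: top_ltn.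
  have [i Ei] : exists i, dmatch Z (bot p) = top i.
    move: pn; elim/top_bot_ind: (dmatch Z (bot p)) => i; first by exists i.
    by rewrite bot_ltn.
  have Ei' : dmatch Z (top i) = bot p by rewrite -Ei dmatchK.
  have Si : val S i = None by apply/eqP; rewrite ES top_configN Ei' leqNgt bot_ltn.
  exists i; first by rewrite mem_free Si.
  by apply: (@bot_inj n); rewrite -phiE // Ei'.
- exact: sorted_free.
rewrite sorted_map; apply: (sub_in_sorted (P := mem (free_points S))) (sorted_free S); last exact/allP.
move=> i j /=; rewrite !mem_free => /eqP/phiE Ei /eqP/phiE Ej ij.
have := match_nocross (dmatch_planar Z) (top i) (top j); rewrite Ei Ej /= /lt ij.
have := ltn_ord (phi i); have := ltn_ord (phi j).
have := ltn_ord i; have := ltn_ord j.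
have : phi i != phi j.
  apply: contraTneq ij => E; suff /top_inj-> : top i = top j by rewrite ltnn.
  by apply: (can_inj (dmatchK Z)); rewrite Ei Ej E.
by rewrite -val_eqE /=; lia.
Qed.

End TableDiagrams.

Section TableBijection.
Variables (n : nat) (H : hypergroup).
Local Notation B := (hg_bas H).
Local Notation D := (diagram n B).
Local Notation top := (@lshift n n).
Local Notation bot := (@bottom_point n).
Local Notation bar := (@hg_barB H).
Local Notation refl := (reflect_diagram bar : D -> D).

Lemma prop_labelE r (b : r.-tuple B) k b0 : (k < r)%N ->
  prop_label b k = if odd k then bar (nth b0 b k) else nth b0 b k.
Proof. by move=> kr; rewrite /prop_label (set_nth_default b0) ?size_tuple. Qed.

(** By planarity the propagating edges join the free points of the two halves in
    increasing order ([free_increasing]), so the halves and the labels of the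
    propagating edges determine the diagram. *)
Lemma tdiag_of_rank Z r (S T : half n B r) : r = rank Z ->
  val S = top_config Z -> val T = top_config (refl Z) -> exists b, tdiag S T b = Z.
Proof.
move=> rZ; move: rZ S T => -> S T ES ET.
pose phi i := odflt i [pick p | dmatch Z (top i) == bot p].
have phiE i : val S i = None -> dmatch Z (top i) = bot (phi i).
  move=> /eqP; rewrite ES top_configN /phi; case: pickP => [p /eqP->|] //=.
  elim/top_bot_ind: (dmatch Z (top i)) => p; first by rewrite leqNgt top_ltn.
  by move/(_ p); rewrite eqxx.
have Efree := free_increasing ES ET phiE.
have Epair i : val S i = None -> free_pair S T i = phi i.
  move=> Si; rewrite /free_pair -Efree (nth_map i) ?size_free ?index_free //.
  by rewrite nth_index // mem_free Si.
pose lab i := dlabel Z (top i).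
have Em : table_match S T = dmatch Z.
  have Et i : table_match S T (top i) = dmatch Z (top i).
    rewrite table_match_top; case E: (val S i) => [[k c]|].
      by move: E; rewrite ES => /top_configP[].
    by rewrite phiE // -Epair.
  apply/ffunP; elim/top_bot_ind=> i //; rewrite table_match_bot; case E: (val T i) => [[k c]|].
    move: E; rewrite ET => /top_configP[]; rewrite dmatch_reflect rev_top => E _.
    by apply: (can_inj (@rev_ordK _)); rewrite E rev_bot.
  rewrite -/(free_pair T S i); apply: (can_inj (dmatchK Z)).
  by rewrite dmatchK phiE ?free_pairN // -Epair ?free_pairN // free_pairK.
pose b : (rank Z).-tuple B := [tuple let x := nth (hg_one H) (map lab (free_points S)) k in
  if odd k then bar x else x | k < rank Z].
have Eb i : val S i = None -> prop_label b (index i (free_points S)) = lab i.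
  move=> Si; have kr := index_free Si; rewrite (prop_labelE _ (hg_one H)) //.
  rewrite -[index i _]/(val (Ordinal kr)) -tnth_nth tnth_mktuple /=.
  rewrite (nth_map i) ?size_free // nth_index ?mem_free ?Si //.
  by case: odd; rewrite ?hg_barBK.
exists b; apply: val_inj; rewrite SubK [RHS]surjective_pairing -/(dmatch Z) -/(dlabel Z) Em.
congr (_, _); apply/ffunP; elim/top_bot_ind=> i.
  rewrite table_label_top; case E: (val S i) => [[k c]|]; last exact: Eb.
  by move: E; rewrite ES => /top_configP[].
rewrite table_label_bot; case E: (val T i) => [[k c]|].
  move: E; rewrite ET => /top_configP[_]; rewrite dlabel_reflect rev_top => <-.
  by rewrite hg_barBK.
have Ti := free_pairN S E; rewrite -(index_free_pair S E) Eb // /lab -dlabel_match.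
by rewrite phiE // -Epair // free_pairK.
Qed.

Definition table_ix := {r : table_index n & (half n B (val r) * half n B (val r) * (val r).-tuple B)%type}.

Definition tdiag_ix (q : table_ix) : D := tdiag (tagged q).1.1 (tagged q).1.2 (tagged q).2.

Lemma tdiag_ix_surj Z : exists q, tdiag_ix q = Z.
Proof.
pose r : table_index n := Sub (Ordinal (rank_lt Z)) (rank_even Z).
have TP : is_half (val r) (top_config (refl Z)).
  by rewrite (_ : nat_of_ord (val r) = rank (refl Z)) ?top_config_half // rank_reflect.
pose S : half n B (val r) := Sub _ (top_config_half Z).
pose T : half n B (val r) := Sub _ TP.
have [b bE] := @tdiag_of_rank Z (val r) S T erefl (SubK _ _) (SubK _ _).
by exists (Tagged (fun r : table_index n => (half n B (val r) * half n B (val r) * (val r).-tuple B)%type) (S, T, b)).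
Qed.

Lemma tdiag_inj r (S T S' T' : half n B r) b b' :
  tdiag S T b = tdiag S' T' b' -> [/\ S = S', T = T' & b = b'].
Proof.
move=> E; have SS : S = S' by apply: val_inj; rewrite -(top_config_tdiag S T b) E top_config_tdiag.
have TT : T = T' by apply: val_inj; rewrite -(bot_config_tdiag S T b) E bot_config_tdiag.
split=> //; rewrite -{S'}SS -{T'}TT in E; apply: eq_from_tnth => k.
have kr := ltn_ord k; rewrite !(tnth_nth (hg_one H)).
have [i Ei] : exists i, index i (free_points S) = k /\ val S i = None.
  have i0 : 'I_n.
    case F: (free_points S) (size_free S) => [|i s] //= sr.
    by exfalso; move: kr; rewrite [X in (_ < X)%N](esym sr).
  by exists (nth i0 (free_points S) k); rewrite index_free_nth // free_nth.
case: Ei => Ik Si.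
have := congr1 (fun X => dlabel X (top i)) E; rewrite !dlabel_tdiag !table_label_top Si Ik.
rewrite !(prop_labelE _ (hg_one H)) //; case: odd => //.
exact: (can_inj (@hg_barBK H)).
Qed.

Lemma tdiag_ix_inj : injective tdiag_ix.
Proof.
move=> [r [[S T] b]] [r' [[S' T'] b']]; rewrite /tdiag_ix /= => E.
have rr : r = r' by do 2!apply: val_inj; rewrite -[LHS](rank_tdiag S T b) E rank_tdiag.
by move: rr S' T' b' E => <- S' T' b' /tdiag_inj[-> -> ->].
Qed.

End TableBijection.

(** * Products of table elements *)

Section Products.
Variables (n : nat) (H : hypergroup) (R : comNzRingType).
Local Notation pt := 'I_(n + n).
Local Notation B := (hg_bas H).
Local Notation D := (diagram n B).
Local Notation emb := (@hg_emb H).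
Local Notation coord := (@hg_coord H).
Local Notation top := (@lshift n n).
Local Notation bot := (@bottom_point n).
Local Notation bar := (@hg_barB H).
Local Notation refl := (reflect_diagram bar : D -> D).

Lemma prodD_supp (X Y Z : D) : (prodD R X Y)@_Z != 0 -> dmatch Z = comp_match X Y /\
  forall j : pt, odd j -> (coord (comp_label X Y j))@_(dlabel Z j) != 0.
Proof.
rewrite prodDE mcoeffZ expand_coef ?comp_planar //; case: ifP => [/eqP E nz|_]; last by rewrite mulr0 eqxx.
split=> // j jo; apply: contraNneq nz => E0.
by rewrite [X in laurentC X](bigD1 j) //= E0 mul0r [laurentC 0]raddf0 mulr0.
Qed.

Lemma stack_in_top i : stack_in (top i) = (true, top i).
Proof. by rewrite stack_inE top_ltn. Qed.

Lemma stack_in_bot i : stack_in (bot i) = (false, bot i).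
Proof. by rewrite stack_inE bot_ltn. Qed.

Lemma comp_top_arc X Y i k : dmatch X (top i) = top k ->
  comp_match X Y (top i) = top k /\ comp_label X Y (top i) = emb (dlabel X (top i)).
Proof.
move=> E; have P0 : is_path_to X Y (top i) 0.
  by apply: path_to0; rewrite stack_in_top /stack_end E outerE top_ltn.
by rewrite (comp_matchE P0) (comp_labelE P0) stack_in_top path_prod1.
Qed.

Lemma comp_bot_arc X Y i k : dmatch Y (bot i) = bot k ->
  comp_match X Y (bot i) = bot k /\ comp_label X Y (bot i) = emb (dlabel Y (bot i)).
Proof.
move=> E; have P0 : is_path_to X Y (bot i) 0.
  by apply: path_to0; rewrite stack_in_bot /stack_end E outerE bot_ltn.
by rewrite (comp_matchE P0) (comp_labelE P0) stack_in_bot path_prod1.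
Qed.

Lemma emb_coord_eq (b c : B) : (coord (emb b))@_c != 0 -> c = b.
Proof. by rewrite hg_coord_emb mcoeffU; case: (b =P c) => [->|]; rewrite ?eqxx. Qed.

Lemma top_config_prodD (X Y Z : D) (i k : 'I_n) c : (prodD R X Y)@_Z != 0 ->
  top_config X i = Some (k, c) -> top_config Z i = Some (k, c).
Proof.
move=> /prodD_supp[mE lE] /top_configP[E1 E2]; apply/top_configP.
rewrite mE; have [E3 E4] := comp_top_arc Y E1; split=> //; rewrite -E2.
have [io|io] := boolP (odd (top i)); first by apply: emb_coord_eq; rewrite -E4; apply: lE.
have E1' : dmatch X (top k) = top i by rewrite -E1 dmatchK.
have [_ E4'] := comp_top_arc Y E1'; rewrite -(dlabel_match Z) mE E3 -(dlabel_match X) E1.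
by apply: emb_coord_eq; rewrite -E4'; apply: lE; rewrite -E1 dmatch_parity.
Qed.

Lemma bot_config_prodD (X Y Z : D) (i k : 'I_n) c : (prodD R X Y)@_Z != 0 ->
  top_config (refl Y) i = Some (k, c) -> top_config (refl Z) i = Some (k, c).
Proof.
move=> nz YE; apply: (@top_config_prodD (refl Y) (refl X)) YE.
rewrite -(prodD_refl R (hg_bar_antiaut H) (@hg_barBK H)).
by rewrite reflR_coef //; apply: hg_barBK.
Qed.

Lemma config_le (c c' : config n B) : (forall i k b, c i = Some (k, b) -> c' i = Some (k, b)) ->
  (#|[pred j | c' j == None]| <= #|[pred j | c j == None]|)%N /\
  (#|[pred j | c' j == None]| = #|[pred j | c j == None]| -> c' = c).
Proof.
move=> cc; have sub : [pred j | c' j == None] \subset [pred j | c j == None].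
  apply/subsetP=> j; rewrite !inE; apply: contraTT.
  by case E: (c j) => [[k b]|] //; rewrite (cc _ _ _ E).
split; first exact: subset_leq_card.
move=> E; have /subset_cardP/(_ sub) E' := E; apply/ffunP=> i.
case Ei: (c i) => [[k b]|]; first exact: cc.
by have := E' i; rewrite !inE Ei eqxx => /eqP.
Qed.

Lemma rankE (Z : D) : rank Z = #|[pred j | top_config Z j == None]|.
Proof. by apply: eq_card => i; rewrite !inE top_configN. Qed.

Lemma rank_prodD_l (X Y Z : D) : (prodD R X Y)@_Z != 0 -> (rank Z <= rank X)%N.
Proof.
move=> nz; rewrite !rankE; apply: (proj1 (config_le _)) => i k b.
exact: (top_config_prodD nz).
Qed.

(** The bottom edges of Y stay at the bottom of X * Y, so either propagating
    edges are lost or the bottom half of Y is kept. *)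
Lemma rank_prodD_r (X Y Z : D) : (prodD R X Y)@_Z != 0 -> (rank Z <= rank Y)%N /\
  (rank Z = rank Y -> top_config (refl Z) = top_config (refl Y)).
Proof.
move=> nz; rewrite -(rank_reflect bar Z) -(rank_reflect bar Y) !rankE.
by apply: config_le => i k b; apply: (bot_config_prodD nz).
Qed.

(** The propagating edges of odd index run downwards: their labels are conjugated so
    that x k is always read from bottom to top. This makes the labels of a product
    of two such diagrams multiply, with no reversal at the odd places. *)
Definition alg_label r (S T : half n B r) (x : nat -> H) (j : pt) : H :=
  let pl k := if odd k then hg_bar (x k) else x k in
  match split j with
  | inl i => if val S i is Some (_, c) then emb c else pl (index i (free_points S))
  | inr i => let p := rev_ord i in
    if val T p is Some (_, c) then emb (bar c) else pl (index p (free_points T))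
  end.

Lemma alg_label_top r (S T : half n B r) x i : alg_label S T x (top i) =
  if val S i is Some (_, c) then emb c else
  if odd (index i (free_points S)) then hg_bar (x (index i (free_points S)))
  else x (index i (free_points S)).
Proof. by rewrite /alg_label split_top. Qed.

Lemma alg_label_bot r (S T : half n B r) x i : alg_label S T x (bot i) =
  if val T i is Some (_, c) then emb (bar c) else
  if odd (index i (free_points T)) then hg_bar (x (index i (free_points T)))
  else x (index i (free_points T)).
Proof. by rewrite /alg_label split_bot rev_ordK. Qed.

Lemma hg_barE b : hg_bar (emb b) = emb (bar b).
Proof. exact: (bna_basis (hg_bar_antiaut H)). Qed.

Lemma expand_alg_label r (S T : half n B r) (b : r.-tuple B) :
  expand R (table_match S T) (alg_label S T (fun k => emb (nth (hg_one H) b k))) = << tdiag S T b >>.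
Proof.
apply: expand_emb; first exact: dmatch_tdiag.
move=> j _; rewrite dlabel_tdiag; elim/top_bot_ind: j => i.
  rewrite alg_label_top table_label_top; case: (val S i) => [[k c]|] //.
  by rewrite /prop_label; case: odd; rewrite ?hg_barE.
rewrite alg_label_bot table_label_bot; case: (val T i) => [[k c]|] //.
by rewrite /prop_label; case: odd; rewrite ?hg_barE.
Qed.

Definition arcs r (S : half n B r) := #|[set i : 'I_n | odd i & val S i != None]|.

Section TableProduct.
Variables (r : nat) (S1 S T : half n B r) (a b : r.-tuple B).
Let X := tdiag S1 S a.
Let Y := tdiag S T b.

Let endX_top i : stack_end X Y (true, top i) = (true, if val S1 i is Some (k, _) then top k else bot (free_pair S1 S i)).
Proof. by rewrite /stack_end dmatch_tdiag table_match_top. Qed.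
Let endX_bot i : stack_end X Y (true, bot i) = (true, if val S i is Some (k, _) then bot k else top (free_pair S S1 i)).
Proof. by rewrite /stack_end dmatch_tdiag table_match_bot. Qed.
Let endY_top i : stack_end X Y (false, top i) = (false, if val S i is Some (k, _) then top k else bot (free_pair S T i)).
Proof. by rewrite /stack_end dmatch_tdiag table_match_top. Qed.
Let endY_bot i : stack_end X Y (false, bot i) = (false, if val T i is Some (k, _) then bot k else top (free_pair T S i)).
Proof. by rewrite /stack_end dmatch_tdiag table_match_bot. Qed.

Let outer_top (c : bool) i : stack_outer (c, top i) = c.
Proof. by rewrite outerE top_ltn eqb_id. Qed.
Let outer_bot (c : bool) i : stack_outer (c, bot i) = ~~ c.
Proof. by rewrite outerE bot_ltn; case: c. Qed.
Let cross_top (c : bool) i : cross (c, top i) = (~~ c, bot i). Proof. by []. Qed.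
Let cross_bot (c : bool) i : cross (c, bot i) = (~~ c, top i).
Proof. by rewrite /cross /= rev_bot. Qed.

Let x k := emb (nth (hg_one H) a k) * emb (nth (hg_one H) b k).

(** The free points of S face each other, so each propagating edge of the product
    consists of one edge of each factor. *)
Lemma comp_table j : comp_match X Y j = table_match S1 T j /\
  (odd j -> comp_label X Y j = alg_label S1 T x j).
Proof.
elim/top_bot_ind: j => i.
  rewrite table_match_top alg_label_top; case E: (val S1 i) => [[k c]|].
    have E' : dmatch X (top i) = top k by rewrite dmatch_tdiag table_match_top E.
    by have [-> ->] := comp_top_arc Y E'; rewrite dlabel_tdiag table_label_top E.
  have Sp := free_pairN S E; have P1 : is_path_to X Y (top i) 1.
    by apply: path_to1; rewrite ?stack_nextE stack_in_top endX_top E ?outer_bot ?cross_bot //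
      endY_top Sp outer_bot.
  rewrite (comp_matchE P1) (comp_labelE P1) [iter _ _ _]/= [traject _ _ _]/= stack_in_top.
  rewrite stack_nextE endX_top E cross_bot endY_top Sp /free_pair -/(free_pair S1 S i).
  rewrite index_free_pair //; split=> [|io].
    by congr bot; apply: set_nth_default; rewrite size_free index_free.
  rewrite -(odd_index_free E) in io; rewrite !path_prod_cons path_prod_nil mul1r /stack_label.
  rewrite !dlabel_tdiag !table_label_top E Sp index_free_pair // /prop_label io.
  by rewrite /x (bna_mul (hg_bar_antiaut H)) !hg_barE.
rewrite table_match_bot alg_label_bot; case E: (val T i) => [[k c]|].
  have E' : dmatch Y (bot i) = bot k by rewrite dmatch_tdiag table_match_bot E.
  by have [-> ->] := comp_bot_arc X E'; rewrite dlabel_tdiag table_label_bot E.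
have Sp := free_pairN S E; have P1 : is_path_to X Y (bot i) 1.
  by apply: path_to1; rewrite ?stack_nextE stack_in_bot endY_bot E ?outer_top ?cross_top //
    endX_bot Sp outer_top.
rewrite (comp_matchE P1) (comp_labelE P1) [iter _ _ _]/= [traject _ _ _]/= stack_in_bot.
rewrite stack_nextE endY_bot E cross_top endX_bot Sp /free_pair -/(free_pair T S i).
rewrite index_free_pair //; split=> [|io].
  by congr top; apply: set_nth_default; rewrite size_free index_free.
rewrite odd_bot -(odd_index_free E) in io; rewrite !path_prod_cons path_prod_nil mul1r /stack_label.
by rewrite !dlabel_tdiag !table_label_bot E Sp index_free_pair // /prop_label (negPf io).
Qed.

(** Each arc of S closes up with its mirror image into a loop; its label is that of
    the arc times its conjugate, which has trace 1. *)
Lemma loopK_table : loopK R X Y = deltaR R ^+ arcs S.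
Proof.
have nI := stack_next_inj (X := X) (Y := Y).
have symf := fconnect_sym nI.
pose f := stack_next X Y.
pose F (w : stack_pt n) := loop_value R (path_label X Y (orbit f w)).
pose P (w : stack_pt n) := odd w.2 && ~~ has (fun w' => stack_outer (stack_end X Y w')) (orbit f w).
have inP w : P w -> forall t, ~~ stack_outer (stack_end X Y (iter t f w)).
  by case/andP=> _ /hasPn noh t; apply: noh; rewrite -fconnect_orbit fconnect_iter.
have f_arc i k c : val S i = Some (k, c) -> f (false, top i) = (true, bot k) /\ f (true, bot k) = (false, top i).
  move=> E; rewrite /f !stack_nextE endY_top E cross_top endX_bot (half_sym E) cross_bot //.
rewrite loopKE.
have -> : \prod_(w | is_loop_base X Y w) F w = \prod_(w | P w && (froot f w == w)) F w.
  by apply: eq_bigl => w; rewrite /is_loop_base /P /enters andbAC -andbA.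
rewrite -(@prod_transversal _ _ f nI F P
  (mem [set (false, top i) | i in [set i : 'I_n | odd i & val S i != None]])); first last.
- move=> w v /imsetP[i]; rewrite inE => /andP[io Si] -> /imsetP[j]; rewrite inE => /andP[jo Sj] ->.
  case Ei: (val S i) Si => [[k c]|] // _; have [f1 f2] := f_arc _ _ _ Ei.
  case/iter_findex; elim/ltn_ind: (findex _ _ _) => -[|[|t]] IHt.
  + by [].
  + by rewrite [iter _ _ _]/= f1 => /(congr1 fst).
  by rewrite !iterSr f1 f2 => /IHt; apply.
- case=> c j Pw; have noh := inP _ Pw; have /andP[/= jo _] := Pw.
  have n0 := noh 0%N; have n1 := noh 1%N; rewrite [iter _ _ _]/= in n0; rewrite [iter _ _ _]/= /f stack_nextE in n1.
  case: c noh jo n0 n1 Pw => noh; elim/top_bot_ind: j noh => i noh jo.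
  + rewrite endX_top; case E: (val S1 i) => [[k c]|]; first by rewrite outer_top.
    by rewrite cross_bot endY_top free_pairN // !outer_bot.
  + rewrite endX_bot; case E: (val S i) => [[k c]|]; last by rewrite outer_top.
    move=> _ _ _; have Ek := half_sym E; have [f1 f2] := f_arc _ _ _ Ek.
    exists (false, top k); last by rewrite -f2; apply: fconnect1.
    rewrite mem_imset; last by move=> ? ? /(congr1 snd)/top_inj.
    by rewrite inE Ek andbT -(negbK (odd k)) -(half_parity Ek) -odd_bot.
  + rewrite endY_top; case E: (val S i) => [[k c]|]; last by rewrite outer_bot.
    move=> _ _ _; exists (false, top i); last exact: connect0.
    by rewrite mem_imset ?inE ?E ?andbT //; move=> ? ? /(congr1 snd)/top_inj.
  rewrite endY_bot; case E: (val T i) => [[k c]|]; first by rewrite outer_bot.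
  by rewrite cross_top endX_bot free_pairN // !outer_top.
- move=> w /imsetP[i]; rewrite inE => /andP[io Si] ->; rewrite /P io /=.
  case Ei: (val S i) Si => [[k c]|] // _; have [f1 f2] := f_arc _ _ _ Ei.
  apply/hasPn=> z; rewrite -fconnect_orbit => /iter_findex <-.
  elim/ltn_ind: (findex _ _ _) => -[|[|t]] IHt.
  + by rewrite [iter _ _ _]/= endY_top Ei outer_top.
  + by rewrite [iter _ _ _]/= f1 endX_bot (half_sym Ei) outer_bot.
  by rewrite !iterSr f1 f2; apply: IHt.
- move=> w v wv /andP[wo /hasPn noh]; rewrite /P; apply/andP; split.
    apply: (@closed_connect _ f (fun w : stack_pt n => odd w.2) _ w v wv wo) => z.
    by rewrite enters_next.
  by apply/hasPn=> z; rewrite -fconnect_orbit => vz; apply: noh; rewrite -fconnect_orbit (connect_trans wv).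
- by move=> w v wv; exact: (cycle_value_connect loop_valueC nI (fun w => emb (stack_label X Y w)) wv).
rewrite big_imset; last by move=> i j _ _ /(congr1 snd)/top_inj.
rewrite -prodr_const; apply: eq_bigr => i; rewrite inE => /andP[io].
case Ei: (val S i) => [[k c]|] // _; have [f1 f2] := f_arc _ _ _ Ei.
rewrite /F path_labelE -[LHS]/(cycle_value (loop_value R) f (fun w => emb (stack_label X Y w)) (false, top i)).
rewrite (@cycle_value_cycle _ _ (loop_value R) loop_valueC _ f _ [:: (false, top i); (true, bot k)]).
- rewrite !path_prod_cons path_prod_nil mul1r /stack_label !dlabel_tdiag table_label_top table_label_bot.
  by rewrite Ei (half_sym Ei) [LHS]loop_value_emb eqxx rmorph1 mulr1.
- by rewrite /= f1 f2 !eqxx.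
- by [].
by rewrite mem_head.
Qed.

Lemma prodD_table : prodD R X Y = deltaR R ^+ arcs S *: expand R (table_match S1 T) (alg_label S1 T x).
Proof.
rewrite prodDE loopK_table; congr (_ *: _).
have -> : comp_match X Y = table_match S1 T by apply/ffunP=> j; case: (comp_table j).
by apply: eq_expand => [|j jo]; [apply: table_match_planar|case: (comp_table j) => _; apply].
Qed.

End TableProduct.
End Products.

(** * Tensor powers *)

Section Tensors.
Variable K : comNzRingType.

Lemma tensor_coef (X : choiceType) r (a : 'I_r -> {malg K[X]}) t :
  (tensor a)@_t = \prod_(i < r) (a i)@_(tnth t i).
Proof.
rewrite /tensor; set S := (\bigcup_(_ <- _) _)%fset; rewrite raddf_sum /=.
under eq_bigr do rewrite mcoeffU.
have [/forallP tS|] := boolP [forall i, tnth t i \in S].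
  pose f0 : {ffun 'I_r -> S} := [ffun i => [` tS i]%fset].
  have tup (f : {ffun 'I_r -> S}) : ([tuple val (f i) | i < r] == t) = (f == f0).
    apply/eqP/eqP=> [E|->]; last by apply: eq_from_tnth => i; rewrite tnth_mktuple ffunE.
    by apply/ffunP=> i; apply: val_inj; rewrite ffunE /= -E tnth_mktuple.
  rewrite (bigD1 f0) //= tup eqxx [X in _ + X]big1 ?addr0 => [|f /negPf nf]; last by rewrite tup nf.
  by apply: eq_bigr => i _; rewrite ffunE.
case/forallPn=> i iS; rewrite big1.
  rewrite (bigD1 i) //= mcoeff_outdom ?mul0r //; apply: contra iS => iS.
  by apply/bigfcupP; exists i => //; rewrite mem_enum.
move=> f _; case: eqP => // E; move: iS; rewrite -E tnth_mktuple.
by rewrite (valP (f i)).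
Qed.

Lemma eq_tensor (X : choiceType) r (a a' : 'I_r -> {malg K[X]}) : a =1 a' -> tensor a = tensor a'.
Proof. by move=> E; apply/malgP=> t; rewrite !tensor_coef; apply: eq_bigr => i _; rewrite E. Qed.

Lemma tensorU (X : choiceType) r (c : 'I_r -> K) (x : 'I_r -> X) :
  tensor (fun i => << c i *g x i >>) = << \prod_i c i *g [tuple x i | i < r] >>.
Proof.
apply/malgP=> t; rewrite tensor_coef mcoeffU; case: eqP => [<-|nt].
  by apply: eq_bigr => i _; rewrite mcoeffU tnth_mktuple eqxx.
have [/forallP E|] := boolP [forall i, x i == tnth t i].
  by case: nt; apply: eq_from_tnth => i; rewrite tnth_mktuple (eqP (E i)).
by case/forallPn=> i /negPf xi; rewrite (bigD1 i) //= mcoeffU xi mul0r.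
Qed.

Lemma tensorU1 (X : choiceType) r (t : r.-tuple X) : tensor (fun i => << tnth t i >>) = << t >> :> {malg K[_]}.
Proof. by rewrite tensorU big1 //; congr << _ *g _ >>; apply: eq_from_tnth => i; rewrite tnth_mktuple. Qed.

Lemma tensor_multiadditive (X Y : choiceType) r (h : 'I_r -> {malg K[X]} -> {malg K[Y]}) :
  (forall i a b, h i (a - b) = h i a - h i b) ->
  multiadditive (fun l : {ffun 'I_r -> {malg K[X]}} => tensor (fun i => h i (l i))).
Proof.
move=> hB j l a b; apply/malgP=> t; rewrite mcoeffB !tensor_coef !(bigD1 j (P := predT)) //=.
rewrite !updE eqxx hB mcoeffB mulrBl.
by congr (_ * _ - _ * _); apply: eq_bigr => i /negPf ij; rewrite !updE ij.
Qed.

(** Tensor products of linear maps: both sides are multi-additive in f, and agree on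
    multiples of basis elements. *)
Lemma tensor_lincomb (X Y : choiceType) r (e : 'I_r -> X -> {malg K[Y]}) (f : 'I_r -> {malg K[X]}) :
  tensor (fun i => lincomb (e i) (f i)) =
  lincomb (fun t : r.-tuple X => tensor (fun i => e i (tnth t i))) (tensor f).
Proof.
pose l : {ffun 'I_r -> {malg K[X]}} := [ffun i => f i].
transitivity (tensor (fun i => lincomb (e i) (l i))).
  by apply: eq_tensor => i; rewrite ffunE.
transitivity (lincomb (fun t : r.-tuple X => tensor (fun i => e i (tnth t i))) (tensor l)); last first.
  by congr lincomb; apply: eq_tensor => i; rewrite ffunE.
apply: (multiadd_ext (@malg_gen K X)
  (Phi := fun l => tensor (fun i => lincomb (e i) (l i)))
  (Psi := fun l => lincomb (fun t : r.-tuple X => tensor (fun i => e i (tnth t i))) (tensor l))).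
- by apply: (@tensor_multiadditive X Y r (fun i => lincomb (e i))) => i a b; apply: lincombB.
- move=> j k a b; rewrite -lincombB; congr lincomb.
  exact: (@tensor_multiadditive X X r (fun _ => id)).
move=> k kU; have [c cP] := fin_all_exists kU; have [x xP] := fin_all_exists cP.
rewrite (@eq_tensor _ _ k (fun i => << c i *g x i >>)) // tensorU malgUZ lincombZ lincombU1.
apply/malgP=> t; rewrite mcoeffZ !tensor_coef -big_split; apply: eq_bigr => i _ /=.
by rewrite xP lincombU mcoeffZ tnth_mktuple.
Qed.

End Tensors.

Section TensorPower.
Variables (H : hypergroup) (R : comNzRingType).
Local Notation B := (hg_bas H).
Local Notation emb := (@hg_emb H).

Definition coordR (x : H) : {malg R[B]} := base_change (fun z : int => z%:~R : R) (hg_coord x).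

Lemma coordRB x y : coordR (x - y) = coordR x - coordR y.
Proof. by rewrite /coordR [hg_coord _]raddfB base_changeB. Qed.

Lemma coordR_emb b : coordR (emb b) = << b >>.
Proof. by rewrite /coordR hg_coord_emb base_changeU. Qed.

(** Left multiplication by the basis element a of the r-th tensor power. *)
Definition tensor_act r (a : r.-tuple B) : {malg R[r.-tuple B]} -> {malg R[r.-tuple B]} :=
  lincomb (fun b : r.-tuple B => tensor (fun i => coordR (emb (tnth a i) * emb (tnth b i)))).

Lemma tensor_act_tensor r (a : r.-tuple B) (y : 'I_r -> {malg R[B]}) :
  tensor_act a (tensor y) = tensor (fun i => @hgR_mul H R << tnth a i >> (y i)).
Proof.
rewrite /tensor_act -(tensor_lincomb (fun i c => coordR (emb (tnth a i) * emb c))).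
by apply: eq_tensor => i; rewrite [RHS]lincombU1.
Qed.

Lemma tensor_act1 r (b : r.-tuple B) : tensor_act [tuple hg_one H | i < r] << b >> = << b >>.
Proof.
rewrite /tensor_act lincombU1 -[RHS]tensorU1; apply: eq_tensor => i.
by rewrite tnth_mktuple hg_emb1 mul1r coordR_emb.
Qed.

End TensorPower.

(** * Straightening products with table elements *)

Lemma base_change_laurentU (R : comNzRingType) (X : choiceType) (x : X) :
  base_change (@laurentC R) << x >> = << x >>.
Proof. by rewrite base_changeU; congr << _ *g _ >>; apply: (rmorph1 (@laurentC R)). Qed.

Section Straightening.
Variables (n : nat) (H : hypergroup) (R : comNzRingType).
Local Notation pt := 'I_(n + n).
Local Notation B := (hg_bas H).
Local Notation D := (diagram n B).
Local Notation emb := (@hg_emb H).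
Local Notation K := (laurent R).
Local Notation top := (@lshift n n).
Local Notation bot := (@bottom_point n).
Local Notation bar := (@hg_barB H).
Local Notation mul := (@tlR_mul n H R).

Section Clin.
Variables (r : nat) (S T : half n B r).
Local Notation Clin := (@table_Clin n H R r S T).

Lemma table_ClinE y : Clin y =
  lincomb (fun b => << tdiag S T b >> : {malg K[D]}) (base_change (@laurentC R) y).
Proof. by apply: eq_lincomb => b; apply: table_CE. Qed.

Lemma table_Clin0 : Clin 0 = 0.
Proof. by rewrite table_ClinE base_change0 lincomb0. Qed.
Lemma table_ClinB x y : Clin (x - y) = Clin x - Clin y.
Proof. by rewrite !table_ClinE base_changeB lincombB. Qed.
Lemma table_ClinD x y : Clin (x + y) = Clin x + Clin y.
Proof. by rewrite !table_ClinE base_changeD lincombD. Qed.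
Lemma table_ClinZ d x : Clin (d *: x) = laurentC d *: Clin x.
Proof. by rewrite [LHS]table_ClinE base_changeZ lincombZ table_ClinE. Qed.
Lemma table_ClinU b : Clin << b >> = << tdiag S T b >>.
Proof. by rewrite table_ClinE base_change_laurentU lincombU1. Qed.

Lemma table_Clin_lincomb (X : choiceType) (e : X -> {malg R[r.-tuple B]}) y :
  Clin (lincomb e y) = lincomb (fun x => Clin (e x)) (base_change (@laurentC R) y).
Proof.
rewrite table_ClinE base_change_lincomb lincomb_lincomb.
by apply: eq_lincomb => x; rewrite table_ClinE.
Qed.

End Clin.

Definition ext_nat r (x : {ffun 'I_r -> H}) (k : nat) : H := oapp x 0 (insub k).

Lemma ext_natE r (x : {ffun 'I_r -> H}) (k : 'I_r) : ext_nat x k = x k.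
Proof. by rewrite /ext_nat valK. Qed.

Lemma hg_bar_sub a b : hg_bar (a - b) = hg_bar a - hg_bar b :> H.
Proof. exact: (based_mapB (bna_add (hg_bar_antiaut H))). Qed.

Lemma expand_table_additive r (S T : half n B r) :
  multiadditive (fun x => expand R (table_match S T) (alg_label S T (@ext_nat r x))).
Proof.
move=> k0 x a b; have mP := table_match_planar S T.
have xE c k (kr : (k < r)%N) : ext_nat (upd x k0 c) k = if k == k0 then c else ext_nat x k.
  by rewrite -[k]/(val (Ordinal kr)) !ext_natE updE -val_eqE.
(* The entering end of the propagating edge of index k0 is at the top of the
   diagram when k0 is odd and at its bottom when k0 is even. *)
have [j0 [j0o j0E]] : exists j0 : pt, odd j0 /\ forall (j : pt) c, odd j -> alg_label S T (ext_nat (upd x k0 c)) j =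
    if j == j0 then (if odd k0 then hg_bar c else c) else alg_label S T (ext_nat x) j.
  have [S0 [T0 [[IS NS] [IT NT]]]] : exists i p, (index i (free_points S) = k0 /\ val S i = None) /\
      (index p (free_points T) = k0 /\ val T p = None).
    have kr := ltn_ord k0.
    have ex (U : half n B r) : exists i, index i (free_points U) = k0 /\ val U i = None.
      have i0 : 'I_n.
        case F: (free_points U) (size_free U) => [|i s] //= sr.
        by exfalso; move: kr; rewrite [X in (_ < X)%N](esym sr).
      by exists (nth i0 (free_points U) k0); rewrite index_free_nth // free_nth.
    by have [i iP] := ex S; have [p pP] := ex T; exists i, p.
  exists (if odd k0 then top S0 else bot T0); split.
    case ko: (odd k0); first by rewrite /= -(odd_index_free NS) IS.
    by rewrite odd_bot -(odd_index_free NT) IT ko.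
  elim/top_bot_ind=> i c; rewrite ?odd_bot => io.
    rewrite !alg_label_top; case E: (val S i) => [[k c']|].
      case: ifP => // /eqP; case: odd => [/top_inj Ei|/eqP]; last by rewrite (negPf (top_neq_bot _ _)).
      by rewrite Ei NS in E.
    have kr := index_free E; rewrite (odd_index_free E) io xE // -IS.
    case: eqP => [Ei|nEi].
      have Ei' : i = S0 by rewrite -(@nth_index _ i i (free_points S)) ?Ei ?nth_index ?mem_free ?E ?NS.
      by rewrite Ei' (odd_index_free NS) -Ei' io eqxx.
    case: ifP => // /eqP; case: odd => [/top_inj Ei|/eqP]; last by rewrite (negPf (top_neq_bot _ _)).
    by case: nEi; rewrite Ei.
  rewrite !alg_label_bot; case E: (val T i) => [[k c']|].
    case: ifP => // /eqP; case: odd => [/esym/eqP|/bot_inj Ei]; first by rewrite (negPf (top_neq_bot _ _)).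
    by rewrite Ei NT in E.
  have kr := index_free E; rewrite (odd_index_free E) (negPf io) xE // -IT.
  case: eqP => [Ei|nEi].
    have Ei' : i = T0 by rewrite -(@nth_index _ i i (free_points T)) ?Ei ?nth_index ?mem_free ?E ?NT.
    by rewrite Ei' (odd_index_free NT) -Ei' (negPf io) eqxx.
  case: ifP => // /eqP; case: odd => [/esym/eqP|/bot_inj Ei]; first by rewrite (negPf (top_neq_bot _ _)).
  by case: nEi; rewrite Ei.
apply: (expand_additive R mP j0o).
- by rewrite !j0E // eqxx; case: odd; rewrite ?hg_bar_sub.
- by move=> j jo /negPf jj; rewrite !j0E // jj.
by move=> j jo /negPf jj; rewrite !j0E // jj.
Qed.

(** Both sides are additive in the label of each propagating edge. *)
Lemma expand_table r (S T : half n B r) (x : {ffun 'I_r -> H}) :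
  expand R (table_match S T) (alg_label S T (ext_nat x)) =
  table_Clin S T (tensor (fun i => coordR R (x i))).
Proof.
apply: (multiadd_ext (@hg_gen H)
  (Phi := fun x => expand R (table_match S T) (alg_label S T (ext_nat x)))
  (Psi := fun x => table_Clin S T (tensor (fun i => coordR R (x i))))).
- exact: expand_table_additive.
- move=> j l a b; rewrite -table_ClinB; congr table_Clin.
  apply/malgP=> t; rewrite mcoeffB !tensor_coef !(bigD1 j (P := predT)) //=.
  rewrite !updE eqxx coordRB mcoeffB mulrBl.
  by congr (_ * _ - _ * _); apply: eq_bigr => i /negPf ij; rewrite !updE ij.
move=> l lB; have [b bE] := fin_all_exists lB.
rewrite (@eq_tensor _ _ _ _ (fun i => << tnth [tuple b i | i < r] i >>)); last first.
  by move=> i; rewrite bE coordR_emb tnth_mktuple.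
rewrite tensorU1 table_ClinU -(@expand_alg_label n H R); apply: eq_expand => [|j jo].
  exact: table_match_planar.
have E (k : nat) : (k < r)%N -> ext_nat l k = emb (nth (hg_one H) [tuple b i | i < r] k).
  by move=> kr; rewrite -[k]/(val (Ordinal kr)) ext_natE bE -tnth_nth tnth_mktuple.
elim/top_bot_ind: j jo => i _.
  by rewrite !alg_label_top; case Ei: (val S i) => [[]|] //; rewrite E ?index_free.
by rewrite !alg_label_bot; case Ei: (val T i) => [[]|] //; rewrite E ?index_free.
Qed.

(** Each arc of S becomes a loop of value delta, and the labels of the propagating
    edges multiply in the tensor power. *)
Lemma prodD_tableE r (S1 S T : half n B r) (a b : r.-tuple B) :
  prodD R (tdiag S1 S a) (tdiag S T b) = deltaR R ^+ arcs S *: table_Clin S1 T (tensor_act a << b >>).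
Proof.
rewrite prodD_table; congr (_ *: _); rewrite /tensor_act lincombU1.
pose x : {ffun 'I_r -> H} := [ffun i => emb (tnth a i) * emb (tnth b i)].
rewrite (@eq_tensor _ _ _ _ (fun i => coordR R (x i))) => [|i]; last by rewrite ffunE.
rewrite -expand_table; apply: eq_expand => [|j _]; first exact: table_match_planar.
have E (k : nat) : (k < r)%N -> emb (nth (hg_one H) a k) * emb (nth (hg_one H) b k) = ext_nat x k.
  by move=> kr; rewrite -[k]/(val (Ordinal kr)) ext_natE ffunE -!tnth_nth.
elim/top_bot_ind: j => i.
  by rewrite !alg_label_top; case Ei: (val S1 i) => [[]|] //; rewrite E ?index_free.
by rewrite !alg_label_bot; case Ei: (val T i) => [[]|] //; rewrite E ?index_free.
Qed.

Definition low_rank r (f : {malg K[D]}) := forall Z, f@_Z != 0 -> (rank Z < r)%N.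

Lemma low_rank0 r : low_rank r 0. Proof. by move=> Z; rewrite mcoeff0 eqxx. Qed.

Lemma low_rankD r f g : low_rank r f -> low_rank r g -> low_rank r (f + g).
Proof.
move=> lf lg Z; rewrite mcoeffD; have [->|/lf//] := eqVneq f@_Z 0.
by rewrite add0r; apply: lg.
Qed.

Lemma low_rankDB r f f' g g' : low_rank r (f - f') -> low_rank r (g - g') -> low_rank r (f + g - (f' + g')).
Proof. by move=> lf lg; rewrite opprD addrACA; apply: low_rankD. Qed.

Lemma low_rankZ r c f : low_rank r f -> low_rank r (c *: f).
Proof. by move=> lf Z nz; apply: lf; apply: contraNneq nz; rewrite mcoeffZ => ->; rewrite mulr0. Qed.

Lemma low_rankZB r c f g : low_rank r (f - g) -> low_rank r (c *: f - c *: g).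
Proof. by rewrite -scalerBr; apply: low_rankZ. Qed.

Lemma low_rank_lincomb (X : choiceType) r (e : X -> {malg K[D]}) f :
  (forall x, f@_x != 0 -> low_rank r (e x)) -> low_rank r (lincomb e f).
Proof.
move=> lowe; rewrite lincomb_sum big_seq; elim/big_ind: _ => [|g h|x xf].
- exact: low_rank0.
- exact: low_rankD.
by apply: low_rankZ; apply: lowe; rewrite mcoeff_neq0.
Qed.

Lemma deltaR_neq0 c (p : K) : p != 0 -> deltaR R ^+ c * p != 0.
Proof.
move=> /eqP/malg_neq0P[k0 k0P].
have /seq_max[m ms mmax] : enum_fset (msupp p) != [::].
  apply/eqP=> E; have : k0 \in msupp p by rewrite -mcoeff_neq0.
  by rewrite -[_ \in _]/(k0 \in enum_fset (msupp p)) E.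
have pm k : m < k -> p@_k = 0.
  by move=> mk; apply: mcoeff_outdom; apply: contraL mk => /mmax; rewrite -leNgt.
have [E _] := deltaR_lead c pm; apply: contraTneq ms => p0.
by rewrite -mcoeff_eq0 -E p0 mcoeff0.
Qed.

Lemma low_rank_cancel r c f : low_rank r (deltaR R ^+ c *: f) -> low_rank r f.
Proof. by move=> lf Z nz; apply: lf; rewrite mcoeffZ; apply: deltaR_neq0. Qed.

(** Cut at the rank of T, the product X * C_{S,T}^b only depends on T and b
    through its right half: multiply X by the diagram C_{S,S}^1 first, at the
    price of a power of delta that can be cancelled. *)
Lemma prodD_straighten (X : D) r (S : half n B r) :
  exists c : {malg K[(half n B r * r.-tuple B)%type]}, forall (T : half n B r) b,
  low_rank r (prodD R X (tdiag S T b) -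
         lincomb (fun q => table_Clin q.1 T (tensor_act q.2 << b >>) : {malg K[D]}) c).
Proof.
pose one_r := [tuple hg_one H | i < r].
(* X * C_{S,S}^1 is a combination of elements C_{S',S}^a, modulo lower rank. *)
pose U := prodD R X (tdiag S S one_r).
have UP Z : U@_Z != 0 -> (rank Z < r)%N \/ exists q : half n B r * r.-tuple B, Z = tdiag q.1 S q.2.
  move=> nz; have [le eq_cfg] := rank_prodD_r nz; rewrite rank_tdiag in le.
  move: le; rewrite leq_eqVlt => /orP[/eqP rZ|]; [right|by left].
  have := eq_cfg; rewrite rank_tdiag bot_config_tdiag => /(_ rZ) ES.
  have S1P : is_half r (top_config Z) by rewrite -rZ top_config_half.
  have [b <-] := @tdiag_of_rank n H Z r (Sub _ S1P) S (esym rZ) (SubK _ _) (esym ES).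
  by exists (Sub _ S1P, b).
have [c [L [lowL UE]]] : exists c : {malg K[(half n B r * r.-tuple B)%type]}, exists L : {malg K[D]},
    low_rank r L /\ U = lincomb (fun q => << tdiag q.1 S q.2 >> : {malg K[D]}) c + L.
  rewrite [X in exists _, exists _, _ /\ X = _]monalgE big_seq.
  elim/big_ind: _ => [|f g [c [L [lL ->]]] [c' [L' [lL' ->]]]|Z ZU].
  - by exists 0, 0; rewrite lincomb0 addr0; split=> //; apply: low_rank0.
  - by exists (c + c'), (L + L'); rewrite lincombD addrACA; split=> //; apply: low_rankD.
  have UZ : U@_Z != 0 by rewrite mcoeff_neq0.
  have [lt|[q ->]] := UP Z UZ.
    exists 0, << U@_Z *g Z >>; rewrite lincomb0 add0r; split=> // Z'.
    by rewrite mcoeffU; have [<-|_] := eqVneq Z Z'; rewrite ?mulr0n ?eqxx.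
  exists << U@_(tdiag q.1 S q.2) *g q >>, 0; rewrite lincombU addr0 -malgUZ; split=> //; exact: low_rank0.
(* Multiplied on the right by C_{S,T}^b, both sides acquire the same power of
   delta. *)
exists c => T b; apply: (@low_rank_cancel r (arcs S)).
have E1 : deltaR R ^+ arcs S *: prodD R X (tdiag S T b) = lincomb (fun Z => prodD R Z (tdiag S T b)) U.
  rewrite /U prodD_assoc prodD_tableE tensor_act1 table_ClinU lincombZ lincombU1 //.
have E2 : deltaR R ^+ arcs S *: lincomb (fun q => table_Clin q.1 T (tensor_act q.2 << b >>) : {malg K[D]}) c
    = lincomb (fun q => prodD R (tdiag q.1 S q.2) (tdiag S T b)) c.
  by rewrite -lincombZl; apply: eq_lincomb => q; rewrite prodD_tableE.
rewrite scalerBr E1 E2 UE lincombD lincomb_lincomb.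
rewrite (eq_lincomb (e' := fun q => prodD R (tdiag q.1 S q.2) (tdiag S T b))); last first.
  by move=> q; rewrite lincombU1.
rewrite [X in X - _]addrC addrK; apply: low_rank_lincomb => Z /lowL lt Z' nz.
exact: leq_ltn_trans (rank_prodD_l nz) lt.
Qed.

Lemma mul_straighten (X : D) r (S : half n B r) :
  exists c : {malg K[(half n B r * r.-tuple B)%type]}, forall (T : half n B r) y,
  low_rank r (mul << X >> (table_Clin S T y) -
         lincomb (fun q => table_Clin q.1 T (tensor_act q.2 y) : {malg K[D]}) c).
Proof.
have [c cP] := prodD_straighten X S; exists c => T.
have actD a y z : tensor_act a (y + z) = tensor_act a y + tensor_act a z :> {malg R[r.-tuple B]}.
  exact: lincombD.
have actZ a d y : tensor_act a (d *: y) = d *: tensor_act a y :> {malg R[r.-tuple B]}.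
  exact: lincombZ.
elim/malg_ind=> [|y z lowy lowz|d b].
- rewrite table_Clin0 (linear_fun0 (tlR_mul_linearr _)) sub0r -lincombNl.
  rewrite (eq_lincomb (e' := fun _ => 0)) ?lincomb0l; first exact: low_rank0.
  by move=> q; rewrite [tensor_act _ 0]lincomb0 table_Clin0 oppr0.
- have E1 : mul << X >> (table_Clin S T (y + z)) =
      mul << X >> (table_Clin S T y) + mul << X >> (table_Clin S T z).
    by rewrite table_ClinD; apply: (linear_funD (tlR_mul_linearr << X >>)).
  have E2 : lincomb (fun q => table_Clin q.1 T (tensor_act q.2 (y + z)) : {malg K[D]}) c =
      lincomb (fun q => table_Clin q.1 T (tensor_act q.2 y) : {malg K[D]}) c
      + lincomb (fun q => table_Clin q.1 T (tensor_act q.2 z) : {malg K[D]}) c.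
    by rewrite -lincombDl; apply: eq_lincomb => q; rewrite actD table_ClinD.
  by rewrite E1 E2; apply: (low_rankDB lowy lowz).
have E1 : mul << X >> (table_Clin S T << d *g b >>) = laurentC d *: prodD R X (tdiag S T b).
  rewrite malgUZ table_ClinZ table_ClinU -tlR_mulUU.
  exact: (linear_funZ _ _ (tlR_mul_linearr << X >>)).
rewrite E1 malgUZ.
rewrite (eq_lincomb (e' := fun q => laurentC d *: (table_Clin q.1 T (tensor_act q.2 << b >>) : {malg K[D]}))); last first.
  by move=> q; rewrite actZ; apply: table_ClinZ.
rewrite lincombZl; apply: low_rankZB; exact: cP.
Qed.

End Straightening.

(** * Tensor powers of a cell datum *)

Section CellPower.
Variables (H : hypergroup) (R : comNzRingType) (D0 : cell_datum (hgR H R)).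
Hypothesis D0P : is_cell_datum (@hgR_mul H R) (hgR_one H R) D0.
Local Notation B := (hg_bas H).
Local Notation cI := (cell_index D0).
Local Notation half_cell := {l : D0 & cd_M l}.

Definition cell0 (c : cI) : {malg R[B]} := cell_elt c.

Definition cell_pow r (c : r.-tuple cI) : {malg R[r.-tuple B]} :=
  tensor (fun i => cell0 (tnth c i)).

Lemma cell_pow_lincomb r (h : 'I_r -> {malg R[cI]}) :
  tensor (fun i => lincomb cell0 (h i)) = lincomb (@cell_pow r) (tensor h).
Proof. exact: (tensor_lincomb (fun _ : 'I_r => cell0)). Qed.

Lemma coord_ex (b : B) : exists f : {malg R[cI]}, lincomb cell0 f == << b >>.
Proof. by have [f [E _]] := cd_C_basis D0P << b >>; exists f; apply/eqP. Qed.

Definition coord0 (b : B) : {malg R[cI]} := xchoose (coord_ex b).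

Lemma coord0K b : lincomb cell0 (coord0 b) = << b >>.
Proof. by apply/eqP; apply: (xchooseP (coord_ex b)). Qed.

Lemma cell0K c : lincomb coord0 (cell0 c) = << c >>.
Proof.
have [f [_ U]] := cd_C_basis D0P (cell0 c).
rewrite -(U (lincomb coord0 (cell0 c))); first by apply: U; apply: lincombU1.
rewrite -[RHS]lincomb_id -[LHS]/(lincomb cell0 _) lincomb_lincomb.
by apply: eq_lincomb => b; apply: coord0K.
Qed.

Definition coord_pow r (b : r.-tuple B) : {malg R[r.-tuple cI]} :=
  tensor (fun i => coord0 (tnth b i)).

Lemma coord_powK r (b : r.-tuple B) : lincomb (@cell_pow r) (coord_pow b) = << b >>.
Proof.
rewrite -cell_pow_lincomb -tensorU1; apply: eq_tensor => i; exact: coord0K.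
Qed.

Lemma cell_powK r (c : r.-tuple cI) : lincomb (@coord_pow r) (cell_pow c) = << c >>.
Proof.
rewrite -(tensor_lincomb (fun _ : 'I_r => coord0)) -tensorU1; apply: eq_tensor => i; exact: cell0K.
Qed.

Lemma lincomb_tag (X Y : choiceType) (F : X -> Y) (P : Y -> Prop) (f : {malg R[X]}) y :
  (forall x, P (F x)) -> (lincomb (fun x => << F x >> : {malg R[Y]}) f)@_y != 0 -> P y.
Proof.
move=> PF; rewrite lincombE => nz.
have [/existsP[x /eqP <-] //|/existsPn nF] := boolP [exists x : msupp f, F (val x) == y].
case/eqP: nz; rewrite big_seq big1 // => x xf.
by rewrite mcoeffU (negPf (nF [` xf]%fset)) mulr0.
Qed.

Section Action.
Variables (r : nat) (a : r.-tuple B) (l : (r.-tupleprod D0)).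
Local Notation Mr := {dffun forall i : 'I_r, cd_M (tnth l i)}.

(** The straightening rule of each tensor factor gives that of the tensor
    product: a product of factors in which one is taken modulo lower cells is
    lower in the product order. *)
Lemma act_cell_pow : exists ra : Mr -> {malg R[Mr]}, forall s t : Mr,
  exists2 f : {malg R[r.-tuple cI]},
    (forall c, f@_c != 0 -> ([tuple tag (tnth c i) | i < r] < l :> r.-tupleprod D0)%O) &
    tensor_act a (tensor (fun i => cd_C (s i) (t i) : {malg R[B]})) =
    lincomb (fun s' : Mr => tensor (fun i => cd_C (s' i) (t i) : {malg R[B]})) (ra s)
      + lincomb (@cell_pow r) f.
Proof.
have ex i : exists ra : cd_M (tnth l i) -> {malg R[cd_M (tnth l i)]}, forall S T,
    lower_cells (tnth l i) (@hgR_mul H R << tnth a i >> (cd_C S T)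
       - lincomb (fun S' => cd_C S' T) (ra S)).
  exact: (cd_C3 D0P).
have [ra raP] := fin_all_exists ex.
pose g (s : Mr) i : {malg R[half_cell]} :=
  lincomb (fun s' : cd_M (tnth l i) => << Tagged (fun l : D0 => cd_M l) s' >>) (ra i (s i)).
(* Tuples of half cells are read as families indexed by l; those which do not
   have the right tags do not occur. *)
pose fam (s : Mr) (u : r.-tuple half_cell) : Mr :=
  finfun (fun i => tagged_as (Tagged (fun l : D0 => cd_M l) (s i)) (tnth u i)).
exists (fun s => lincomb (fun u => << fam s u >>) (tensor (g s))) => s t.
have exf i : exists f : {malg R[cI]}, (forall x, x \in msupp f -> (tag x < tnth l i)%O) /\
    @hgR_mul H R << tnth a i >> (cd_C (s i) (t i))
      = lincomb (fun S' => cd_C S' (t i)) (ra i (s i)) + lincomb cell0 f.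
  have [f fP E] := raP i (s i) (t i); exists f; split=> //.
  by rewrite -[RHS]addrC -E subrK.
have [f fP] := fin_all_exists exf.
pose h i : {malg R[cI]} :=
  lincomb (fun s' => << Tagged (fun l : D0 => (cd_M l * cd_M l)%type) (s', t i) >>) (ra i (s i)).
have hE i : lincomb cell0 (h i) = lincomb (fun S' => cd_C S' (t i)) (ra i (s i)).
  rewrite lincomb_lincomb; apply: eq_lincomb => s'; exact: lincombU1.
exists (tensor (fun i => h i + f i) - tensor h).
  move=> c; rewrite mcoeffB !tensor_coef subr_eq0 => nz.
  have fc i : (f i)@_(tnth c i) != 0 -> (tag (tnth c i) < tnth l i)%O.
    by move=> fz; apply: (fP i).1; rewrite -mcoeff_neq0.
  have hc i : (h i)@_(tnth c i) != 0 -> tag (tnth c i) = tnth l i.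
    by apply: (lincomb_tag (P := fun y => tag y = tnth l i)).
  rewrite ltEtprod; apply/andP; split.
    apply: contraNT nz => /existsPn nlt; apply/eqP; apply: eq_bigr => i _.
    rewrite mcoeffD; have [->|/fc] := eqVneq (f i)@_(tnth c i) 0; first by rewrite addr0.
    by have := nlt i; rewrite tnth_mktuple => /negPf->.
  apply/forallP=> i; rewrite tnth_mktuple; apply: contraNT nz => nle.
  have f0 : (f i)@_(tnth c i) = 0.
    by apply/eqP; apply: contraNT nle => /fc/ltW.
  have h0 : (h i)@_(tnth c i) = 0.
    by apply/eqP; apply: contraNT nle => /hc->.
  by rewrite (bigD1 i) //= (bigD1 i (P := predT)) //= mcoeffD f0 h0 addr0 !mul0r.
rewrite tensor_act_tensor lincombB -!cell_pow_lincomb.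
have -> : tensor (fun i => @hgR_mul H R << tnth a i >> (cd_C (s i) (t i))) =
    tensor (fun i => lincomb cell0 (h i + f i)).
  by apply: eq_tensor => i; rewrite (fP i).2 lincombD hE.
rewrite [RHS]addrC -[LHS]subr0 -[RHS]addrA; congr (_ + _).
rewrite addrC -opprB; congr (- _); rewrite [X in _ = _ - X]lincomb_lincomb.
have -> : lincomb (fun u => lincomb (fun s' : Mr => tensor (fun i => cd_C (s' i) (t i) : {malg R[B]}))
     << fam s u >>) (tensor (g s)) = tensor (fun i => lincomb cell0 (h i)); last by rewrite subrr.
rewrite (eq_lincomb (e' := fun u : r.-tuple half_cell => tensor (fun i =>
    cd_C (tagged_as (Tagged (fun l : D0 => cd_M l) (s i)) (tnth u i)) (t i) : {malg R[B]}))).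
  rewrite -(tensor_lincomb (fun i x =>
    cd_C (tagged_as (Tagged (fun l : D0 => cd_M l) (s i)) x) (t i) : {malg R[B]})).
  apply: eq_tensor => i; rewrite hE /g lincomb_lincomb; apply: eq_lincomb => s'.
  by rewrite lincombU1 tagged_asE.
by move=> u; rewrite lincombU1; apply: eq_tensor => i; rewrite ffunE.
Qed.

End Action.

(** The tags of the factors of a cell of the tensor power are collected in l, on which
    the types of its other components depend. *)
Lemma cell_tuple r (c : r.-tuple cI) (l : r.-tupleprod D0) :
  (forall i, tnth l i = tag (tnth c i)) ->
  exists st : {dffun forall i : 'I_r, cd_M (tnth l i)} * {dffun forall i : 'I_r, cd_M (tnth l i)},
  forall i, tnth c i = Tagged (fun l : D0 => (cd_M l * cd_M l)%type) (st.1 i, st.2 i).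
Proof.
move=> lE; have ex i : exists st : (cd_M (tnth l i) * cd_M (tnth l i))%type,
    tnth c i = Tagged (fun l : D0 => (cd_M l * cd_M l)%type) st.
  by rewrite lE; exists (tagged (tnth c i)); rewrite taggedK.
have [st stP] := fin_all_exists ex.
exists (finfun (fun i => (st i).1), finfun (fun i => (st i).2)) => i /=.
by rewrite !ffunE stP; case: (st i).
Qed.

End CellPower.

(** * The cells of the diagram algebra *)

Section Cells.
Variables (n : nat) (H : hypergroup) (R : comNzRingType) (D0 : cell_datum (hgR H R)).
Variable gB : hg_bas H -> hg_bas H.
Hypothesis D0P : is_cell_datum (@hgR_mul H R) (hgR_one H R) D0.
Hypothesis gK : involutive gB.
Local Notation B := (hg_bas H).
Local Notation D := (diagram n B).
Local Notation K := (laurent R).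
Local Notation cI := (cell_index D0).
Local Notation dtl := (tl_cell_datum n D0 gB).
Local Notation table_idx r := (half n B (val r) * half n B (val r) * (val r).-tuple B)%type.
Local Notation cell_idx r := (half n B (val r) * half n B (val r) * (val r).-tuple cI)%type.

Lemma map_halfE r (S : half n B r) i :
  val (map_half gB S) i = omap (fun kb => (kb.1, gB kb.2)) (val S i).
Proof. by rewrite SubK ffunE. Qed.

Lemma map_halfK r : involutive (@map_half n B gB r).
Proof.
move=> S; apply: val_inj; apply/ffunP=> i; rewrite !map_halfE.
by case: (val S i) => [[k b]|] //=; rewrite gK.
Qed.

(** Cells of the diagram algebra in which the tag of each tensor factor is stored
    with that factor, so that no type depends on a tuple of tags. *)
Definition cell_ix := {r : table_index n & cell_idx r}.
Definition mk_cell_ix (r : table_index n) (q : cell_idx r) : cell_ix :=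
  Tagged (fun r : table_index n => cell_idx r) q.
Arguments mk_cell_ix : clear implicits.

(** The second half diagram is twisted as in the definition of the cells. *)
Definition table_cell (q : cell_ix) : {malg K[D]} :=
  table_Clin (tagged q).1.1 (map_half gB (tagged q).1.2) (@cell_pow H R D0 _ (tagged q).2).

Lemma table_cellE (r : table_index n) (S T : half n B (val r)) c :
  table_cell (mk_cell_ix r (S, map_half gB T, c)) = table_Clin S T (@cell_pow H R D0 _ c).
Proof. by rewrite /table_cell /= map_halfK. Qed.

Lemma table_ix_ex Z : exists q : table_ix n H, tdiag_ix q == Z.
Proof. by have [q <-] := tdiag_ix_surj Z; exists q. Qed.

Definition table_ix_of (Z : D) : table_ix n H := xchoose (table_ix_ex Z).

Lemma table_ix_ofK Z : tdiag_ix (table_ix_of Z) = Z.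
Proof. by apply/eqP; apply: (xchooseP (table_ix_ex Z)). Qed.

Lemma tdiag_ixK q : table_ix_of (tdiag_ix q) = q.
Proof. by apply: tdiag_ix_inj; rewrite table_ix_ofK. Qed.

Definition cell_coord_ix (q : table_ix n H) : {malg K[cell_ix]} :=
  lincomb (fun c => << mk_cell_ix (tag q) ((tagged q).1.1, map_half gB (tagged q).1.2, c) >>)
    (base_change (@laurentC R) (coord_pow D0P (tagged q).2)).

Definition cell_coord (f : {malg K[D]}) : {malg K[cell_ix]} :=
  lincomb (fun Z => cell_coord_ix (table_ix_of Z)) f.

Lemma cell_coordK f : lincomb table_cell (cell_coord f) = f.
Proof.
rewrite lincomb_lincomb -[RHS]lincomb_id; apply: eq_lincomb => Z.
rewrite -[in RHS](table_ix_ofK Z); case: (table_ix_of Z) => r [[S T] b]; rewrite /cell_coord_ix /=.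
rewrite lincomb_lincomb.
transitivity (table_Clin S T (lincomb (@cell_pow H R D0 _) (coord_pow D0P b))).
  rewrite table_Clin_lincomb; apply: eq_lincomb => c.
  by rewrite lincombU1; apply: table_cellE.
by rewrite coord_powK table_ClinU.
Qed.

Lemma cell_coord_cell q : cell_coord (table_cell q) = << q >>.
Proof.
case: q => r [[S T] c]; rewrite /table_cell /= table_ClinE /cell_coord lincomb_lincomb.
pose mk c' : {malg K[cell_ix]} := << mk_cell_ix r (S, T, c') >>.
transitivity (lincomb mk (base_change (@laurentC R)
    (lincomb (@coord_pow H R D0 D0P _) (@cell_pow H R D0 _ c)))).
  rewrite base_change_lincomb lincomb_lincomb; apply: eq_lincomb => b.
  pose q : table_ix n H := Tagged (fun r : table_index n => table_idx r) (S, map_half gB T, b).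
  rewrite lincombU1 -[tdiag _ _ _]/(tdiag_ix q) tdiag_ixK /cell_coord_ix /=.
  by apply: eq_lincomb => c'; rewrite map_halfK.
by rewrite cell_powK base_change_laurentU lincombU1.
Qed.

(** The table basis is indexed by pairs of half diagrams and by the basis of the
    tensor power, which can be exchanged for the basis of tensor cells. *)
Lemma table_cell_basis : is_basis table_cell.
Proof.
apply: (is_basisP (phi := cell_coord)).
- exact: lincomb_linear.
- exact: cell_coord_cell.
exact: cell_coordK.
Qed.

Definition cell_tags r (c : r.-tuple cI) : r.-tupleprod D0 := [tuple tag (tnth c i) | i < r].

Definition ix_tag (q : cell_ix) : tl_poset n D0 :=
  Tagged (fun r : table_index n => ((val r).-tupleprod D0 : Type)) (cell_tags (tagged q).2).

Definition flat_cell (y : cell_index dtl) : cell_ix :=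
  let: existT x (Ss, Tt) := y in
  mk_cell_ix (tag x) (Ss.1, Tt.1, [tuple Tagged (fun l : D0 => (cd_M l * cd_M l)%type) (Ss.2 i, Tt.2 i) | i < val (tag x)]).

Lemma flat_cellE y : cell_elt y = table_cell (flat_cell y).
Proof.
case: y => x [Ss Tt]; rewrite /table_cell /cell_elt /=; congr table_Clin.
by apply: eq_tensor => i; rewrite tnth_mktuple.
Qed.

Lemma flat_cell_inj : injective flat_cell.
Proof.
move=> [[r l] [[S s] [T t]]] [[r' l'] [[S' s'] [T' t']]] /= E.
have rr : r = r' by have := congr1 tag E.
move: rr l' S' s' T' t' E => <- l' S' s' T' t' E0.
have E := @eq_from_Tagged _ (fun r : table_index n => cell_idx r) r _ _ E0.
have ES : S = S' := congr1 (fun q => q.1.1) E.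
have ET : T = T' := congr1 (fun q => q.1.2) E.
move: ES ET E {E0} => <- <- E.
have Ei i := congr1 (fun q => tnth q.2 i) E; rewrite /= in Ei.
have ll : l = l'.
  by apply: eq_from_tnth => i; have := congr1 tag (Ei i); rewrite !tnth_mktuple.
move: ll s' t' {E} Ei => <- s' t' Ei.
have st i : s i = s' i /\ t i = t' i.
  have E := Ei i; rewrite !tnth_mktuple in E.
  have E2 := @eq_from_Tagged _ (fun l : D0 => (cd_M l * cd_M l)%type) _ _ _ E.
  by split; [apply: (congr1 fst E2)|apply: (congr1 snd E2)].
have -> : s = s' by apply/ffunP=> i; case: (st i).
by have -> : t = t' by apply/ffunP=> i; case: (st i).
Qed.

Lemma flat_cell_surj q : exists2 y, flat_cell y = q & tag y = ix_tag q.
Proof.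
case: q => r [[S T] c]; have lE i : tnth (cell_tags c) i = tag (tnth c i) by rewrite tnth_mktuple.
have [[s t] stP] := cell_tuple lE.
exists (existT (fun x : dtl => (cd_M x * cd_M x)%type) (ix_tag (mk_cell_ix r (S, T, c))) ((S, s), (T, t))) => //=.
congr (mk_cell_ix r (_, _, _)); apply: eq_from_tnth => i; rewrite tnth_mktuple; exact: esym (stP i).
Qed.

Lemma tl_cell_basis : is_basis (@cell_elt _ _ dtl).
Proof.
have flat_surj q : exists y, flat_cell y = q by have [y E _] := flat_cell_surj q; exists y.
have := basis_bij table_cell_basis flat_cell_inj flat_surj.
move=> bas v; have [f [E U]] := bas v.
have EE g : lincomb (@cell_elt _ _ dtl) g = lincomb (table_cell \o flat_cell) g.
  by apply: eq_lincomb => y; apply: flat_cellE.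
exists f; split=> [|g gE]; first exact: etrans (EE f) E.
by apply: U; apply: etrans (esym (EE g)) gE.
Qed.

End Cells.

(** * Finiteness *)

Definition has_enum (T : eqType) := exists s : seq T, forall x, x \in s.

Lemma has_enum_pair (T U : eqType) : has_enum T -> has_enum U -> has_enum (T * U)%type.
Proof.
move=> [s sP] [u uP]; exists [seq (x, y) | x <- s, y <- u] => -[x y].
by apply/allpairsP; exists (x, y); rewrite sP uP.
Qed.

Lemma has_enum_option (T : eqType) : has_enum T -> has_enum (option T).
Proof.
move=> [s sP]; exists (None :: map Some s) => -[x|] //.
by rewrite inE (mem_map (@Some_inj _)) sP orbT.
Qed.

Lemma has_enum_sub (T : choiceType) (P : pred T) : has_enum T -> has_enum {x : T | P x}.
Proof. by move=> [s sP]; exists (pmap insub s) => x; rewrite mem_pmap_sub sP. Qed.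

Lemma has_enum_dffun (I : finType) (T : I -> choiceType) :
  (forall i, has_enum (T i)) -> has_enum {dffun forall i, T i}.
Proof.
move=> Tfin; have [s sP] := fin_all_exists Tfin.
exists [seq finfun (fun i => val (f i)) | f : {dffun forall i, seq_sub (s i)}] => f.
apply/mapP; exists (finfun (fun i => SeqSub (sP i (f i)))); first by rewrite mem_enum.
by apply/ffunP=> i; rewrite !ffunE.
Qed.

Lemma has_enum_sigma (I : finType) (T : I -> eqType) :
  (forall i, has_enum (T i)) -> has_enum {i : I & T i}.
Proof.
move=> Tfin; have [s sP] := fin_all_exists Tfin.
exists [seq Tagged T x | i <- enum I, x <- s i] => -[i x].
by apply/allpairsPdep; exists i, x; rewrite mem_enum sP.
Qed.

Section Finiteness.
Variables (n : nat) (H : hypergroup) (R : comNzRingType) (D0 : cell_datum (hgR H R)).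
Hypothesis D0P : is_cell_datum (@hgR_mul H R) (hgR_one H R) D0.
Local Notation B := (hg_bas H).

(** A finite family cannot span the free module on an infinite set. *)
Lemma basis_has_enum : has_enum B.
Proof.
have [s sP] : has_enum (cell_index D0).
  by apply: has_enum_sigma => l; apply: has_enum_pair; apply: (cd_finM D0P).
exists [seq b | c <- s, b <- enum_fset (msupp (cell0 c))] => b.
apply/allpairsPdep.
have : (lincomb (@cell0 H R D0) (coord0 D0P b))@_b != 0 by rewrite coord0K mcoeffU eqxx oner_eq0.
rewrite lincombE; have [/existsP[c cb] _|/existsPn nc] :=
  boolP [exists c : msupp (coord0 D0P b), b \in msupp (cell0 (val c))].
  by exists (val c), b; rewrite sP.
rewrite big_seq big1 ?eqxx // => c cs.
by rewrite (mcoeff_outdom (nc [` cs]%fset)) mulr0.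
Qed.

Lemma half_has_enum r : has_enum (half n B r).
Proof.
apply: has_enum_sub; apply: (@has_enum_dffun _ (fun _ => option ('I_n * B))) => _.
apply: has_enum_option; apply: has_enum_pair; last exact: basis_has_enum.
by exists (enum 'I_n) => i; rewrite mem_enum.
Qed.

Lemma tl_M_has_enum (x : tl_poset n D0) : has_enum (tl_M x).
Proof.
apply: has_enum_pair; first exact: half_has_enum.
by apply: has_enum_dffun => i; apply: (cd_finM D0P).
Qed.

End Finiteness.

(** * The straightening rule *)

Section LowerCells.
Variables (K : comNzRingType) (V : lmodType K) (C : cell_datum V) (l : C).

Lemma lower0 : lower_cells l 0.
Proof. by exists 0 => [x|]; rewrite ?lincomb0 // -mcoeff_neq0 mcoeff0 eqxx. Qed.

Lemma lowerD u v : lower_cells l u -> lower_cells l v -> lower_cells l (u + v).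
Proof.
move=> [f fP ->] [g gP ->]; exists (f + g) => [x|]; last by rewrite lincombD.
rewrite -mcoeff_neq0 mcoeffD => nz; have [/fP//|f0] := boolP (x \in msupp f).
by apply: gP; rewrite -mcoeff_neq0; apply: contraNneq nz => ->; rewrite addr0 (mcoeff_outdom f0).
Qed.

Lemma lowerZ c v : lower_cells l v -> lower_cells l (c *: v).
Proof.
move=> [f fP ->]; exists (c *: f) => [x|]; last by rewrite lincombZ.
rewrite -mcoeff_neq0 mcoeffZ => nz; apply: fP; rewrite -mcoeff_neq0.
by apply: contraNneq nz => ->; rewrite mulr0.
Qed.

Lemma lower_lincomb (X : choiceType) (e : X -> V) f :
  (forall x, f@_x != 0 -> lower_cells l (e x)) -> lower_cells l (lincomb e f).
Proof.
move=> le; rewrite lincomb_sum big_seq; elim/big_ind: _ => [|g h|x xf].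
- exact: lower0.
- exact: lowerD.
by apply: lowerZ; apply: le; rewrite mcoeff_neq0.
Qed.

Lemma lower_elt (x : cell_index C) : (tag x < l)%O -> lower_cells l (cell_elt x).
Proof.
move=> lt; exists << x >> => [y|]; last by rewrite lincombU1.
by rewrite -mcoeff_neq0 mcoeffU; have [<- //|_] := eqVneq x y; rewrite mulr0n eqxx.
Qed.

(** The third axiom of cell data, for a family u of elements indexed by the column
    index. Such families form a submodule, so the axiom can be checked on the basis
    diagrams. *)
Definition straight (u : cd_M l -> V) := exists rho : {malg K[cd_M l]}, forall T,
  lower_cells l (u T - lincomb (fun S' => cd_C S' T) rho).

Lemma eq_straight u v : u =1 v -> straight u -> straight v.
Proof. by move=> E [rho rhoP]; exists rho => T; rewrite -E. Qed.

Lemma straight_lower u : (forall T, lower_cells l (u T)) -> straight u.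
Proof. by move=> lu; exists 0 => T; rewrite lincomb0 subr0. Qed.

Lemma straightD u v : straight u -> straight v -> straight (fun T => u T + v T).
Proof.
move=> [p pP] [q qP]; exists (p + q) => T.
by rewrite lincombD opprD addrACA; apply: lowerD.
Qed.

Lemma straightZ c u : straight u -> straight (fun T => c *: u T).
Proof. by move=> [p pP]; exists (c *: p) => T; rewrite lincombZ -scalerBr; apply: lowerZ. Qed.

Lemma straight_lincomb (X : choiceType) (e : X -> cd_M l -> V) (f : {malg K[X]}) :
  (forall x, straight (e x)) -> straight (fun T => lincomb (e^~ T) f).
Proof.
move=> se; elim/malg_ind: f => [|f g sf sg|c x].
- by apply: straight_lower => T; rewrite lincomb0; apply: lower0.
- by apply: eq_straight (straightD sf sg) => T; rewrite lincombD.
by apply: eq_straight (straightZ c (se x)) => T; rewrite lincombU.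
Qed.

End LowerCells.

Section Straighten.
Variables (n : nat) (H : hypergroup) (R : comNzRingType) (D0 : cell_datum (hgR H R)).
Variable gB : hg_bas H -> hg_bas H.
Hypothesis D0P : is_cell_datum (@hgR_mul H R) (hgR_one H R) D0.
Hypothesis gK : involutive gB.
Local Notation B := (hg_bas H).
Local Notation dtl := (tl_cell_datum n D0 gB).
Local Notation mul := (@tlR_mul n H R).

Lemma lower_table_cell (x : dtl) (q : cell_ix n D0) : (ix_tag q < x)%O -> lower_cells x (table_cell gB q).
Proof.
have [y <- <-] := flat_cell_surj gB q; rewrite -flat_cellE; exact: (@lower_elt _ (tlR n H R) dtl x y).
Qed.

(** Losing propagating edges lowers the first component of the lexicographic order. *)
Lemma low_rank_lower (x : dtl) f : low_rank (val (tag x)) f -> lower_cells x f.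
Proof.
move=> lf; rewrite -[f]lincomb_id; apply: lower_lincomb => Z /lf lt.
move: lt; rewrite -[in lower_cells _ _](cell_coordK D0P gK << Z >>) -[Z in rank Z](table_ix_ofK Z) => lt.
rewrite /cell_coord lincombU1 lincomb_lincomb; apply: lower_lincomb => c _; rewrite lincombU1.
apply: lower_table_cell; move: lt; rewrite /tdiag_ix rank_tdiag => lt.
have lt' : (tag (table_ix_of Z) < tag x)%O by [].
by rewrite /ix_tag ltEsig /= (ltW lt') leNgt lt'.
Qed.

(** The labels of the propagating edges are straightened in the tensor power: the
    error has the same number of propagating edges, and lowers the second component
    of the lexicographic order. *)
Lemma lower_act (x : dtl) (a : (val (tag x)).-tuple B) (S1 : half n B (val (tag x)))
    (s : {dffun forall i : 'I_(val (tag x)), cd_M (tnth (tagged x) i)}) :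
  straight (fun T : cd_M x => table_Clin S1 (map_half gB T.1) (tensor_act a (power_C s T.2)) : tlR n H R).
Proof.
have [ra raP] := act_cell_pow D0P a (tagged x).
exists (lincomb (fun s' => << (S1, s') : cd_M x >>) (base_change (@laurentC R) (ra s))) => T.
have [f fP E] := raP s T.2; rewrite /power_C E table_ClinD table_Clin_lincomb lincomb_lincomb.
rewrite [X in _ - X](eq_lincomb (e' := fun s' => table_Clin S1 (map_half gB T.1)
    (power_C s' T.2) : tlR n H R)); last first.
  by move=> s'; rewrite lincombU1.
rewrite addrC addKr table_Clin_lincomb; apply: lower_lincomb => c.
rewrite base_changeE => nz; apply: (@lower_table_cell x (@mk_cell_ix n H R D0 (tag x) (S1, T.1, c))).
rewrite /ix_tag lt_Taggedl; apply: fP; apply: contraNneq nz => ->; exact/eqP/raddf0.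
Qed.

Lemma tl_straighten (a : tlR n H R) (x : dtl) (S : cd_M x) :
  straight (fun T : cd_M x => mul a (cd_C S T)).
Proof.
case: S => S0 s.
apply: (eq_straight (u := fun T : cd_M x =>
    lincomb (fun X => mul << X >> (cd_C ((S0, s) : cd_M x) T)) a)) => [T|].
  exact/esym/(linear_malgE (tlR_mul_linearl _)).
apply: straight_lincomb => X; have [c cP] := mul_straighten R X S0.
pose v q (T : cd_M x) : tlR n H R := table_Clin q.1 (map_half gB T.1) (tensor_act q.2 (power_C s T.2)).
apply: (eq_straight (u := fun T : cd_M x =>
    (mul << X >> (cd_C ((S0, s) : cd_M x) T) - lincomb (v^~ T) c) + lincomb (v^~ T) c)) => [T|].
  exact: subrK.
apply: straightD; first by apply: straight_lower => T; apply: low_rank_lower; apply: cP.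
apply: straight_lincomb => q; exact: lower_act.
Qed.

End Straighten.

(** * The anti-involution and the theorem *)

Section Star.
Variables (n : nat) (H : hypergroup) (R : comNzRingType).
Variables (psi : H -> H) (psiB : hg_bas H -> hg_bas H).
Variables (g : H -> H) (gB : hg_bas H -> hg_bas H).
Hypothesis psiP : is_based_antiaut (@hg_emb H) psi psiB.
Hypothesis gP : is_based_aut (@hg_emb H) g gB.
Hypothesis psi_g : psi =1 @hg_bar H \o g.
Hypothesis psiK : involutive psiB.
Local Notation B := (hg_bas H).
Local Notation D := (diagram n B).
Local Notation emb := (@hg_emb H).
Local Notation bar := (@hg_barB H).
Local Notation K := (laurent R).

Lemma based_antiautE b : psiB b = bar (gB b).
Proof.
apply: hg_emb_inj; rewrite -(bna_basis psiP) psi_g /= (ba_basis gP).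
exact: (bna_basis (hg_bar_antiaut H)).
Qed.

(** The conjugate of b is the only basis element whose product with b has a
    nonzero trace, and automorphisms preserve the trace. *)
Lemma based_aut_bar b : gB (bar b) = bar (gB b).
Proof.
have tr := based_map_trace (ba_add gP) (ba_one gP) (ba_basis gP) (bij_inj (ba_bijB gP)).
have := tr (emb (bar b) * emb b).
rewrite (ba_mul gP) !(ba_basis gP) !hg_trace_emb eqxx.
by case: eqP.
Qed.

(** As g commutes with the conjugation, psi being an involution makes g one. *)
Lemma based_aut_involutive : involutive gB.
Proof. by move=> b; rewrite -[RHS]psiK !based_antiautE based_aut_bar hg_barBK. Qed.

Let psi_bar b : psiB (bar b) = bar (psiB b).
Proof. by rewrite !based_antiautE based_aut_bar. Qed.

Lemma dmatch_map (X : D) : dmatch (map_diagram gB X) = dmatch X.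
Proof. by rewrite {1}/dmatch SubK. Qed.

Lemma dlabel_map (X : D) p : dlabel (map_diagram gB X) p = gB (dlabel X p).
Proof. by rewrite {1}/dlabel SubK /= ffunE. Qed.

Lemma reflect_map (X : D) : reflect_diagram bar (map_diagram gB X) = reflect_diagram psiB X.
Proof.
apply: diagram_eqP => [|p _].
  by apply/ffunP=> p; rewrite !dmatch_reflect dmatch_map.
by rewrite !dlabel_reflect dlabel_map based_antiautE.
Qed.

Lemma map_reflect (X : D) : map_diagram gB (reflect_diagram bar X) = reflect_diagram psiB X.
Proof.
apply: diagram_eqP => [|p _].
  by apply/ffunP=> p; rewrite dmatch_map !dmatch_reflect.
by rewrite dlabel_map !dlabel_reflect based_antiautE based_aut_bar.
Qed.

Lemma star_alphaE : @tlR_star n H R \o @tlR_alpha n H R gB =1 @reflR n H R psiB.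
Proof.
move=> f; rewrite /= /tlR_star /tlR_alpha lincomb_lincomb; apply: eq_lincomb => X.
by rewrite lincombU1 reflect_map.
Qed.

Lemma alpha_starE : @tlR_alpha n H R gB \o @tlR_star n H R =1 @reflR n H R psiB.
Proof.
move=> f; rewrite /= /tlR_star /tlR_alpha lincomb_lincomb; apply: eq_lincomb => X.
by rewrite lincombU1 map_reflect.
Qed.

Lemma free_map_half r (S : half n B r) : free_points (map_half gB S) = free_points S.
Proof. by apply: eq_filter => i; rewrite map_halfE; case: (val S i). Qed.

(** Reflection exchanges the two halves. The definition of the table basis
    conjugates the labels of the second one, and psi applies the conjugation and g:
    on one side the conjugations cancel and g remains, on the other g is cancelled
    by the twist of the second half. *)
Lemma reflect_tdiag r (S T : half n B r) b :
  reflect_diagram psiB (tdiag S (map_half gB T) b)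
    = tdiag T (map_half gB S) [tuple psiB (tnth b i) | i < r].
Proof.
have prop k : (k < r)%N ->
    psiB (prop_label b k) = prop_label [tuple psiB (tnth b i) | i < r] k.
  move=> kr; rewrite /prop_label -[k]/(val (Ordinal kr)) -!tnth_nth tnth_mktuple.
  by case: odd; rewrite ?psi_bar.
apply: diagram_eqP => [|p _].
  apply/ffunP=> p; rewrite dmatch_reflect !dmatch_tdiag -table_match_rev.
  elim/top_bot_ind: p => i; rewrite ?table_match_top ?table_match_bot ?free_map_half map_halfE.
    by case: (val T i) => [[]|] /=.
  by case: (val S i) => [[]|] /=.
rewrite dlabel_reflect !dlabel_tdiag; elim/top_bot_ind: p => i; rewrite ?rev_top ?rev_bot.
  rewrite table_label_top table_label_bot map_halfE free_map_half.
  case Ti: (val T i) => [[k c]|] /=; last by rewrite prop ?index_free.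
  by rewrite psi_bar based_antiautE hg_barBK based_aut_involutive.
rewrite table_label_top table_label_bot map_halfE free_map_half.
case Si: (val S i) => [[k c]|] /=; last by rewrite prop ?index_free.
exact: based_antiautE.
Qed.

Lemma reflR_Clin r (S T : half n B r) (y : 'I_r -> {malg R[B]}) :
  reflR psiB (table_Clin S (map_half gB T) (tensor y))
    = table_Clin T (map_half gB S) (tensor (fun i => hgR_map psiB (y i : hgR H R))) :> {malg K[D]}.
Proof.
rewrite (tensor_lincomb (fun _ b => << psiB b >>)) table_Clin_lincomb.
rewrite table_ClinE /reflR lincomb_lincomb; apply: eq_lincomb => b.
rewrite lincombU1 reflect_tdiag -table_ClinU; congr table_Clin.
rewrite tensorU big1 //; congr << _ *g _ >>.
Qed.

Variable D0 : cell_datum (hgR H R).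
Hypothesis D0P : is_cell_datum (@hgR_mul H R) (hgR_one H R) D0.
Hypothesis D0_star : cd_star D0 =1 @hgR_map H R psiB.

Lemma tl_cell_datumP :
  is_cell_datum (@tlR_mul n H R) (tlR_one n H R) (tl_cell_datum n D0 gB).
Proof.
have gK := based_aut_involutive.
have starE : cd_star (tl_cell_datum n D0 gB) =1 @reflR n H R psiB := star_alphaE.
split.
- exact: tlR_algebra.
- by move=> x; apply: tl_M_has_enum.
- exact: basis_inj (tl_cell_basis D0P gK).
- exact: tl_cell_basis.
- by move=> c u v; rewrite !starE; apply: lincomb_linear.
- by move=> u; rewrite !starE; apply: reflRK.
- by move=> u v; rewrite !starE; apply: (reflR_antimul psiP psiK).
- move=> x [S s] [T t]; rewrite starE /cd_C /= [LHS]reflR_Clin.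
  congr table_Clin; apply: eq_tensor => i; rewrite -D0_star; exact: (cd_star_C D0P).
move=> a x; have [M MP] := tl_M_has_enum D0P x.
apply: (@finite_choice _ {malg laurent R[cd_M x]} 0 (fun S rho => forall T : cd_M x,
  lower_cells x (tlR_mul a (cd_C S T) - lincomb (fun S' : cd_M x => cd_C S' T) rho)) M MP) => S.
exact: (tl_straighten D0P gK a S).
Qed.

End Star.

Theorem theorem4p1p3 (R : comNzRingType) (n : nat) (H : hypergroup)
    (psi : H -> H) (psiB : hg_bas H -> hg_bas H)
    (psi_antiaut : is_based_antiaut (@hg_emb H) psi psiB)
    (D0 : cell_datum (hgR H R))
    (D0_cell : is_cell_datum (@hgR_mul H R) (hgR_one H R) D0)
    (D0_star : cd_star D0 =1 @hgR_map H R psiB) :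
  cellular (@tlR_mul n H R) (tlR_one n H R)
  /\ forall (g : H -> H) (gB : hg_bas H -> hg_bas H),
       is_based_aut (@hg_emb H) g gB ->
       psi =1 @hg_bar H \o g ->
       is_cell_datum (@tlR_mul n H R) (tlR_one n H R) (tl_cell_datum n D0 gB)
       /\ @tlR_star n H R \o @tlR_alpha n H R gB
            =1 @tlR_alpha n H R gB \o @tlR_star n H R.
Proof.
have psiK : involutive psiB.
  have U b : hgR_map psiB (<< b >> : hgR H R) = << psiB b >> by apply: lincombU1.
  move=> b; have /malgP/(_ b) := cd_star_invol D0_cell << b >>.
  rewrite !D0_star U [hgR_map _ _]U !mcoeffU eqxx.
  by case: eqP => // _ /eqP; rewrite eq_sym oner_eq0.
split=> [|g gB gP psi_g]; last first.
  split; first exact: (tl_cell_datumP n psi_antiaut gP psi_g psiK D0_cell D0_star).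
  move=> f; apply: etrans (star_alphaE psi_antiaut gP psi_g f) _.
  exact: esym (alpha_starE psi_antiaut gP psi_g f).
(* The first claim needs some g: the conjugation after psi. *)
have barP := hg_bar_antiaut H.
have gP : is_based_aut (@hg_emb H) (@hg_bar H \o psi) (@hg_barB H \o psiB).
  split=> [x y|x y||||b] /=.
  - by rewrite (bna_add psi_antiaut) (bna_add barP).
  - by rewrite (bna_mul psi_antiaut) (bna_mul barP).
  - by rewrite (bna_one psi_antiaut) (bna_one barP).
  - by apply: bij_comp; [apply: bna_bij barP|apply: bna_bij psi_antiaut].
  - by apply: bij_comp; [apply: bna_bijB barP|apply: bna_bijB psi_antiaut].
  by rewrite (bna_basis psi_antiaut) (bna_basis barP).
have psi_g : psi =1 @hg_bar H \o (@hg_bar H \o psi) by move=> x; rewrite /= hg_bar_invol.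
exists (tl_cell_datum n D0 (@hg_barB H \o psiB)).
exact: (tl_cell_datumP n psi_antiaut gP psi_g psiK D0_cell D0_star).
Qed.
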